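(* Let $\lambda>0$. The predual of $\mathrm{bmo}(\mathbb{R}_\lambda)$ is $h^1(\mathbb{R}_\lambda)$; that is, the dual space of $h^1(\mathbb{R}_\lambda)$ is $\mathrm{bmo}(\mathbb{R}_\lambda)$ (with equivalent norms).
   Context: Fix $\lambda>0$. $\mathbb{R}_+=(0,\infty)$, $dm_\lambda(x)=x^{2\lambda}\,dx$, $d\mu_\lambda(x_1,x_2)=dm_\lambda(x_1)\,dm_\lambda(x_2)$, and $\mathbb{R}_\lambda=(\mathbb{R}_+\times\mathbb{R}_+,d\mu_\lambda)$. A rectangle is a product $R=I\times J$ of bounded intervals in $\mathbb{R}_+$. An $\infty$-atom is a function $a\in L^\infty(\mathbb{R}_\lambda)$ supported on a rectangle $R$ with $\|a\|_{L^\infty(\mathbb{R}_\lambda)}\le\mu_\lambda(R)^{-1}$ and $\int a\,d\mu_\lambda=0$. The little Hardy space $h^1(\mathbb{R}_\lambda)=h^{1,\infty}(\mathbb{R}_\lambda)$ is the set of functions $f=\sum_i\alpha_ia_i$ (convergence in $L^1(\mathbb{R}_\lambda)$) with $a_i$ $\infty$-atoms, $\alpha_i\in\mathbb{C}$, $\sum_i|\alpha_i|<\infty$, with norm $\inf\sum_i|\alpha_i|$ over all such decompositions. Little bmo: $b\in L^1_{loc}(\mathbb{R}_\lambda)$ is in $\mathrm{bmo}(\mathbb{R}_\lambda)$ if $$\|b\|_{\mathrm{bmo}(\mathbb{R}_\lambda)}:=\sup_{R}\frac1{\mu_\lambda(R)}\iint_R|b-m_R(b)|\,d\mu_\lambda<\infty,\qquad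 m_R(b)=\frac1{\mu_\lambda(R)}\iint_R b\,d\mu_\lambda,$$ the supremum over all rectangles $R\subset\mathbb{R}_+\times\mathbb{R}_+$; functions differing by a constant are identified. The duality is understood in the usual sense: each $b\in\mathrm{bmo}(\mathbb{R}_\lambda)$ defines, via $f\mapsto\int bf\,d\mu_\lambda$ on finite linear combinations of $\infty$-atoms, a functional extending boundedly to $h^1(\mathbb{R}_\lambda)$ with norm comparable to $\|b\|_{\mathrm{bmo}(\mathbb{R}_\lambda)}$, and every bounded linear functional on $h^1(\mathbb{R}_\lambda)$ arises in this way from a $b\in \mathrm{bmo}(\mathbb{R}_\lambda)$, unique up to an additive constant. *)

(* Defs.v *)
From HB Require Import structures.
From mathcomp Require Import all_boot all_order all_algebra.
From mathcomp Require Import all_classical all_reals all_analysis.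
From mathcomp Require Import measurable_realfun.
From mathcomp.real_closed Require Import complex.

Set Implicit Arguments.
Unset Strict Implicit.
Unset Printing Implicit Defensive.

Import Order.TTheory GRing.Theory Num.Theory.
Import numFieldNormedType.Exports.
Import ComplexField.Normc.

Local Open Scope classical_set_scope.
Local Open Scope ring_scope.
Local Open Scope ereal_scope.

Definition Rplus {R : realType} : set R := `]0%R, +oo[.

Definition quadrant {R : realType} : set (R * R) := Rplus `*` Rplus.

(* The measure x^(2 lam) dx on (0, +oo), as a measure on the whole real line
   that vanishes on the complement of (0, +oo). *)
Definition mlam {R : realType} (lam : R) (A : set R) : \bar R :=
  \int[lebesgue_measure]_(x in A)
    (((fun y : R => (y `^ (2 * lam))%R) \_ Rplus) x)%:E.

Section mlam_measure.
Context {R : realType} (lam : R).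

Let density (x : R) : R := ((fun y : R => (y `^ (2 * lam))%R) \_ Rplus) x.

Let density_ge0 x : (0 <= density x)%R.
Proof. by rewrite /density patchE; case: ifP => // _; exact: powR_ge0. Qed.

Let measurable_density : measurable_fun [set: R] density.
Proof.
apply/(measurable_restrictT _ (measurable_itv _)).
exact/measurable_funTS.
Qed.

Let mlam0 : mlam lam set0 = 0.
Proof. by rewrite /mlam integral_set0. Qed.

Let mlam_ge0 A : 0 <= mlam lam A.
Proof. by apply: integral_ge0 => x _; rewrite lee_fin. Qed.

Let mlam_sigma_additive : semi_sigma_additive (mlam lam).
Proof.
have mf : measurable_fun [set: R] (EFin \o density) by exact/measurable_EFinP.
have f0 x : 0 <= (EFin \o density) x by rewrite lee_fin.
exact: (@semi_sigma_additive_nng_induced _ _ R (@lebesgue_measure R) _ mf f0).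
Qed.

HB.instance Definition _ := isMeasure.Build _ _ _ (mlam lam)
  mlam0 mlam_ge0 mlam_sigma_additive.

Let mlam_sigma_finite : sigma_finite [set: R] (mlam lam).
Proof.
pose F (n : nat) : set R := `[(- n%:R)%R, n%:R%R] `&`
    density @^-1` `]-oo, n%:R%R].
have mF n : measurable (F n).
  apply: measurableI => //.
  by rewrite -[X in measurable X]setTI; exact: measurable_density.
exists F.
  apply/esym; rewrite -subTset => x _.
  exists (Num.truncn (`|x| + density x)%R).+1 => //.
  have /ltW h := truncnS_gt (`|x| + density x)%R.
  split => /=; rewrite in_itv/=.
    by rewrite -ler_norml (le_trans _ h)// lerDl.
  by rewrite (le_trans _ h)// lerDr.
move=> n; split => //.
apply: (@le_lt_trans _ _ (\int[lebesgue_measure]_(x in F n) (cst n%:R%:E) x)).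
  apply: ge0_le_integral.
  - exact: mF.
  - by move=> x _; rewrite lee_fin; exact: density_ge0.
  - apply/measurable_EFinP.
    exact: (measurable_funS measurableT (@subsetT _ _) measurable_density).
  - exact: measurable_cst.
  - by move=> x [_] /=; rewrite in_itv/= lee_fin.
rewrite integral_cst; last exact: mF.
apply: lte_mul_pinfty => //.
apply: (@le_lt_trans _ _ (lebesgue_measure `[(- n%:R)%R, (n%:R : R)%R])).
  apply: le_measure; rewrite ?inE//; last exact: subIsetl.
  exact: mF.
by rewrite lebesgue_measure_itv/= ; case: ifP => // _; exact: ltry.
Qed.

HB.instance Definition _ :=
  @Measure_isSigmaFinite.Build _ _ _ (mlam lam) mlam_sigma_finite.

Definition mulam : {measure set (R * R) -> \bar R} :=
  mlam lam \x mlam lam.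

End mlam_measure.

Section little_hardy_bmo.
Context {R : realType} (lam : R).
Local Notation mu := (mulam lam).
Implicit Types (f a b : R * R -> R[i]) (S : set (R * R)).

(* Complex-valued functions are handled through their real and imaginary
   parts. Functions are representatives of classes modulo mu-a.e. equality;
   only their values on the quadrant matter. *)
Definition cmeasurable S f :=
  measurable_fun S (fun x => complex.Re (f x)) /\
  measurable_fun S (fun x => complex.Im (f x)).

Definition cintegrable S f :=
  mu.-integrable S (fun x => (complex.Re (f x))%:E) /\
  mu.-integrable S (fun x => (complex.Im (f x))%:E).

Definition cintegral S f : R[i] :=
  ((\int[mu]_(x in S) complex.Re (f x))%R +i*
   (\int[mu]_(x in S) complex.Im (f x))%R)%C.

Definition bounded_interval (I : set R) :=
  [/\ is_interval I, bounded_set I & I `<=` Rplus].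

(* Degenerate rectangles are excluded, since 1 / mu S occurs below. *)
Definition rectangle S :=
  (exists I J : set R,
    [/\ bounded_interval I, bounded_interval J & S = I `*` J]) /\ 0 < mu S.

Definition atom a :=
  cmeasurable quadrant a /\
  exists S, [/\ rectangle S,
    {ae mu, forall x, ~ S x -> a x = 0%R},
    'N[mu]_+oo[EFin \o (@normc R) \o a] <= (mu S)^-1 &
    cintegral quadrant a = 0%R].

Definition atomic_decomposition f (alpha : nat -> R[i])
    (atoms : nat -> R * R -> R[i]) :=
  [/\ forall i, atom (atoms i),
    \sum_(0 <= i <oo) (normc (alpha i))%:E < +oo &
    \int[mu]_(x in quadrant)
       (normc (f x - \sum_(0 <= i < n) alpha i * atoms i x)%R)%:E @[n --> \oo]
      --> 0].

Definition h1 f :=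
  cintegrable quadrant f /\
  exists alpha atoms, atomic_decomposition f alpha atoms.

Definition h1_norm f : \bar R :=
  ereal_inf [set s | exists alpha atoms, atomic_decomposition f alpha atoms /\
                       s = \sum_(0 <= i <oo) (normc (alpha i))%:E].

Definition atomic_span f :=
  exists (n : nat) (alpha : 'I_n -> R[i]) (atoms : 'I_n -> R * R -> R[i]),
    (forall i, atom (atoms i)) /\
    forall x, f x = (\sum_(i < n) alpha i * atoms i x)%R.

(* Bounded linear functionals on h1. Boundedness forces L to agree on
   functions of h1 that are equal a.e.; the values of L outside h1 are
   irrelevant. *)
Definition h1_dual (L : (R * R -> R[i]) -> R[i]) :=
  (forall (k : R[i]) f g, h1 f -> h1 g ->
    L (fun x => k * f x + g x)%R = (k * L f + L g)%R) /\
  (exists M : R, forall f, h1 f -> (normc (L f))%:E <= M%:E * h1_norm f).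

Definition dual_norm (L : (R * R -> R[i]) -> R[i]) : \bar R :=
  ereal_sup [set (normc (L f))%:E | f in [set f | h1 f /\ h1_norm f <= 1]].

Definition L1loc b :=
  cmeasurable quadrant b /\
  forall K : set (R * R), K `<=` quadrant -> compact K -> cintegrable K b.

Definition mean S b : R[i] := (((fine (mu S))^-1)%:C%C * cintegral S b)%R.

Definition bmo_norm b : \bar R :=
  ereal_sup [set (mu S)^-1 * \int[mu]_(x in S) (normc (b x - mean S b)%R)%:E
            | S in rectangle].

Definition bmo b := L1loc b /\ bmo_norm b < +oo.

Definition represents b (L : (R * R -> R[i]) -> R[i]) :=
  forall f, atomic_span f ->
    cintegrable quadrant (fun x => b x * f x)%R /\
    L f = cintegral quadrant (fun x => b x * f x)%R.

End little_hardy_bmo.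

(* Main.v *)
(* From L to b. For a measurable E inside a rectangle S, the function
   1_E - mu(E)/mu(S) 1_S has small h^1 norm when mu(E) is small: take nested partitions of S
   into rectangles of equal measure, enclose E in a union U of cells of measure at most
   2d, where mu(E) < d, and let P_k be the maximal cells in which U has density above s.
   Then the function is one atom on S with coefficient 4 s mu(S), plus one atom on each
   P_k with coefficient mu(P_k), and the latter sum up to at most 2d/s. Hence, for a fixed
   square S0, E |-> L(1_E - mu(E)/mu(S0) 1_S0) is a charge absolutely continuous with
   respect to mu, and its Radon-Nikodym density is b. Testing L on atoms of the form
   c (1_P - mu(P)/mu(S) 1_S), with P the part of S where Re b (or Im b) is at least its
   mean, recovers the oscillation of b over S, which gives the lower bound on the norm of
   L and the uniqueness of b.

   From b to L. The integral of b f need not converge for f in h^1, so truncate u = Re b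
   (and Im b) to u_k with values in [-k, k]. Truncation is 1-Lipschitz, so u_k pairs with
   every atom with the oscillation bound of u, uniformly in k; since u_k is bounded,
   pairing with it commutes with the atomic series, and Tannery's theorem yields the
   limit in k. *)

From HB Require Import structures.
Require Import Defs.
From mathcomp Require Import all_boot all_order all_algebra.
From mathcomp Require Import all_classical all_reals all_analysis.
From mathcomp Require Import measurable_realfun ess_sup_inf ring lra zify.
From mathcomp.real_closed Require Import complex.

Set Implicit Arguments.
Unset Strict Implicit.
Unset Printing Implicit Defensive.

Import Order.TTheory GRing.Theory Num.Theory.
Import numFieldNormedType.Exports.
Import ComplexField.Normc.

Local Open Scope classical_set_scope.
Local Open Scope ring_scope.
Local Open Scope ereal_scope.

(** The obstacle in passing from L to b is that atoms are controlled in the sup norm only: on a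
    fixed rectangle L is a bounded functional for that norm, and such a functional may be merely
    finitely additive on sets. Countable additivity has to come from the h^1 norm, and a small mu(E)
    makes this norm small only with the help of atoms on smaller rectangles. Selecting these among
    all rectangles would call for the strong maximal function, which is not of weak type (1,1).
    Partitions nested inside the given S make the maximal cells disjoint, and cells of equal measure
    make the ratio of parent to child exactly 4. The threshold s is fixed before d, since s controls
    the large atom and d/s the sum of the small ones. In passing from b to L, a uniform bound on
    atoms is not yet a bound on h^1, because the norm of even a finite combination is an infimum
    over infinite decompositions. The limit over truncations depends on f alone, and every
    decomposition of f bounds it. *)

(** * Nested countable partitions: regularity and stopping cells *)

Section cells.
Context d (T : measurableType d) (R : realType).
Variable mu : {measure set T -> \bar R}.
Variables (S : set T) (p : nat -> T -> nat).
Hypothesis mS : measurable S.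
Hypothesis muS : mu S < +oo.
Hypothesis mp : forall n k, measurable (S `&` p n @^-1` [set k]).
Hypothesis refp : forall n x y, p n.+1 x = p n.+1 y -> p n x = p n y.
Implicit Types (U V E : set T).

Definition cell n k : set T := S `&` p n @^-1` [set k].

Lemma refine_le n m x y : (m <= n)%N -> p n x = p n y -> p m x = p m y.
Proof.
elim: n => [|n ih]; first by rewrite leqn0 => /eqP ->.
by rewrite leq_eqVlt => /predU1P[-> //|mn] /refp; exact: ih.
Qed.

(** Openness relative to [S] in the topology whose basis consists of the cells; nothing is asked of
    [U] off [S]. *)
Definition cellopen U :=
  forall x, S x -> U x -> exists n, forall y, S y -> p n y = p n x -> U y.

(** Labels are natural numbers, so there are countably many cells, and an open set is the union of
    those it contains. *)
Lemma cellopen_measurable U : cellopen U -> measurable (S `&` U).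
Proof.
move=> oU.
pose K n : set nat := [set k | forall y, S y -> p n y = k -> U y].
rewrite (_ : S `&` U = \bigcup_n \bigcup_(k in K n) cell n k).
  by apply: bigcupT_measurable => n; apply: bigcup_measurable => k _; exact: mp.
apply/seteqP; split => [x [Sx Ux]|x [n _ [k Kk [Sx pk]]]].
  have [n nU] := oU _ Sx Ux.
  by exists n => //; exists (p n x).
by split => //; exact: (Kk).
Qed.

Lemma cellopenI U V : cellopen U -> cellopen V -> cellopen (U `&` V).
Proof.
move=> oU oV x Sx [Ux Vx].
have [n nU] := oU _ Sx Ux; have [m mV] := oV _ Sx Vx.
exists (maxn n m) => y Sy pyx; split.
  by apply: nU => //; apply: refine_le pyx; exact: leq_maxl.
by apply: mV => //; apply: refine_le pyx; exact: leq_maxr.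
Qed.

Lemma cellopen_bigcup (U : (set T)^nat) :
  (forall n, cellopen (U n)) -> cellopen (\bigcup_n U n).
Proof.
move=> oU x Sx [n _ Ux]; have [m mU] := oU _ _ Sx Ux.
by exists m => y Sy pyx; exists n => //; exact: mU.
Qed.

Lemma cellopen_bigcap (U : (set T)^nat) N :
  (forall n, cellopen (U n)) -> cellopen (\bigcap_(n < N) U n).
Proof.
move=> oU; elim: N => [|N ih].
  by rewrite bigcap_mkord big_ord0 => x _ _; exists 0%N.
by rewrite bigcap_mkord big_ord_recr/= -bigcap_mkord; exact: cellopenI.
Qed.

(* A form of outer and inner regularity that is symmetric under complements. *)
Definition cell_regular E := forall e : R, (0 < e)%R ->
  exists U V, [/\ cellopen U, cellopen V, S `&` E `<=` U, S `\` E `<=` V &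
    mu (S `&` (U `&` V)) <= e%:E].

Lemma cell_regularC E : cell_regular E -> cell_regular (~` E).
Proof.
move=> rE e e0; have [U [V [oU oV EU EV UVe]]] := rE e e0.
exists V, U; split => //; first by rewrite setDE setCK.
by rewrite (setIC V).
Qed.

Lemma cell_regular0 : cell_regular set0.
Proof.
move=> e e0; exists set0, setT; split.
- by [].
- by move=> x _ _; exists 0%N.
- by rewrite setI0.
- by [].
- by rewrite set0I setI0 measure0 lee_fin ltW.
Qed.

(** The enclosures of the [E n] may be united, but those of the complements may only be intersected
    finitely often if openness is to survive. The full intersection overlaps the union in measure at
    most e/2, and continuity from above replaces it by a finite one at the cost of the other
    half. *)
Lemma cell_regular_bigcup (E : (set T)^nat) :
  (forall n, cell_regular (E n)) -> cell_regular (\bigcup_n E n).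
Proof.
move=> rE e e0.
have d0 (n : nat) : (0 < e / 2 / (2 ^ n.+1)%:R)%R.
  by rewrite !divr_gt0// ltr0n expn_gt0.
have /choice[UV hUV] n : exists UV : set T * set T,
   [/\ cellopen UV.1, cellopen UV.2, S `&` E n `<=` UV.1, S `\` E n `<=` UV.2 &
    mu (S `&` (UV.1 `&` UV.2)) <= (e / 2 / (2 ^ n.+1)%:R)%:E].
  by have [U [V h]] := rE n _ (d0 n); exists (U, V).
pose U := \bigcup_n (UV n).1.
pose V N := \bigcap_(n < N) (UV n).2.
have oU : cellopen U by apply: cellopen_bigcup => n; case: (hUV n).
have oV N : cellopen (V N) by apply: cellopen_bigcap => n; case: (hUV n).
have mW N : measurable (S `&` (U `&` V N)).
  by apply/cellopen_measurable/cellopenI.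
pose B := \bigcup_n (S `&` ((UV n).1 `&` (UV n).2)).
have mB n : measurable (S `&` ((UV n).1 `&` (UV n).2)).
  by apply/cellopen_measurable/cellopenI; case: (hUV n).
have muB : mu B <= (e / 2)%:E.
  apply: (@le_trans _ _ (\sum_(n <oo) mu (S `&` ((UV n).1 `&` (UV n).2)))).
    by apply: measure_sigma_subadditive => //; exact: bigcupT_measurable.
  apply: (@le_trans _ _ (\sum_(n <oo) (e / 2 / (2 ^ n.+1)%:R)%:E)).
    by apply: lee_nneseries => // n _; case: (hUV n).
  by apply: epsilon_trick0; rewrite divr_ge0// ltW.
have cvgW : mu (S `&` (U `&` V N)) @[N --> \oo] -->
    mu (\bigcap_N (S `&` (U `&` V N))).
  apply: nonincreasing_cvg_mu => //.
  - by rewrite (le_lt_trans _ muS)// le_measure ?inE//; exact: subIsetl.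
  - exact: bigcapT_measurable.
  - move=> n m nm; apply/subsetPset; do 2 apply: setIS.
    by move=> x Vx k /= kn; apply: Vx => /=; exact: leq_trans nm.
have WB : \bigcap_N (S `&` (U `&` V N)) `<=` B.
  move=> x xW; have [Sx [[n _ Unx] _]] := xW 0%N I.
  exists n => //; split => //; split => //.
  by have [_ [_]] := xW n.+1 I; apply => /=.
have muW : mu (\bigcap_N (S `&` (U `&` V N))) < e%:E.
  apply: (@le_lt_trans _ _ (e / 2)%:E).
    apply: le_trans muB; rewrite le_measure ?inE//; first exact: bigcapT_measurable.
    exact: bigcupT_measurable.
  by rewrite lte_fin; lra.
have [N _ /(_ N (leqnn N)) hN] : \forall N \near \oo, mu (S `&` (U `&` V N)) < e%:E.
  by apply: (cvgW [set y | y < e%:E]); exact: open_ereal_lt'.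
exists U, (V N); split => //.
- move=> x [Sx [n _ Ex]]; exists n => //.
  by case: (hUV n) => _ _ + _ _; apply.
- move=> x [Sx nEx] n _; case: (hUV n) => _ _ _ + _; apply.
  by split => // Ex; apply: nEx; exists n.
- exact: ltW.
Qed.

(** What [U] contains beyond [E] lies in [V] as well, hence in the small overlap. *)
Lemma cell_regular_outer E (e : R) : measurable E -> cell_regular E -> (0 < e)%R ->
  exists U, [/\ cellopen U, S `&` E `<=` U & mu (S `&` U) <= mu (S `&` E) + e%:E].
Proof.
move=> mE rE e0; have [U [V [oU oV EU EV UVe]]] := rE e e0.
exists U; split => //.
apply: (le_trans _ (leeD2l _ UVe)).
have mUV : measurable (S `&` (U `&` V)) by apply/cellopen_measurable/cellopenI.
apply: (le_trans _ (measureU2 mu (measurableI _ _ mS mE) mUV)).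
apply: le_measure; rewrite ?inE//.
- exact: cellopen_measurable.
- by apply: measurableU => //; exact: measurableI.
- move=> x [Sx Ux]; have [Ex|nEx] := pselect (E x); [by left|right].
  by do !split => //; exact: EV.
Qed.

Variables (D s : R).
Hypothesis cell_gt0 : forall n x, S x -> 0 < mu (cell n (p n x)).
Hypothesis doubling : forall n x, S x ->
  mu (cell n (p n x)) <= D%:E * mu (cell n.+1 (p n.+1 x)).
Hypothesis p0 : forall x y, S x -> S y -> p 0%N x = p 0%N y.

(** The parent of a maximal dense cell is not dense, so the doubling constant [D] bounds the density
    of [U] in the cell by [s * D]. Two maximal cells that meet are nested, hence equal. *)
Lemma stopping_cover U : cellopen U -> (0 < s)%R -> (s < 1)%R ->
  mu (S `&` U) <= s%:E * mu S ->
  exists Q : (set T)^nat, [/\ trivIset setT Q,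
    forall i, Q i = set0 \/ exists n x, S x /\ Q i = cell n (p n x),
    S `&` U `<=` \bigcup_i Q i,
    forall i, mu (Q i `&` U) <= (s * D)%:E * mu (Q i) &
    forall i, s%:E * mu (Q i) <= mu (Q i `&` U)].
Proof.
move=> oU s0 s1 Us.
pose dense n k := s%:E * mu (cell n k) < mu (cell n k `&` U).
pose Sel n k := [/\ exists2 x, S x & p n x = k, dense n k &
  (* The cells [p m x] with m < n are the ancestors of the cell labelled [k]. *)
  forall m x, (m < n)%N -> S x -> p n x = k -> ~ dense m (p m x)].
(* The pairs (generation, label) are enumerated by [pickle]; indices that select no cell give the
   empty set. *)
pose Q i := if @pickle_inv (nat * nat)%type i is Some nk then
  if `[< Sel nk.1 nk.2 >] then cell nk.1 nk.2 else set0 else set0.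
have QP i : Q i = set0 \/ exists n k,
    [/\ Sel n k, Q i = cell n k & i = pickle (n, k)].
  rewrite /Q; case: pickle_inv (@pickle_invK (nat * nat)%type i) => /=; last by left.
  move=> [n k] /= nki; case: asboolP => /= [sel|_]; last by left.
  by right; exists n, k; rewrite -nki.
have mcell n k : measurable (cell n k) by exact: mp.
have mcU n k : measurable (cell n k `&` U).
  rewrite -(setIidl (_ : cell n k `<=` S)); last by move=> x [].
  by rewrite -setIA; apply: measurableI => //; exact: cellopen_measurable.
exists Q; split.
- move=> i j _ _ [x [Qi Qj]].
  case: (QP i) => [Q0|[n [k [[_ dn sn] Qnk inj]]]]; first by rewrite Q0 in Qi.
  case: (QP j) => [Q0|[m [l [[_ dm sm] Qml jml]]]]; first by rewrite Q0 in Qj.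
  move: Qi Qj; rewrite Qnk Qml => -[Sx /= pnx] [_ /= pmx].
  have [nm|mn|nm] := ltngtP n m.
  + by have := sm n x nm Sx pmx; rewrite pnx.
  + by have := sn m x mn Sx pnx; rewrite pmx.
  + by rewrite inj jml -pnx -pmx nm.
- move=> i; case: (QP i) => [->|[n [k [[[x Sx pnx] _ _] -> _]]]]; [by left|right].
  by exists n, x; rewrite pnx.
- move=> x [Sx Ux].
  (* By openness some cell around [x] lies inside [U]; its density is 1, which exceeds [s] strictly
     because the cell has positive finite measure. *)
  have ex : exists n, `[< dense n (p n x) >].
    have [n nU] := oU _ Sx Ux; exists n; apply/asboolP; rewrite /dense.
    rewrite [cell _ _ `&` U]setIidl; last by move=> y [Sy /= pyx]; exact: nU.
    have fc : mu (cell n (p n x)) \is a fin_num.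
      rewrite ge0_fin_numE// (le_lt_trans _ muS)//.
      by rewrite le_measure ?inE//; exact: subIsetl.
    by rewrite -(fineK fc) -EFinM lte_fin gtr_pMl// fine_gt0// cell_gt0//= -ge0_fin_numE.
  case: (ex_minnP ex) => n /asboolP dn nmin.
  exists (pickle (n, p n x)) => //; rewrite /Q pickleK_inv/=.
  case: asboolP => [//|[]]; split => //; first by exists x.
  move=> m y mn Sy pyx dm.
  have := nmin m; rewrite leqNgt mn => h; apply/notF/h/asboolP.
  by rewrite -(refine_le (ltnW mn) pyx).
- move=> i; case: (QP i) => [->|]; first by rewrite set0I measure0 mule0.
  move=> [n [k [[[x Sx pnx] dn sn] -> _]]]; move: n pnx dn sn => [|n] pnx dn sn.
    (* The only cell of generation 0 is [S], which is not dense by the assumption on [U]; every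
       selected cell therefore has a parent. *)
    exfalso; move: dn; rewrite /dense (_ : cell 0 k = S) ?ltNge ?Us//.
    apply/seteqP; split => y; first by case.
    by move=> Sy; split => //=; rewrite -pnx; exact: p0.
  have /negP := sn n x (ltnSn n) Sx pnx; rewrite -leNgt => h.
  apply: (@le_trans _ _ (mu (cell n (p n x) `&` U))).
    rewrite le_measure ?inE//; apply: setSI => y [Sy /= pyk]; split => //=.
    by apply: refp; rewrite pyk.
  apply: (le_trans h); rewrite EFinM -muleA lee_pmul2l ?lte_fin//.
  by rewrite -pnx; exact: doubling.
- move=> i; case: (QP i) => [->|]; first by rewrite set0I measure0 mule0.
  by move=> [n [k [[_ dn _] -> _]]]; exact: ltW.
Qed.

End cells.

(** * The weighted measure on an interval and its dyadic quantile partitions *)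

Section mlam_interval.
Context {R : realType} (lam : R).
Hypothesis lam_gt0 : (0 < lam)%R.
Local Notation m := (mlam lam).

Let lam2_ge0 : (0 <= 2 * lam)%R. Proof. by rewrite mulr_ge0// ltW. Qed.

Let density (x : R) : R := ((fun y : R => (y `^ (2 * lam))%R) \_ Rplus) x.

Let density_ge0 x : (0 <= density x)%R.
Proof. by rewrite /density patchE; case: ifP => // _; exact: powR_ge0. Qed.

Let measurable_density (A : set R) : measurable_fun A (fun x => (density x)%:E).
Proof.
apply/measurable_EFinP; apply: measurable_funTS.
apply/(measurable_restrictT _ (measurable_itv _)).
exact/measurable_funTS.
Qed.

Lemma mlam_le (A : set R) (B : R) : measurable A -> (0 <= B)%R ->
  A `<=` `]-oo, B] -> m A <= (B `^ (2 * lam))%:E * lebesgue_measure A.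
Proof.
move=> mA B0 AB; rewrite -integral_cst//; apply: ge0_le_integral => //.
- by move=> x _; rewrite lee_fin density_ge0.
- exact: measurable_density.
- move=> x /AB/=; rewrite in_itv/= => xB.
  rewrite lee_fin patchE; case: ifPn => [|_]; last exact: powR_ge0.
  rewrite inE /Rplus/= in_itv/= andbT => x0.
  by apply: ge0_ler_powR => //; rewrite nnegrE ltW.
Qed.

Lemma mlam_itv_oo_gt0 (x y : R) : (0 <= x)%R -> (x < y)%R -> 0 < m `]x, y[.
Proof.
(* The weight may vanish at the left end, when that end is 0; on the right half of the interval it
   is at least a^(2 lam) > 0. *)
move=> x0 xy; pose a := ((x + y) / 2)%R.
have xa : (x < a)%R by rewrite /a; lra.
have ay : (a < y)%R by rewrite /a; lra.
apply: (@lt_le_trans _ _ (m `]a, y[)); last first.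
  by rewrite le_measure ?inE//; apply: subset_itvr; rewrite bnd_simp ltW.
apply: (@lt_le_trans _ _ (\int[lebesgue_measure]_(z in `]a, y[) (cst (a `^ (2 * lam))%:E z))).
  rewrite integral_cst//= lebesgue_measure_itv/= lte_fin ay -EFinD -EFinM lte_fin.
  by rewrite mulr_gt0 ?subr_gt0// powR_gt0// (le_lt_trans x0).
apply: ge0_le_integral => //.
- by move=> z _; rewrite lee_fin powR_ge0.
- exact: measurable_density.
- move=> z/=; rewrite in_itv/= => /andP[az zy].
  have a0 : (0 < a)%R by exact: le_lt_trans xa.
  rewrite lee_fin patchE mem_set/=; last by rewrite /Rplus/= in_itv/= andbT (lt_trans a0).
  apply: ge0_ler_powR => //; rewrite ?nnegrE ltW//.
  exact: lt_trans az.
Qed.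

Lemma bounded_interval_measurable (I : set R) : bounded_interval I -> measurable I.
Proof. by case=> /is_interval_measurable. Qed.

Lemma bounded_intervalP (I : set R) : bounded_interval I ->
  exists2 B : R, (0 < B)%R & I `<=` `]0%R, B]%classic.
Proof.
move=> [_ [M [_ bM]] I0]; exists (`|M| + 1)%R; first by rewrite ltr_wpDl.
move=> x Ix; have := I0 _ Ix; rewrite /Rplus/= !in_itv/= andbT => ->/=.
rewrite (le_trans (ler_norm _))//; apply: bM => //.
by rewrite (le_lt_trans (ler_norm _))// ltrDl.
Qed.

Lemma mlam_lty (I : set R) : bounded_interval I -> m I < +oo.
Proof.
move=> bI; have [B B0 IB] := bounded_intervalP bI.
have mI := bounded_interval_measurable bI.
apply: (@le_lt_trans _ _ (m `]0%R, B])); first by rewrite le_measure ?inE.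
apply: (le_lt_trans (mlam_le _ (ltW B0) _)) => //.
  by move=> x /=; rewrite !in_itv/= => /andP[].
by rewrite lebesgue_measure_itv/= lte_fin B0 sube0 -EFinM ltry.
Qed.

Section adic.
Variable (I : set R).
Hypothesis bI : bounded_interval I.
Hypothesis mI0 : 0 < m I.

Let mI := bounded_interval_measurable bI.
Let c : R := fine (m I).
Let mIE : m I = c%:E.
Proof. by rewrite /c fineK// ge0_fin_numE// mlam_lty. Qed.
Let c0 : (0 < c)%R. Proof. by rewrite -lte_fin -mIE. Qed.

Let mIA (A : set R) : measurable A -> m (I `&` A) \is a fin_num.
Proof.
move=> mA; rewrite ge0_fin_numE// (le_lt_trans _ (mlam_lty bI))//.
by rewrite le_measure ?inE//; exact: measurableI.
Qed.

Definition cdf_on (x : R) : R := fine (m (I `&` `]-oo, x])).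
Local Notation G := cdf_on.

Let GE x : m (I `&` `]-oo, x]) = (G x)%:E.
Proof. by rewrite /cdf_on fineK//; exact: mIA. Qed.

Let G_ge0 x : (0 <= G x)%R. Proof. exact: fine_ge0. Qed.

Let G_lec x : (G x <= c)%R.
Proof. by rewrite -lee_fin -GE -mIE le_measure ?inE//; exact: measurableI. Qed.

Let GD x y : (x <= y)%R -> m (I `&` `]x, y]) = (G y - G x)%:E.
Proof.
move=> xy; rewrite EFinB -!GE.
rewrite (_ : I `&` `]-oo, y] = (I `&` `]-oo, x]) `|` (I `&` `]x, y])); last first.
  by rewrite -setIUr -itv_bndbnd_setU ?bnd_simp.
rewrite measureU//=; [|exact: measurableI..|].
  by rewrite addeAC subee ?add0e//; exact: mIA.
rewrite setIACA setIid -subset0 => z [_ []] /=.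
by rewrite !in_itv/= => zx /andP[]; rewrite ltNge zx.
Qed.

Let G_mono x y : (x <= y)%R -> (G x <= G y)%R.
Proof. by move=> xy; rewrite -subr_ge0 -lee_fin -GD. Qed.

Let G_strict x y : I x -> I y -> (x < y)%R -> (G x < G y)%R.
Proof.
move=> Ix Iy xy; rewrite -subr_gt0 -lte_fin -GD ?ltW//.
have x0 : (0 <= x)%R.
  by have [_ _ /(_ _ Ix)] := bI; rewrite /Rplus/= in_itv/= andbT => /ltW.
apply: (lt_le_trans (mlam_itv_oo_gt0 x0 xy)).
rewrite le_measure ?inE//; first exact: measurableI.
move=> z /=; rewrite in_itv/= => /andP[xz zy]; split.
  by have [+ _ _] := bI; apply; [exact: Ix|exact: Iy|rewrite !ltW].
by rewrite /= in_itv/= xz ltW.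
Qed.

Let lipschitz : exists2 K : R, (0 < K)%R &
  forall x y, (x <= y)%R -> (G y - G x <= K * (y - x))%R.
Proof.
have [B B0 IB] := bounded_intervalP bI.
exists (B `^ (2 * lam))%R; first exact: powR_gt0.
move=> x y xy; rewrite -lee_fin -GD//.
apply: (@le_trans _ _ ((B `^ (2 * lam))%:E * lebesgue_measure (I `&` `]x, y]))).
  apply: mlam_le; [exact: measurableI|exact: ltW|].
  by move=> z [/IB/=]; rewrite !in_itv/= => /andP[].
rewrite EFinM lee_pmul2l// ?lte_fin ?powR_gt0//.
apply: (@le_trans _ _ (lebesgue_measure (`]x, y] : set R))).
  by rewrite le_measure ?inE//; exact: measurableI.
rewrite lebesgue_measure_itv/= lte_fin; case: ifPn => // _.
by rewrite lee_fin subr_ge0.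
Qed.

Let G_continuous : continuous G.
Proof.
have [K K0 GK] := lipschitz.
move=> x; apply/cvgrPdist_lt => e e0; near=> y.
have [xy|yx] := leP x y.
  rewrite ler0_norm ?subr_le0 ?G_mono// opprB (le_lt_trans (GK _ _ xy))//.
  rewrite mulrC -ltr_pdivlMr// -(ger0_norm (_ : 0 <= y - x)%R) ?subr_ge0//.
  rewrite distrC; near: y; apply: cvgr_dist_lt => //; exact: divr_gt0.
rewrite ger0_norm ?subr_ge0 ?G_mono ?ltW// (le_lt_trans (GK _ _ (ltW yx)))//.
rewrite mulrC -ltr_pdivlMr// -(ger0_norm (_ : 0 <= x - y)%R) ?subr_ge0 ?ltW//.
near: y; apply: cvgr_dist_lt => //; exact: divr_gt0.
Unshelve. all: by end_near. Qed.

Let G_onto v : (0 <= v <= c)%R -> exists x, G x = v.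
Proof.
move=> /andP[v0 vc]; have [B B0 IB] := bounded_intervalP bI.
have G0 : G 0%R = 0%R.
  rewrite /cdf_on (_ : _ `&` _ = set0) ?measure0// -subset0 => x [/IB/=].
  by rewrite !in_itv/= => /andP[+ _]; rewrite ltNge => /negbTE ->.
have GB : G B = c.
  rewrite /cdf_on setIidl// => x /IB/=.
  by rewrite !in_itv/= => /andP[].
have [x _ <-] : exists2 x, x \in `[0%R, B] & G x = v; last by exists x.
apply: IVT; [exact: ltW|exact: continuous_subspaceT|].
by rewrite G0 GB min_l ?max_r ?v0// ltW.
Qed.

Let mG v : measurable [set x | (G x < v)%R].
Proof.
apply: is_interval_measurable => x y /= Gx Gy z /andP[xz zy].
by rewrite /= (le_lt_trans _ Gy)// G_mono.
Qed.

(** The probability integral transform: a continuous distribution function is itself uniformly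
    distributed. Both bounds compare the set with a half-line on which [G] reaches a prescribed
    value. *)
Let mG_lt v : (0 <= v <= c)%R -> m (I `&` [set x | (G x < v)%R]) = v%:E.
Proof.
move=> /andP[v0 vc]; apply/eqP; rewrite eq_le; apply/andP; split.
  have [x Gx] : exists x, G x = v by apply: G_onto; rewrite v0.
  rewrite -Gx -GE le_measure ?inE//; [exact: measurableI|exact: measurableI|].
  apply: setIS => y /=; rewrite in_itv/=; apply: contraTT.
  by rewrite -ltNge => /ltW xy; rewrite -leNgt G_mono.
apply/lee_subgt0Pr => e e0.
have [ve|ve] := ltP v e.
  by apply: (@le_trans _ _ 0) => //; rewrite -EFinB lee_fin subr_le0 ltW.
have [x Gx] : exists x, G x = (v - e)%R.
  by apply: G_onto; rewrite subr_ge0 ve/=; lra.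
rewrite -EFinB -Gx -GE le_measure ?inE//; [exact: measurableI|exact: measurableI|].
apply: setIS => y /=; rewrite in_itv/= => /G_mono/le_lt_trans; apply.
by rewrite Gx; lra.
Qed.

(* The last cell of each generation absorbs the points where [G] is maximal. *)
Definition adic (n : nat) (x : R) : nat :=
  minn (Num.truncn (2 ^+ n * (G x / c))) (2 ^ n).-1.

Let Gc_ge0 n x : (0 <= 2 ^+ n * (G x / c))%R.
Proof. by rewrite mulr_ge0// ?exprn_ge0// divr_ge0// ltW. Qed.

Lemma adic_mono n x y : (x <= y)%R -> (adic n x <= adic n y)%N.
Proof.
move=> xy; rewrite leq_min geq_minr andbT geq_min; apply/orP; left.
apply: Num.Theory.le_truncn; rewrite ler_pM2l ?exprn_gt0//.
by rewrite ler_pM2r ?invr_gt0// G_mono.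
Qed.

Lemma adic0 x : adic 0 x = 0%N.
Proof. by rewrite /adic expn0 minn0. Qed.

(** Both the integer part of 2^n t and the cap 2^n - 1 arise from those of the next generation by
    halving, and halving is monotone, so it commutes with the minimum. *)
Lemma adic_half n x : adic n x = (adic n.+1 x)./2.
Proof.
rewrite /adic; set t := (G x / c)%R.
have t0 : (0 <= t)%R by rewrite divr_ge0// ltW.
have -> : Num.truncn (2 ^+ n * t)%R = (Num.truncn (2 ^+ n.+1 * t)%R)./2.
  set k := Num.truncn (2 ^+ n.+1 * t)%R.
  have /andP[k1 k2] : (k%:R <= 2 ^+ n.+1 * t < k.+1%:R)%R.
    by apply: Num.Theory.truncn_itv; rewrite mulr_ge0// exprn_ge0.
  apply: Num.Theory.truncn_def.
  have kE : (k%:R = (odd k)%:R + 2 * (k./2)%:R :> R)%R.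
    by rewrite -[in LHS](odd_double_half k) natrD -mul2n natrM.
  have ok0 : (0 <= (odd k)%:R :> R)%R by [].
  have ok1 : ((odd k)%:R <= 1 :> R)%R by case: odd.
  move: k1 k2; rewrite exprS -mulrA -(natr1 k) kE -(natr1 (k./2)) => k1 k2.
  by apply/andP; split; lra.
have -> : ((2 ^ n).-1 = (2 ^ n.+1).-1./2)%N.
  by rewrite expnS mul2n; case: (2 ^ n)%N => // k; rewrite doubleS/= uphalf_double.
rewrite /minn; have [ab|ba] := ltnP (Num.truncn (2 ^+ n.+1 * t)%R) (2 ^ n.+1).-1.
  case: ltnP => // h; apply/eqP; rewrite eqn_leq h/=.
  by rewrite half_leq// ltnW.
by case: ltnP => // h; move: (half_leq ba); rewrite leqNgt h.
Qed.

Lemma adic_lt n x : (adic n x < 2 ^ n)%N.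
Proof.
by rewrite /adic -[ltnRHS]prednK ?expn_gt0// ltnS geq_minr.
Qed.

Lemma measurable_adic n k : measurable (I `&` adic n @^-1` [set k]).
Proof.
apply: measurableI => //; apply: is_interval_measurable => x y /= xk yk z /andP[xz zy].
apply/eqP; rewrite eqn_leq -{1}yk -xk.
by rewrite !adic_mono.
Qed.

(** Below 2^n the cap is invisible, so the index is the integer part of the rescaled distribution
    function. *)
Let adic_ltE n k x : (k < 2 ^ n)%N ->
  (adic n x < k)%N = (G x < c * (k%:R / 2 ^+ n))%R.
Proof.
move=> kn; rewrite /adic gtn_min.
have -> : ((2 ^ n).-1 < k)%N = false.
  by apply/negbTE; rewrite -leqNgt -ltnS prednK// expn_gt0.
rewrite orbF Num.Theory.truncn_lt_nat//.
rewrite mulrA -ltr_pdivlMr ?exprn_gt0//; last by rewrite invr_gt0.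
rewrite invrK mulrC -ltr_pdivlMr ?exprn_gt0// mulrA.
by rewrite (mulrC k%:R).
Qed.

Let m_adic_lt n k : (k <= 2 ^ n)%N ->
  m (I `&` [set x | (adic n x < k)%N]) = (c * (k%:R / 2 ^+ n))%:E.
Proof.
rewrite leq_eqVlt => /predU1P[->|kn].
  rewrite natrX divff ?expf_neq0// mulr1 -mIE; congr (m _).
  by apply/seteqP; split => x /=; [case|split => //; exact: adic_lt].
rewrite -(@mG_lt (c * (k%:R / 2 ^+ n))%R).
  by congr (m (_ `&` _)); apply/seteqP; split => x /=; rewrite adic_ltE.
apply/andP; split; first by rewrite mulr_ge0 ?divr_ge0 ?exprn_ge0// ltW.
rewrite ler_piMr ?(ltW c0)//.
by rewrite ler_pdivrMr ?exprn_gt0// mul1r -natrX ler_nat ltnW.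
Qed.

Lemma m_adic n k : (k < 2 ^ n)%N ->
  m (I `&` adic n @^-1` [set k]) = (c / 2 ^+ n)%:E.
Proof.
move=> kn.
have := m_adic_lt kn.
rewrite (_ : I `&` _ = (I `&` [set x | (adic n x < k)%N]) `|`
  (I `&` adic n @^-1` [set k])); last first.
  rewrite -setIUr; congr (_ `&` _); apply/seteqP; split => x /=.
    by rewrite ltnS leq_eqVlt => /predU1P[->|]; [right|left].
  by move=> [|->//]; rewrite ltnS => /ltnW.
rewrite measureU//; last 3 first.
- apply: measurableI => //; apply: is_interval_measurable => x y /= xk yk z /andP[xz zy].
  by rewrite /= (leq_ltn_trans _ yk)// adic_mono.
- exact: measurable_adic.
- by rewrite -subset0 => x [[_ /=] + [_ /=]] => /[swap] ->; rewrite ltnn.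
rewrite [X in (X + _)%E](m_adic_lt (ltnW kn)).
have := mIA (measurable_adic n k); rewrite setIA setIid => /fineK mE.
rewrite -mE [X in (_ + X)%E](esym mE) -EFinD => -[h]; congr EFin.
have -> : (c / 2 ^+ n = c * (k.+1%:R / 2 ^+ n) - c * (k%:R / 2 ^+ n))%R.
  by rewrite -natr1; field; rewrite expf_neq0.
by rewrite -h addrAC subrr add0r.
Qed.

Lemma adic_interval n k : bounded_interval (I `&` adic n @^-1` [set k]).
Proof.
have [iI [M [Mr bM]] I0] := bI; split.
- move=> x y [Ix /= xk] [Iy /= yk] z /andP[xz zy]; split.
    by apply: (iI x y) => //; rewrite xz.
  by apply/eqP; rewrite /= eqn_leq -{1}yk -xk !adic_mono.
- by exists M; split => // K MK x [Ix _]; exact: bM.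
- by move=> x [/I0].
Qed.

(** On one cell of generation n the distribution function varies by at most c / 2^n, the last cell
    included. *)
Let adic_close x (e : R) : (0 < e)%R -> exists n, forall y, adic n y = adic n x ->
  (`|G y - G x| < e)%R.
Proof.
move=> e0.
have [n ne] : exists n : nat, (c / 2 ^+ n < e)%R.
  exists (Num.truncn (c / e)%R).+1; rewrite ltr_pdivrMr ?exprn_gt0// mulrC.
  rewrite -ltr_pdivrMr// (lt_trans (truncnS_gt _))//.
  by rewrite -natrX ltr_nat ltn_expl.
exists n => y yx; apply: le_lt_trans ne.
suff H u v : adic n u = adic n v -> (G u - G v <= c / 2 ^+ n)%R.
  by rewrite ler_norml H// lerNl opprB H.
move=> uv.
have lo : (c * ((adic n v)%:R / 2 ^+ n) <= G v)%R.
  by rewrite leNgt -adic_ltE ?adic_lt// ltnn.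
suff hi : (G u <= c * ((adic n v).+1%:R / 2 ^+ n))%R.
  apply: (le_trans (lerB hi lo)); rewrite -natr1.
  by rewrite -mulrBr -mulrBl addrAC subrr add0r mul1r.
rewrite -uv; have := adic_lt n u; rewrite leq_eqVlt => /predU1P[->|h].
  by rewrite natrX divff ?expf_neq0// mulr1.
by rewrite ltW// -adic_ltE.
Qed.

(** If [a] lies in [I], then [G] separates [x] from [a] strictly and a fine enough cell around [x]
    stays below [a]. If not, the interval [I] lies entirely on the side of [x], and any generation
    works. *)
Lemma adic_open_lt a x : I x -> (x < a)%R ->
  exists n, forall y, I y -> adic n y = adic n x -> (y < a)%R.
Proof.
move=> Ix xa; have [Ia|nIa] := pselect (I a).
  have Gxa : (0 < G a - G x)%R by rewrite subr_gt0 G_strict.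
  have [n hn] := adic_close x Gxa; exists n => y Iy /hn h.
  rewrite ltNge; apply/negP => /G_mono ay.
  by have := le_lt_trans (ler_norm _) h; rewrite ltrD2r ltNge ay.
exists 0%N => y Iy _; rewrite ltNge; apply/negP => ay; apply: nIa.
by have [+ _ _] := bI; apply; [exact: Ix|exact: Iy|rewrite (ltW xa)].
Qed.

Lemma adic_open_gt a x : I x -> (a < x)%R ->
  exists n, forall y, I y -> adic n y = adic n x -> (a < y)%R.
Proof.
move=> Ix ax; have [Ia|nIa] := pselect (I a).
  have Gxa : (0 < G x - G a)%R by rewrite subr_gt0 G_strict.
  have [n hn] := adic_close x Gxa; exists n => y Iy /hn h.
  rewrite ltNge; apply/negP => /G_mono ay.
  by move: h; rewrite distrC => /(le_lt_trans (ler_norm _)); rewrite ltrD2l ltrN2 ltNge ay.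
exists 0%N => y Iy _; rewrite ltNge; apply/negP => ay; apply: nIa.
by have [+ _ _] := bI; apply; [exact: Iy|exact: Ix|rewrite ay (ltW ax)].
Qed.

(** A closed half-line starting at [a] need not be open for the cells; moving its end slightly to
    the left makes it so, and the measure added is controlled by the Lipschitz bound on the
    distribution function. *)
Lemma mlam_window a (e : R) : (0 < e)%R ->
  exists2 b, (b < a)%R & m (I `&` `]b, a]) <= e%:E.
Proof.
move=> e0; have [K K0 GK] := lipschitz.
exists (a - e / K)%R; first by rewrite ltrBlDr ltrDl divr_gt0.
have h : (a - e / K <= a)%R by rewrite gerBl ltW// divr_gt0.
rewrite GD// lee_fin (le_trans (GK _ _ h))//.
by rewrite opprB addrC subrK mulrC divfK// gt_eqF.
Qed.

End adic.
End mlam_interval.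

(** * Rectangles and their nested partitions into rectangles *)

Section rectangles.
Context {R : realType} (lam : R).
Hypothesis lam_gt0 : (0 < lam)%R.
Local Notation m := (mlam lam).
Local Notation mu := (mulam lam).

Lemma mulamX (A B : set R) : measurable A -> measurable B ->
  mu (A `*` B) = m A * m B.
Proof. exact: product_measure1E. Qed.

Lemma rectangle_sides S : rectangle lam S -> exists I J : set R,
  [/\ bounded_interval I, bounded_interval J, S = I `*` J, 0 < m I & 0 < m J].
Proof.
move=> [[I [J [bI bJ SIJ]]] S0]; exists I, J.
have mI := bounded_interval_measurable bI.
have mJ := bounded_interval_measurable bJ.
move: S0; rewrite SIJ mulamX// => S0.
by split => //; rewrite lt_neqAle measure_ge0 andbT;
  apply: contraTN S0 => /eqP <-; rewrite ?mul0e ?mule0 ltxx.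
Qed.

Lemma rectangle_measurable S : rectangle lam S -> measurable S.
Proof.
move=> /rectangle_sides[I [J [bI bJ -> _ _]]].
by apply: measurableX; exact: bounded_interval_measurable.
Qed.

Lemma rectangle_lty S : rectangle lam S -> mu S < +oo.
Proof.
move=> /rectangle_sides[I [J [bI bJ -> _ _]]].
rewrite mulamX; [|exact: bounded_interval_measurable..].
by rewrite lte_mul_pinfty// ?ge0_fin_numE//; exact: mlam_lty.
Qed.

Lemma rectangle_fin S : rectangle lam S -> mu S \is a fin_num.
Proof. by move=> rS; rewrite ge0_fin_numE// rectangle_lty. Qed.

Lemma rectangle_fine_gt0 S : rectangle lam S -> (0 < fine (mu S))%R.
Proof. by move=> rS; rewrite fine_gt0// rectangle_lty// andbT; case: rS. Qed.

Lemma rectangle_quadrant S : rectangle lam S -> S `<=` quadrant.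
Proof.
move=> /rectangle_sides[I [J [[_ _ I0] [_ _ J0] -> _ _]]] x [/= /I0 x1 /J0 x2].
by split.
Qed.

Lemma measurable_quadrant : measurable (quadrant : set (R * R)).
Proof. by apply: measurableX; exact: measurable_itv. Qed.

(** Products of the quantile partitions of the two sides: each generation halves both sides, so a
    parent has exactly 4 times the measure of a child. Regularity passes from half-planes to all
    measurable sets because the regular sets form a sigma-algebra. *)
Lemma rectangle_partition S : rectangle lam S ->
  exists p : nat -> R * R -> nat,
  [/\ (forall n k, measurable (S `&` p n @^-1` [set k])),
      (forall n x y, p n.+1 x = p n.+1 y -> p n x = p n y),
      (forall x y, p 0%N x = p 0%N y),
      (forall n x, S x -> rectangle lam (cell S p n (p n x)) /\
        mu (cell S p n (p n x)) <= 4%:E * mu (cell S p n.+1 (p n.+1 x))) &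
      (forall E, measurable E -> cell_regular mu S p E)].
Proof.
move=> rS; have [I [J [bI bJ SIJ mI0 mJ0]]] := rectangle_sides rS.
have mI := bounded_interval_measurable bI.
have mJ := bounded_interval_measurable bJ.
have mS := rectangle_measurable rS.
pose i1 := adic lam I; pose i2 := adic lam J.
pose p n (x : R * R) := pickle (i1 n x.1, i2 n x.2).
have pE n x y : p n x = p n y -> i1 n x.1 = i1 n y.1 /\ i2 n x.2 = i2 n y.2.
  by move=> /(pcan_inj pickleK)[].
have cellE n x : cell S p n (p n x) =
    (I `&` i1 n @^-1` [set i1 n x.1]) `*` (J `&` i2 n @^-1` [set i2 n x.2]).
  rewrite /cell SIJ; apply/seteqP; split => y /=.
    by move=> [[Iy Jy] /pE[-> ->]].
  by move=> [[Iy y1] [Jy y2]]; split; [split|rewrite /p y1 y2].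
have mc1 n k : measurable (I `&` i1 n @^-1` [set k]) by exact: measurable_adic.
have mc2 n k : measurable (J `&` i2 n @^-1` [set k]) by exact: measurable_adic.
have mp n k : measurable (S `&` p n @^-1` [set k]).
  have [[x Sx pxk]|h] := pselect (exists2 x, S x & p n x = k).
    by rewrite -[X in measurable X]/(cell S p n k) -pxk cellE; apply: measurableX.
  rewrite (_ : _ `&` _ = set0)// -subset0 => x [Sx pxk].
  by apply: h; exists x.
have refp n x y : p n.+1 x = p n.+1 y -> p n x = p n y.
  move=> /pE[h1 h2].
  have e1 : i1 n x.1 = i1 n y.1 by rewrite /i1 !(adic_half lam_gt0 bI mI0 n) -/i1 h1.
  have e2 : i2 n x.2 = i2 n y.2 by rewrite /i2 !(adic_half lam_gt0 bJ mJ0 n) -/i2 h2.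
  by rewrite /p e1 e2.
have muc n x : mu (cell S p n (p n x)) =
    (fine (m I) / 2 ^+ n * (fine (m J) / 2 ^+ n))%:E.
  by rewrite cellE mulamX// !m_adic// adic_lt.
have cI0 : (0 < fine (m I))%R by rewrite fine_gt0// mI0 mlam_lty.
have cJ0 : (0 < fine (m J))%R by rewrite fine_gt0// mJ0 mlam_lty.
have mufin : mu S < +oo by exact: rectangle_lty.
exists p; split; [exact: mp|exact: refp| | |].
- by move=> x y; rewrite /p /i1 /i2 !adic0.
- move=> n x Sx; split.
    split; last by rewrite muc lte_fin mulr_gt0// divr_gt0// exprn_gt0.
    rewrite cellE; exists (I `&` i1 n @^-1` [set i1 n x.1]).
    by exists (J `&` i2 n @^-1` [set i2 n x.2]); split => //; exact: adic_interval.
  rewrite !muc -EFinM lee_fin !exprS.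
  rewrite le_eqVlt; apply/orP; left; apply/eqP; field.
  by rewrite expf_neq0.
have sigma : sigma_algebra setT (cell_regular mu S p).
  split; first exact: cell_regular0.
    by move=> A rA; rewrite setTD; exact: cell_regularC.
  exact: cell_regular_bigcup.
have mfst (B : set R) : measurable B -> measurable (@fst R R @^-1` B).
  by move=> mB; rewrite -[X in measurable X]setTI; exact: measurable_fst.
have msnd (B : set R) : measurable B -> measurable (@snd R R @^-1` B).
  by move=> mB; rewrite -[X in measurable X]setTI; exact: measurable_snd.
(* The half-plane is open already; its complement is enclosed in the slightly larger open half-plane
   to the right of [b]. The overlap lies in the strip over ]b, a], whose measure is that of a window
   times [m J], whence the tolerance e / m(J). *)
have ray1 a : cell_regular mu S p (fst @^-1` `]-oo, a[).
  move=> e e0.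
  have e' : (0 < e / fine (m J))%R by rewrite divr_gt0.
  have [b ba hb] := mlam_window lam_gt0 bI a e'.
  exists (fst @^-1` `]-oo, a[), (fst @^-1` `]b, +oo[); split.
  - move=> x Sx /=; rewrite in_itv/= => xa; rewrite SIJ in Sx; case: Sx => Ix Jx.
    have [n hn] := adic_open_lt lam_gt0 bI mI0 Ix xa.
    exists n => y; rewrite SIJ => -[Iy _] /pE[yx _] /=.
    by rewrite in_itv/=; exact: hn.
  - move=> x Sx /=; rewrite in_itv/= andbT => xa; rewrite SIJ in Sx; case: Sx => Ix Jx.
    have [n hn] := adic_open_gt lam_gt0 bI mI0 Ix xa.
    exists n => y; rewrite SIJ => -[Iy _] /pE[yx _] /=.
    by rewrite in_itv/= andbT; exact: hn.
  - by move=> x [].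
  - move=> x [_] /=; rewrite !in_itv/= andbT => /negP; rewrite -leNgt.
    exact: lt_le_trans.
  - apply: (@le_trans _ _ (mu ((I `&` `]b, a]) `*` J))).
      rewrite le_measure ?inE//.
      + apply: measurableI => //; apply: measurableI; exact: mfst.
      + by apply: measurableX => //; exact: measurableI.
      move=> x; rewrite SIJ /= !in_itv/= andbT => -[[Ix Jx] [xa bx]].
      by split; [split; [exact: Ix|rewrite /= ?in_itv/= bx ltW]|exact: Jx].
    rewrite mulamX//; last exact: measurableI.
    apply: (@le_trans _ _ ((e / fine (m J))%:E * m J)).
      by rewrite lee_pmul2r// ge0_fin_numE// mlam_lty.
    rewrite -[X in _ * X]fineK ?ge0_fin_numE ?mlam_lty// -EFinM divfK//.
    by rewrite gt_eqF.
have ray2 a : cell_regular mu S p (snd @^-1` `]-oo, a[).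
  move=> e e0.
  have e' : (0 < e / fine (m I))%R by rewrite divr_gt0.
  have [b ba hb] := mlam_window lam_gt0 bJ a e'.
  exists (snd @^-1` `]-oo, a[), (snd @^-1` `]b, +oo[); split.
  - move=> x Sx /=; rewrite in_itv/= => xa; rewrite SIJ in Sx; case: Sx => Ix Jx.
    have [n hn] := adic_open_lt lam_gt0 bJ mJ0 Jx xa.
    exists n => y; rewrite SIJ => -[_ Jy] /pE[_ yx] /=.
    by rewrite in_itv/=; exact: hn.
  - move=> x Sx /=; rewrite in_itv/= andbT => xa; rewrite SIJ in Sx; case: Sx => Ix Jx.
    have [n hn] := adic_open_gt lam_gt0 bJ mJ0 Jx xa.
    exists n => y; rewrite SIJ => -[_ Jy] /pE[_ yx] /=.
    by rewrite in_itv/= andbT; exact: hn.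
  - by move=> x [].
  - move=> x [_] /=; rewrite !in_itv/= andbT => /negP; rewrite -leNgt.
    exact: lt_le_trans.
  - apply: (@le_trans _ _ (mu (I `*` (J `&` `]b, a])))).
      rewrite le_measure ?inE//.
      + apply: measurableI => //; apply: measurableI; exact: msnd.
      + by apply: measurableX => //; exact: measurableI.
      move=> x; rewrite SIJ /= !in_itv/= andbT => -[[Ix Jx] [xa bx]].
      by split; [exact: Ix|split; [exact: Jx|rewrite /= ?in_itv/= bx ltW]].
    rewrite mulamX//; last exact: measurableI.
    apply: (@le_trans _ _ (m I * (e / fine (m I))%:E)).
      by rewrite lee_pmul2l// ge0_fin_numE// mlam_lty.
    rewrite -[X in X * _]fineK ?ge0_fin_numE ?mlam_lty// -EFinM mulrC divfK//.
    by rewrite gt_eqF.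
(* The product sigma-algebra is generated by preimages of Borel sets under the two projections, and
   the Borel sets by open half-lines. *)
move=> E; apply: smallest_sub => // A [] [B mB <-]; rewrite setTI.
- pose C := [set B : set R | cell_regular mu S p (fst @^-1` B)].
  move: mB; rewrite [X in X B -> _](_ : _ = (@ocitv R).-sigma.-measurable)//.
  rewrite RGenInftyO.measurableE; move: B.
  suff : <<s @RGenInftyO.G R >> `<=` C by apply.
  apply: smallest_sub; last by move=> _ [a ->]; exact: ray1.
  split; rewrite /C/=.
  + by rewrite preimage_set0; case: sigma.
  + by move=> D rD; rewrite setTD preimage_setC; exact: cell_regularC.
  + by move=> F rF; rewrite preimage_bigcup; exact: cell_regular_bigcup.
- pose C := [set B : set R | cell_regular mu S p (snd @^-1` B)].
  move: mB; rewrite [X in X B -> _](_ : _ = (@ocitv R).-sigma.-measurable)//.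
  rewrite RGenInftyO.measurableE; move: B.
  suff : <<s @RGenInftyO.G R >> `<=` C by apply.
  apply: smallest_sub; last by move=> _ [a ->]; exact: ray2.
  split; rewrite /C/=.
  + by rewrite preimage_set0; case: sigma.
  + by move=> D rD; rewrite setTD preimage_setC; exact: cell_regularC.
  + by move=> F rF; rewrite preimage_bigcup; exact: cell_regular_bigcup.
Qed.

End rectangles.

(** * Modulus, real part and imaginary part *)

Section normc_theory.
Context {R : realType}.
Implicit Types z w : R[i].

Lemma normc_ge0 z : (0 <= normc z)%R.
Proof. by case: z => a b; exact: sqrtr_ge0. Qed.

Lemma normc_geRe z : (`|complex.Re z| <= normc z)%R.
Proof.
by case: z => a b /=; rewrite -sqrtr_sqr ler_wsqrtr// lerDl sqr_ge0.
Qed.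

Lemma normc_geIm z : (`|complex.Im z| <= normc z)%R.
Proof.
by case: z => a b /=; rewrite -sqrtr_sqr ler_wsqrtr// lerDr sqr_ge0.
Qed.

Lemma normc_leReIm z : (normc z <= `|complex.Re z| + `|complex.Im z|)%R.
Proof.
case: z => a b /=; rewrite -[leRHS]ger0_norm ?addr_ge0// -sqrtr_sqr ler_wsqrtr//.
by rewrite sqrrD !real_normK ?num_real// lerD2r lerDl mulrn_wge0// mulr_ge0.
Qed.

Lemma normc_real (r : R) : normc r%:C%C = `|r|%R.
Proof. by rewrite /= expr0n/= addr0 sqrtr_sqr. Qed.

Lemma ReM z w : complex.Re (z * w)%R =
  (complex.Re z * complex.Re w - complex.Im z * complex.Im w)%R.
Proof. by case: z w => [a b] [c d]. Qed.

Lemma ImM z w : complex.Im (z * w)%R =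
  (complex.Re z * complex.Im w + complex.Im z * complex.Re w)%R.
Proof. by case: z w => [a b] [c d]. Qed.

Lemma ReD z w : complex.Re (z + w)%R = (complex.Re z + complex.Re w)%R.
Proof. by case: z w => [a b] [c d]. Qed.

Lemma ImD z w : complex.Im (z + w)%R = (complex.Im z + complex.Im w)%R.
Proof. by case: z w => [a b] [c d]. Qed.

Lemma ReB z w : complex.Re (z - w)%R = (complex.Re z - complex.Re w)%R.
Proof. by case: z w => [a b] [c d]. Qed.

Lemma ImB z w : complex.Im (z - w)%R = (complex.Im z - complex.Im w)%R.
Proof. by case: z w => [a b] [c d]. Qed.

Lemma eq_complexP z w :
  complex.Re z = complex.Re w -> complex.Im z = complex.Im w -> z = w.
Proof. by case: z w => [a b] [c d] /= -> ->. Qed.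

Lemma Re_sum I (s : seq I) (P : pred I) (F : I -> R[i]) :
  complex.Re (\sum_(i <- s | P i) F i)%R = (\sum_(i <- s | P i) complex.Re (F i))%R.
Proof. by elim/big_rec2: _ => [|i x y _ <-]; rewrite ?ReD. Qed.

Lemma Im_sum I (s : seq I) (P : pred I) (F : I -> R[i]) :
  complex.Im (\sum_(i <- s | P i) F i)%R = (\sum_(i <- s | P i) complex.Im (F i))%R.
Proof. by elim/big_rec2: _ => [|i x y _ <-]; rewrite ?ImD. Qed.

Lemma normc_leD z w : (normc (z + w)%R <= normc z + normc w)%R.
Proof. exact: (@le_normcD R). Qed.

End normc_theory.

(** * Real integrals and blocks *)

Section integral_lemmas.
Context d (T : measurableType d) (R : realType).
Variable mu : {measure set T -> \bar R}.
Implicit Types (S D : set T) (u w : T -> R).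

Lemma Rintegral_supp S D u : S `<=` D -> (forall x, ~ S x -> u x = 0%R) ->
  (\int[mu]_(x in D) u x = \int[mu]_(x in S) u x)%R.
Proof.
move=> SD u0; rewrite Rintegral_mkcond [RHS]Rintegral_mkcond.
congr fine; apply: eq_integral => x _; rewrite !patchE.
case: ifPn; case: ifPn => //.
  by move=> /negP xS _; rewrite u0// => /mem_set.
by rewrite !inE => /SD xD /negP; rewrite inE.
Qed.

Lemma Rintegral_mul_indic S D u : D `<=` S ->
  (\int[mu]_(x in S) (u x * \1_D x) = \int[mu]_(x in D) u x)%R.
Proof.
move=> DS; rewrite -[in RHS](setIidr DS) Rintegral_mkcondr.
apply: eq_Rintegral => x _; rewrite patchE indicE.
by case: ifPn => _; rewrite ?mulr1 ?mulr0.
Qed.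

Lemma integrableZE D (k : R) u : measurable D ->
  mu.-integrable D (fun x => (u x)%:E) -> mu.-integrable D (fun x => (k * u x)%:E).
Proof. by move=> mD iu; under eq_fun do rewrite EFinM; exact: integrableZl. Qed.

Lemma integrable_bounded_supp S D u (c : R) : measurable S -> measurable D ->
  mu S < +oo -> measurable_fun setT u -> (forall x, (`|u x| <= c)%R) ->
  (forall x, ~ S x -> u x = 0%R) -> mu.-integrable D (EFin \o u).
Proof.
move=> mS mD Sfin mu_ uc u0.
apply: (integrableS measurableT) => //.
have -> : EFin \o u = (EFin \o u) \_ S.
  by apply/funext => x; rewrite patchE; case: ifPn => //= /negP; rewrite inE => /u0 ->.
apply/(integrable_mkcond _ mS)/measurable_bounded_integrable => //.
  exact: measurable_funTS.
exists c; split; first exact: num_real.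
by move=> K cK x _ /=; exact: (le_trans (uc x) (ltW cK)).
Qed.

Lemma le_Rintegral_abs D u w : measurable D ->
  measurable_fun D u -> mu.-integrable D (EFin \o w) ->
  {ae mu, forall x, D x -> (`|u x| <= w x)%R} ->
  mu.-integrable D (EFin \o u) /\
  (`|\int[mu]_(x in D) u x| <= \int[mu]_(x in D) w x)%R.
Proof.
move=> mD mu_ iw uw.
have mw : measurable_fun D w by apply/measurable_EFinP; exact: measurable_int iw.
have le1 : \int[mu]_(x in D) `|(u x)%:E| <= \int[mu]_(x in D) `|(w x)%:E|.
  apply: ae_ge0_le_integral => //.
  - by apply/measurable_EFinP; exact: measurableT_comp.
  - by apply/measurable_EFinP; exact: measurableT_comp.
  by apply: filterS uw => x h Dx; rewrite lee_fin (le_trans (h Dx))// ler_norm.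
have iu : mu.-integrable D (EFin \o u).
  apply/integrableP; split; first exact/measurable_EFinP.
  by apply: (le_lt_trans le1); case/integrableP : iw.
split => //; apply: (le_trans (le_normr_Rintegral mD iu)).
rewrite /Rintegral fine_le//.
- by apply: integrable_fin_num => //; exact: integrable_norm.
- exact: integrable_fin_num.
apply: (le_trans le1).
rewrite le_eqVlt; apply/orP; left; apply/eqP.
apply: ae_eq_integral => //.
- by apply/measurable_EFinP; exact: measurableT_comp.
- exact/measurable_EFinP.
apply: filterS uw => x h Dx; rewrite /= ger0_norm//.
exact: le_trans (h Dx).
Qed.

(** A real atom before normalisation: dividing by c mu(S) makes it one. Bounds and support hold
    everywhere rather than almost everywhere, so that pointwise identities between blocks are
    available. *)
Definition block (c : R) S u :=
  [/\ measurable_fun setT u, (forall x, (`|u x| <= c)%R),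
    (forall x, ~ S x -> u x = 0%R) & (\int[mu]_(x in S) u x = 0)%R].

Lemma block_integrable (c : R) S D u : measurable S -> mu S < +oo -> measurable D ->
  block c S u -> mu.-integrable D (EFin \o u).
Proof.
by move=> mS Sfin mD [mu_ uc u0 _]; exact: integrable_bounded_supp uc u0.
Qed.

End integral_lemmas.

(** * Splitting an indicator function along a disjoint cover *)

Section cover.
Context d (T : measurableType d) (R : realType).
Variable mu : {measure set T -> \bar R}.
Variables (S : set T) (P : (set T)^nat) (E : set T) (t : R).
Hypothesis mS : measurable S.
Hypothesis Sfin : mu S \is a fin_num.
Hypothesis S0 : (0 < fine (mu S))%R.
Hypothesis mP : forall k, measurable (P k).
Hypothesis tP : trivIset setT P.
Hypothesis PS : forall k, P k `<=` S.
Hypothesis mE : measurable E.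
Hypothesis EP : E `<=` \bigcup_k P k.
Hypothesis t0 : (0 < t)%R.
Hypothesis densP : forall k, mu (P k `&` E) <= t%:E * mu (P k).
Hypothesis densS : mu E <= t%:E * mu S.

Let Slty : mu S < +oo. Proof. by rewrite -ge0_fin_numE. Qed.

Let fin_sub A : measurable A -> A `<=` S -> mu A \is a fin_num.
Proof.
move=> mA AS; rewrite ge0_fin_numE// (le_lt_trans _ Slty)//.
by rewrite le_measure ?inE.
Qed.

Let ES : E `<=` S. Proof. by move=> x /EP[k _ /PS]. Qed.
Let mPE k : measurable (P k `&` E). Proof. exact: measurableI. Qed.
Let Pfin k : mu (P k) \is a fin_num. Proof. exact: fin_sub. Qed.
Let PEfin k : mu (P k `&` E) \is a fin_num.
Proof. by apply: fin_sub => // x [/PS]. Qed.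
Let Efin : mu E \is a fin_num. Proof. exact: fin_sub. Qed.

(** On a null set [P k], such as an empty one, the quotient is 0 by the convention on division, a
    value that still satisfies the identities below. *)
Let dens k : R := (fine (mu (P k `&` E)) / fine (mu (P k)))%R.

Let dens_ge0 k : (0 <= dens k)%R. Proof. by rewrite divr_ge0// fine_ge0. Qed.

Let dens_le k : (dens k <= t)%R.
Proof.
have := densP k; rewrite -(fineK (Pfin k)) -(fineK (PEfin k)) -EFinM lee_fin => h.
have [z|nz] := eqVneq (fine (mu (P k))) 0%R.
  by rewrite /dens z invr0 mulr0 ltW.
by rewrite ler_pdivrMr// lt_neqAle eq_sym nz fine_ge0.
Qed.

Let densE k : ((dens k)%:E * mu (P k) = mu (P k `&` E)).
Proof.
rewrite -[in LHS](fineK (Pfin k)) -[RHS](fineK (PEfin k)) -EFinM; congr EFin.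
have [z|nz] := eqVneq (fine (mu (P k))) 0%R; last by rewrite divfK.
rewrite z mulr0; apply/esym/le_anti; rewrite fine_ge0// andbT -z.
by rewrite fine_le// le_measure ?inE//; exact: subIsetl.
Qed.

Let small (k : nat) (x : T) : R :=
  (\1_(P k `&` E) x - dens k * \1_(P k) x)%R.

(** The conditional expectation of the indicator of [E] on the cover. As a nonnegative series it can
    be integrated term by term. *)
Let mean_fun (x : T) : \bar R := \sum_(k <oo) (dens k * \1_(P k) x)%:E.

Let mean_in k x : P k x -> mean_fun x = (dens k)%:E.
Proof.
move=> Pkx; apply/lim_near_cst => //; near=> N.
rewrite big_mkord.
have kN : (k < N)%N by near: N; exact: nbhs_infty_gt.
rewrite (bigD1 (Ordinal kN))//= big1 ?adde0 ?indicE ?mem_set ?mulr1// => i.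
move=> /eqP ik; rewrite indicE memNset ?mulr0// => Pix; apply: ik.
by apply/val_inj => /=; apply: (tP I I); exists x.
Unshelve. all: by end_near. Qed.

Let mean_out x : ~ (\bigcup_k P k) x -> mean_fun x = 0.
Proof.
move=> nPx; apply: eseries0 => k _ _; rewrite indicE memNset ?mulr0// => Pkx.
by apply: nPx; exists k.
Qed.

Let mean_fin x : mean_fun x = (fine (mean_fun x))%:E /\
  (0 <= fine (mean_fun x) <= t)%R.
Proof.
have [[k _ Pkx]|nPx] := pselect ((\bigcup_k P k) x).
  by rewrite (mean_in Pkx)/= dens_ge0 dens_le.
by rewrite mean_out//= lexx ltW.
Qed.

Let measurable_mean : measurable_fun setT mean_fun.
Proof.
apply: ge0_emeasurable_sum => [k x _ _|k _]; first by rewrite lee_fin mulr_ge0.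
by apply/measurable_EFinP; apply: measurable_funM => //; exact: measurable_indic.
Qed.

Let integral_mean : \int[mu]_(x in S) mean_fun x = mu E.
Proof.
rewrite integral_nneseries//; last 2 first.
- by move=> k; apply/measurable_EFinP; apply: measurable_funM.
- by move=> k x _; rewrite lee_fin mulr_ge0.
transitivity (\sum_(k <oo) mu (P k `&` E)).
  apply: eq_eseriesr => k _; rewrite -densE.
  under eq_integral do rewrite EFinM.
  rewrite ge0_integralZl//; last 2 first.
  - by apply/measurable_EFinP; exact: measurable_indic.
  - by rewrite lee_fin.
  by rewrite integral_indic// setIidl//; exact: PS.
rewrite -measure_semi_bigcup.
- by congr (mu _); rewrite -setI_bigcupl setIidr.
- by move=> k; exact: mPE.
- by apply: trivIset_setIr.
- exact: bigcupT_measurable.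
Qed.

Let large (x : T) : R :=
  (fine (mean_fun x) - fine (mu E) / fine (mu S) * \1_S x)%R.

Let mu_ratio : (0 <= fine (mu E) / fine (mu S) <= t)%R.
Proof.
rewrite divr_ge0 ?fine_ge0//= ler_pdivrMr//.
by have := densS; rewrite -(fineK Efin) -(fineK Sfin) -EFinM lee_fin.
Qed.

(** Both the local densities and the global one lie in [0, t], so their difference is bounded by t.
    Both terms integrate to mu(E) over [S]. *)
Let block_large : block mu t S large.
Proof.
have mfm : measurable_fun setT (fun x => fine (mean_fun x)).
  exact: measurableT_comp.
split.
- apply: measurable_funB => //.
  by apply: measurable_funM => //; exact: measurable_indic.
- move=> x; have [_ /andP[m0 mt]] := mean_fin x.
  have /andP[r0 rt] := mu_ratio; rewrite /large indicE ler_norml.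
  by case: (x \in S); rewrite ?mulr1 ?mulr0; lra.
- move=> x nSx; rewrite /large indicE memNset// mulr0 subr0 mean_out//.
  by move=> [k _ /PS].
- rewrite /large RintegralB//; last 2 first.
  + apply/integrableP; split; first by apply/measurable_EFinP; exact: measurable_funTS.
    rewrite (eq_integral mean_fun) ?integral_mean -?ge0_fin_numE// => x _.
    have [-> /andP[m0 _]] := mean_fin x.
    by rewrite /= ger0_norm.
  + apply: integrableZE => //.
    apply: (@integrable_bounded_supp _ _ _ mu S S (\1_S) 1%R) => //.
      * move=> x; rewrite indicE; case: (x \in S); rewrite ?normr1//.
      by rewrite normr0.
    * by move=> x nSx; rewrite indicE memNset.
  rewrite (_ : (\int[mu]_(x in S) fine (mean_fun x) = fine (mu E))%R); last first.
    rewrite /Rintegral -integral_mean; congr fine; apply: eq_integral => x _.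
    by have [<-] := mean_fin x.
  rewrite (_ : (\int[mu]_(x in S) _ = fine (mu E) / fine (mu S) * fine (mu S))%R).
    by rewrite divfK ?subrr// gt_eqF.
  rewrite -Rintegral_cst//; apply: eq_Rintegral => x xS.
  by rewrite indicE xS mulr1.
Qed.

Let block_small k : block mu 1 (P k) (small k).
Proof.
have d1 : (dens k <= 1)%R.
  rewrite /dens; have [z|nz] := eqVneq (fine (mu (P k))) 0%R.
    by rewrite z invr0 mulr0.
  rewrite ler_pdivrMr ?lt_neqAle ?[_ == fine _]eq_sym ?nz ?fine_ge0// mul1r.
  by rewrite fine_le// le_measure ?inE//; exact: subIsetl.
have d0 := dens_ge0 k.
have mI1 : measurable_fun setT (\1_(P k `&` E) : T -> R) by exact: measurable_indic.
have mI2 : measurable_fun setT (\1_(P k) : T -> R) by exact: measurable_indic.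
have int1 A : measurable A -> mu.-integrable (P k) (EFin \o (\1_A : T -> R)).
  move=> mA; apply: measurable_bounded_integrable => //.
    by rewrite -ge0_fin_numE.
  exists 1%R; split; first exact: num_real.
  move=> K K1 x _; apply: (le_trans _ (ltW K1)); rewrite /= indicE.
  by case: (x \in A); rewrite ?normr1// normr0.
split.
- by apply: measurable_funB => //; exact: measurable_funM.
- move=> x; rewrite /small !indicE in_setI ler_norml.
  by case: (x \in P k); case: (x \in E) => /=; rewrite ?mulr1 ?mulr0; lra.
- by move=> x nPx; rewrite /small !indicE !memNset ?mulr0 ?subr0// => -[].
- rewrite /small RintegralB//; last 2 first.
  + exact: int1.
  + by apply: integrableZE => //; exact: int1.
  rewrite RintegralZl//; last exact: int1.
  rewrite /Rintegral !integral_indic// setIid setIAC setIid setIC.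
  apply/eqP; rewrite subr_eq0; apply/eqP.
  have := congr1 fine (densE k); rewrite fineM// => ->.
  by rewrite setIC.
Qed.

Let tail n := \bigcup_(k >= n) P k.

Let mtail n : measurable (tail n).
Proof. by apply: bigcup_measurable => k _. Qed.

Let tail_cvg0 : mu (tail n) @[n --> \oo] --> 0.
Proof.
have := @nonincreasing_cvg_mu _ _ _ mu tail.
have -> : \bigcap_n tail n = set0.
  rewrite -subset0 => x tx; have [k _ Pkx] := tx 0%N I.
  have [j /= kj Pjx] := tx k.+1 I.
  have jk : j = k by apply: (tP I I); exists x.
  by rewrite jk ltnn in kj.
rewrite measure0; apply => //.
- rewrite -ge0_fin_numE//; apply: fin_sub => // x [k _]; exact: PS.
- move=> n k nk; apply/subsetPset => x [j /= kj Pjx]; exists j => //=.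
  exact: leq_trans kj.
Qed.

(** By disjointness at most one [small k] is nonzero at [x]: the difference is 0 if its index is
    below [n], and that single term, of modulus at most 1, otherwise. *)
Let residual n x : (`|\1_E x - fine (mean_fun x) - \sum_(0 <= k < n) small k x|
  <= \1_(tail n) x)%R.
Proof.
have [[k _ Pkx]|nPx] := pselect ((\bigcup_k P k) x); last first.
  rewrite mean_out//= indicE memNset ?subr0; last by move/EP.
  rewrite big1 ?subr0 ?normr0// => k _.
  by rewrite /small !indicE !memNset ?mulr0 ?subr0// => [Pkx|[Pkx _]];
    apply: nPx; exists k.
have other i : i <> k -> small i x = 0%R.
  move=> ik; have nPi : ~ P i x by move=> Pix; apply: ik; apply: (tP I I); exists x.
  by rewrite /small !indicE !memNset ?mulr0 ?subr0// => -[].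
have smallk : small k x = (\1_E x - dens k)%R.
  by rewrite /small !indicE in_setI (mem_set Pkx)/= mulr1.
rewrite (mean_in Pkx)/= -smallk; have [kn|nk] := ltnP k n.
  rewrite big_mkord (bigD1 (Ordinal kn))//= big1 ?addr0 ?subrr ?normr0// => i.
  by move=> /eqP ik; apply: other => ik'; apply: ik; apply/val_inj.
rewrite big_mkord big1 ?subr0; last first.
  by move=> i _; apply: other => ik; move: nk; rewrite -ik leqNgt ltn_ord.
have [_ + _ _] := block_small k => /(_ x) /le_trans; apply.
by rewrite indicE mem_set//; exists k.
Qed.

(** A Calderon-Zygmund decomposition: the good part is the conditional expectation minus the global
    mean, the bad parts are the deviations from the local means on the [P k]. *)
Lemma cover_split : exists (large : T -> R) (small : nat -> T -> R),
  [/\ block mu t S large, forall k, block mu 1 (P k) (small k),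
    (forall n x, (`|(\1_E x - fine (mu E) / fine (mu S) * \1_S x) -
       (large x + \sum_(0 <= k < n) small k x)| <= \1_(\bigcup_(k >= n) P k) x)%R),
    (forall n, measurable (\bigcup_(k >= n) P k)) &
    mu (\bigcup_(k >= n) P k) @[n --> \oo] --> 0].
Proof.
exists large, small; split => // n x.
rewrite (_ : _ - _ = \1_E x - fine (mean_fun x) - \sum_(0 <= k < n) small k x)%R//.
by rewrite /large; ring.
Qed.

End cover.

#[local] Opaque mulam.

(** * Atoms and atomic decompositions *)

Section atoms.
Context {R : realType} (lam : R).
Hypothesis lam_gt0 : (0 < lam)%R.
Local Notation m := (mlam lam).
Local Notation mu := (mulam lam).
Local Notation Q := (@quadrant R).
Implicit Types (f a b : R * R -> R[i]) (S D : set (R * R)).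

Let mQ : measurable Q. Proof. exact: measurable_quadrant. Qed.

(** These rectangles reach the axes, as any rectangle may; compact subsets of the open quadrant
    would not contain them. *)
Definition square (n : nat) : set (R * R) :=
  `]0%R, n.+1%:R] `*` `]0%R, n.+1%:R].

Lemma square_rectangle n : rectangle lam (square n).
Proof.
pose I : set R := `]0%R, n.+1%:R]%classic.
have bI : bounded_interval I.
  split; first exact: interval_is_interval.
    exists n.+1%:R; split; first exact: num_real.
    move=> K nK x; rewrite /I/= in_itv/= => /andP[x0 xn].
    by rewrite ger0_norm ?ltW// (le_lt_trans xn).
  by move=> x; rewrite /I /Rplus/= !in_itv/= andbT => /andP[].
split; first by exists I, I.
have mI : measurable I by exact: measurable_itv.
rewrite [X in _ < mu X](_ : square n = I `*` I)// mulamX//.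
suff : 0 < m I by move=> h; rewrite mule_gt0.
have := @mlam_itv_oo_gt0 _ _ lam_gt0 0%R n.+1%:R (lexx _).
rewrite ltr0n => /(_ isT) /lt_le_trans; apply.
by rewrite le_measure ?inE// => x; rewrite /I/= !in_itv/= => /andP[-> /ltW ->].
Qed.

Lemma square_mono n k : (n <= k)%N -> square n `<=` square k.
Proof.
move=> nk x [/=]; rewrite !in_itv/= => /andP[x0 xn] /andP[y0 yn].
by split; rewrite /= in_itv/= ?x0 ?y0/= (le_trans _ (_ : n.+1%:R <= _)%R)// ler_nat.
Qed.

Lemma subset_square S : (exists B : R, forall x, S x -> (x.1 <= B)%R /\ (x.2 <= B)%R) ->
  S `<=` Q -> exists n, S `<=` square n.
Proof.
move=> [B hB] SQ; exists (Num.truncn B) => x Sx.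
have [x1 x2] := hB _ Sx; have [] := SQ _ Sx.
rewrite /Rplus/= !in_itv/= !andbT => x10 x20.
by split; rewrite /= in_itv/= ?x10 ?x20/= (le_trans _ (ltW (truncnS_gt B))).
Qed.

Lemma rectangle_square S : rectangle lam S -> exists n, S `<=` square n.
Proof.
move=> rS; have := rectangle_quadrant rS.
apply: subset_square; have [I [J [bI bJ -> _ _]]] := rectangle_sides rS.
have [B1 B10 I1] := bounded_intervalP bI.
have [B2 B20 J2] := bounded_intervalP bJ.
exists (Num.max B1 B2) => x [/I1 /=] + /J2 /=.
rewrite !in_itv/= => /andP[_ h1] /andP[_ h2].
by rewrite !le_max h1 h2 ?orbT.
Qed.

Lemma quadrant_square : Q = \bigcup_n square n.
Proof.
apply/seteqP; split => x.
  move=> [x1 x2].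
  have [n hn] : exists n, [set x] `<=` square n; last by exists n => //; apply: hn.
  apply: subset_square; last by move=> _ ->.
  by exists (Num.max x.1 x.2) => _ ->; rewrite !le_max !lexx ?orbT.
by move=> [n _]; exact: (rectangle_quadrant (square_rectangle n)).
Qed.

Lemma measurable_square n : measurable (square n).
Proof. exact: rectangle_measurable (square_rectangle n). Qed.

Lemma inv_mu S : rectangle lam S -> (mu S)^-1 = ((fine (mu S))^-1)%:E.
Proof.
move=> rS; rewrite -[in LHS](fineK (rectangle_fin lam_gt0 rS)) inver.
by rewrite gt_eqF// rectangle_fine_gt0.
Qed.

Lemma atom_bound a : atom lam a -> exists S,
  [/\ rectangle lam S, cmeasurable Q a, cintegral lam Q a = 0%R &
    {ae mu, forall x, (normc (a x) <= (fine (mu S))^-1 * \1_S x)%R}].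
Proof.
move=> [ma [S [rS a0 aN ia]]]; exists S; split => //.
(* The norm at infinity is an essential supremum only when the whole space has positive measure. *)
have mu0 : 0 < mu setT.
  case: (rS) => _ /lt_le_trans; apply; rewrite le_measure ?inE//.
  exact: (rectangle_measurable rS).
move: aN; rewrite unlock /Lnorm mu0 inv_mu// => /ess_supP aN.
apply: filterS2 a0 aN => x a0; rewrite /= lee_fin ger0_norm ?normc_ge0//.
rewrite indicE; case: (boolP (x \in S)) => [_|/negP].
  by rewrite mulr1.
by rewrite inE => /a0 -> _; rewrite mulr0 [leLHS](normc0 R).
Qed.

(* The real and imaginary parts of [z * a] for an atom [a] with [normc z <= r]. *)
Definition rough_block (r : R) (u : R * R -> R) := exists S,
  [/\ rectangle lam S, measurable_fun Q u, (\int[mu]_(x in Q) u x = 0)%R &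
    {ae mu, forall x, (`|u x| <= r * (fine (mu S))^-1 * \1_S x)%R}].

Lemma integrable_indicQ (k : R) S : rectangle lam S ->
  mu.-integrable Q (fun x => (k * \1_S x)%:E).
Proof.
move=> rS; have mS := rectangle_measurable rS.
apply: (@integrable_bounded_supp _ _ _ mu S Q (fun x => k * \1_S x)%R `|k|%R) => //.
- exact: (rectangle_lty lam_gt0 rS).
- by apply: measurable_funM => //; exact: measurable_indic.
- move=> x; rewrite normrM indicE; case: (x \in S); rewrite ?normr1 ?mulr1//.
  by rewrite normr0 mulr0.
- by move=> x nSx; rewrite indicE memNset// mulr0.
Qed.

Lemma rough_block_integrable r u : rough_block r u -> mu.-integrable Q (EFin \o u).
Proof.
move=> [S [rS mu_ _ ub]].
have iw := @integrable_indicQ (r * (fine (mu S))^-1)%R S rS.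
by have [] := le_Rintegral_abs mQ mu_ iw (filterS (fun x h _ => h) ub).
Qed.

Lemma atom_integrable a : atom lam a -> cintegrable lam Q a.
Proof.
move=> /atom_bound[S [rS [mR mI] _ ab]].
have iw := @integrable_indicQ ((fine (mu S))^-1)%R S rS.
split.
  have [//|+ _] := le_Rintegral_abs mQ mR iw _; last exact.
  by apply: filterS ab => x h _; rewrite (le_trans _ h)// normc_geRe.
have [//|+ _] := le_Rintegral_abs mQ mI iw _; last exact.
by apply: filterS ab => x h _; rewrite (le_trans _ h)// normc_geIm.
Qed.

Lemma cmeasurableZ D f (k : R[i]) : measurable D -> cmeasurable D f ->
  cmeasurable D (fun x => k * f x)%R.
Proof.
move=> mD [mR mI]; split.
  under eq_fun do rewrite ReM.
  by apply: measurable_funB; exact: measurable_funM.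
under eq_fun do rewrite ImM.
by apply: measurable_funD; exact: measurable_funM.
Qed.

Lemma cintegrableZ D f (k : R[i]) : measurable D -> cintegrable lam D f ->
  cintegrable lam D (fun x => k * f x)%R.
Proof.
move=> mD [mR mI]; split.
  under eq_fun do rewrite ReM EFinB !EFinM.
  by apply: integrableB => //; exact: integrableZl.
under eq_fun do rewrite ImM EFinD !EFinM.
by apply: integrableD => //; exact: integrableZl.
Qed.

Lemma cintegrableD D f g : measurable D -> cintegrable lam D f -> cintegrable lam D g ->
  cintegrable lam D (fun x => f x + g x)%R.
Proof.
move=> mD [mR mI] [nR nI]; split.
  by under eq_fun do rewrite ReD EFinD; exact: integrableD.
by under eq_fun do rewrite ImD EFinD; exact: integrableD.
Qed.

Lemma cintegralZ D f (k : R[i]) : measurable D -> cintegrable lam D f ->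
  cintegral lam D (fun x => k * f x)%R = (k * cintegral lam D f)%R.
Proof.
move=> mD [mR mI]; apply: eq_complexP; rewrite ?ReM ?ImM /=.
  under eq_Rintegral do rewrite ReM.
  rewrite RintegralB//; last 2 first.
  - exact: integrableZE.
  - exact: integrableZE.
  by rewrite !RintegralZl.
under eq_Rintegral do rewrite ImM.
rewrite RintegralD//; last 2 first.
- exact: integrableZE.
- exact: integrableZE.
by rewrite !RintegralZl.
Qed.

Lemma cintegralD D f g : measurable D -> cintegrable lam D f -> cintegrable lam D g ->
  cintegral lam D (fun x => f x + g x)%R = (cintegral lam D f + cintegral lam D g)%R.
Proof.
move=> mD [mR mI] [nR nI]; apply: eq_complexP; rewrite ?ReD ?ImD/=.
  by under eq_Rintegral do rewrite ReD; rewrite RintegralD.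
by under eq_Rintegral do rewrite ImD; rewrite RintegralD.
Qed.

Lemma cintegrable0 D : cintegrable lam D (fun=> 0%R).
Proof. by split; exact: integrable0. Qed.

Lemma cintegrable_sum D n (F : nat -> R * R -> R[i]) : measurable D ->
  (forall i, cintegrable lam D (F i)) ->
  cintegrable lam D (fun x => \sum_(0 <= i < n) F i x)%R.
Proof.
move=> mD iF; elim: n => [|n ih].
  by under [X in cintegrable _ _ X]eq_fun do rewrite big_geq//; exact: cintegrable0.
under [X in cintegrable _ _ X]eq_fun do rewrite big_nat_recr//=.
exact: cintegrableD.
Qed.

Lemma measurable_normc D f : cmeasurable D f -> measurable_fun D (fun x => normc (f x)).
Proof.
move=> [mR mI]; rewrite (_ : (fun x => _) =
  (fun x => Num.sqrt (complex.Re (f x) ^+ 2 + complex.Im (f x) ^+ 2)%R)); last first.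
  by apply/funext => x; case: (f x).
apply: (@measurableT_comp _ _ _ _ _ _ (@Num.sqrt R)).
  exact: (continuous_measurable_fun (@sqrt_continuous R)).
by apply: measurable_funD; exact: measurable_funX.
Qed.

Lemma cintegrable_normc D f : measurable D -> cintegrable lam D f ->
  mu.-integrable D (fun x => (normc (f x))%:E).
Proof.
move=> mD [iR iI].
have cm : cmeasurable D f.
  by split; apply/measurable_EFinP; [exact: measurable_int iR|exact: measurable_int iI].
have iS : mu.-integrable D
    (fun x => (`|complex.Re (f x)| + `|complex.Im (f x)|)%:E).
  under eq_fun do rewrite EFinD.
  apply: integrableD => //; first exact: (@integrable_norm _ _ _ mu D (fun x => complex.Re (f x))).
  exact: (@integrable_norm _ _ _ mu D (fun x => complex.Im (f x))).
have [//|+ _] := le_Rintegral_abs mD (measurable_normc cm) iS _; last exact.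
by apply: aeW => x _; rewrite ger0_norm ?normc_ge0// normc_leReIm.
Qed.

Lemma atom_blockRe a (z : R[i]) : atom lam a ->
  rough_block (normc z) (fun x => complex.Re (z * a x)%R).
Proof.
move=> aa; have [S [rS ma ia ab]] := atom_bound aa; have inta := atom_integrable aa.
exists S; split => //.
- by have [] := cmeasurableZ z mQ ma.
- have := cintegralZ z mQ inta; rewrite ia mulr0.
  by move/(congr1 (@complex.Re R)).
- apply: filterS ab => x h; rewrite (le_trans (normc_geRe _))//.
  by rewrite normcM -mulrA ler_wpM2l// normc_ge0.
Qed.

Lemma atom_blockIm a (z : R[i]) : atom lam a ->
  rough_block (normc z) (fun x => complex.Im (z * a x)%R).
Proof.
move=> aa; have [S [rS ma ia ab]] := atom_bound aa; have inta := atom_integrable aa.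
exists S; split => //.
- by have [] := cmeasurableZ z mQ ma.
- have := cintegralZ z mQ inta; rewrite ia mulr0.
  by move/(congr1 (@complex.Im R)).
- apply: filterS ab => x h; rewrite (le_trans (normc_geIm _))//.
  by rewrite normcM -mulrA ler_wpM2l// normc_ge0.
Qed.

Lemma block_atom c S w : rectangle lam S -> (0 < c)%R -> block mu c S w ->
  atom lam (fun x => ((c * fine (mu S))^-1 * w x)%:C%C).
Proof.
move=> rS c0 [mw wc w0 iw]; have muS0 := rectangle_fine_gt0 lam_gt0 rS.
have k0 : (0 < (c * fine (mu S))^-1)%R by rewrite invr_gt0 mulr_gt0.
have mS := rectangle_measurable rS.
split.
  by split => //=; apply: measurable_funTS; exact: measurable_funM.
exists S; split => //.
- by apply: aeW => x nSx; rewrite w0// mulr0.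
- rewrite unlock /Lnorm; case: ifPn => [_|_]; last by rewrite inv_mu// lee_fin invr_ge0 ltW.
  apply/ess_supP; apply: aeW => x; rewrite inv_mu//.
  change (`|normc ((c * fine (mu S))^-1 * w x)%:C%C|%:E <= ((fine (mu S))^-1)%:E).
  rewrite normc_real lee_fin normr_id normrM (gtr0_norm k0) invfM.
  rewrite mulrAC -[leRHS]mul1r ler_wpM2r ?invr_ge0 ?(ltW muS0)//.
  by rewrite mulrC ler_pdivrMr// mul1r.
- apply: eq_complexP => /=; last by rewrite Rintegral_cst// mul0r.
  rewrite RintegralZl//; last by apply: (block_integrable mS (rectangle_lty lam_gt0 rS) mQ (And4 mw wc w0 iw)).
  rewrite (@Rintegral_supp _ _ _ mu S) ?iw ?mulr0//; exact: (rectangle_quadrant rS).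
Qed.

Lemma zero_atom : atom lam (fun=> 0%R).
Proof.
have := @block_atom 1%R (square 0) (fun=> 0%R) (square_rectangle 0) ltr01.
under [X in atom _ X]eq_fun do rewrite mulr0.
apply; split => //; first by move=> x; rewrite normr0.
by rewrite Rintegral_cst ?mul0r//; exact: measurable_square.
Qed.

(* Finite combinations are padded with zero coefficients. *)
Lemma finite_decomposition n (alpha : 'I_n -> R[i]) (atoms : 'I_n -> R * R -> R[i]) f :
  (forall i, atom lam (atoms i)) ->
  (forall x, f x = (\sum_(i < n) alpha i * atoms i x)%R) ->
  exists alpha' atoms', atomic_decomposition lam f alpha' atoms' /\
    \sum_(0 <= i <oo) (normc (alpha' i))%:E = (\sum_(i < n) normc (alpha i))%:E.
Proof.
move=> aa fE.
pose alpha' (i : nat) : R[i] := if insub i is Some j then alpha j else 0%R.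
pose atoms' (i : nat) := if insub i is Some j then atoms j else (fun=> 0%R).
have splitE (V : nmodType) (F : nat -> V) (G : 'I_n -> V) N :
    (forall i : 'I_n, F i = G i) -> (forall i, (n <= i)%N -> F i = 0%R) ->
    (n <= N)%N -> (\sum_(0 <= i < N) F i = \sum_(i < n) G i)%R.
  move=> FG F0 nN; rewrite (big_cat_nat (leq0n n) nN)/= big_mkord.
  have -> : (\sum_(n <= i < N) F i = 0)%R.
    rewrite big_nat_cond big1// => i /andP[/andP[ni _] _]; exact: F0.
  by rewrite addr0; apply: eq_bigr => i _; exact: FG.
have alphaE (i : 'I_n) : alpha' i = alpha i by rewrite /alpha' valK.
have atomsE (i : 'I_n) : atoms' i = atoms i by rewrite /atoms' valK.
have alpha0 i : (n <= i)%N -> alpha' i = 0%R.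
  by move=> ni; rewrite /alpha' insubN// -leqNgt.
have sumE : \sum_(0 <= i <oo) (normc (alpha' i))%:E = (\sum_(i < n) normc (alpha i))%:E.
  apply/lim_near_cst => //; near=> N.
  rewrite (splitE _ _ (fun i => (normc (alpha i))%:E)).
  - by rewrite sumEFin.
  - by move=> i; rewrite alphaE.
  - by move=> i ni; rewrite alpha0// [normc _](normc0 R).
  - by near: N; exact: nbhs_infty_ge.
exists alpha', atoms'; split => //; split.
- by move=> i; rewrite /atoms'; case: insub => [j|]; [exact: aa|exact: zero_atom].
- by rewrite sumE ltry.
- apply: cvg_near_cst; near=> N.
  rewrite integral0_eq// => x _; rewrite fE.
  rewrite (splitE _ _ (fun i => (alpha i * atoms i x)%R)).
  - by rewrite subrr [normc _](normc0 R).
  - by move=> i; rewrite alphaE atomsE.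
  - by move=> i ni; rewrite alpha0// mul0r.
  - by near: N; exact: nbhs_infty_ge.
Unshelve. all: by end_near. Qed.

Lemma h1_norm_le f alpha atoms : atomic_decomposition lam f alpha atoms ->
  h1_norm lam f <= \sum_(0 <= i <oo) (normc (alpha i))%:E.
Proof. by move=> h; apply: ereal_inf_lbound; exists alpha, atoms. Qed.

Lemma cintegrable_finsum D n (alpha : 'I_n -> R[i]) (atoms : 'I_n -> R * R -> R[i]) f :
  measurable D -> (forall i, cintegrable lam D (atoms i)) ->
  (forall x, f x = (\sum_(i < n) alpha i * atoms i x)%R) -> cintegrable lam D f.
Proof.
move=> mD ia fE; have -> : f = (fun x => \sum_(i < n) alpha i * atoms i x)%R.
  exact/funext.
elim: n alpha atoms ia {f fE} => [|n ih] alpha atoms ia.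
  by under [X in cintegrable _ _ X]eq_fun do rewrite big_ord0; exact: cintegrable0.
under [X in cintegrable _ _ X]eq_fun do rewrite big_ord_recr/=.
apply: cintegrableD => //; last exact: cintegrableZ.
by apply: ih => i; exact: ia.
Qed.

Lemma span_h1 n (alpha : 'I_n -> R[i]) (atoms : 'I_n -> R * R -> R[i]) f :
  (forall i, atom lam (atoms i)) ->
  (forall x, f x = (\sum_(i < n) alpha i * atoms i x)%R) ->
  h1 lam f /\ h1_norm lam f <= (\sum_(i < n) normc (alpha i))%:E.
Proof.
move=> aa fE; have [alpha' [atoms' [dec sumE]]] := finite_decomposition aa fE.
split; last by rewrite -sumE; exact: h1_norm_le dec.
split; last by exists alpha', atoms'.
apply: (@cintegrable_finsum Q n alpha atoms f mQ) => //.
by move=> i; exact: atom_integrable.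
Qed.

Lemma atom_h1 a : atom lam a -> h1 lam a /\ h1_norm lam a <= 1.
Proof.
move=> aa; have := @span_h1 1 (fun=> 1%R) (fun=> a) a (fun=> aa).
rewrite big_ord1 [normc _](normc1 R); apply => x.
by rewrite big_ord1 mul1r.
Qed.

Lemma atom_span a : atom lam a -> atomic_span lam a.
Proof.
by move=> aa; exists 1%N, (fun=> 1%R), (fun=> a); split => // x; rewrite big_ord1 mul1r.
Qed.

Lemma block_span c S w : rectangle lam S -> (0 < c)%R -> block mu c S w ->
  exists2 a, atom lam a & forall x, (w x)%:C%C = ((c * fine (mu S))%:C%C * a x)%R.
Proof.
move=> rS c0 bw; exists (fun x => ((c * fine (mu S))^-1 * w x)%:C%C).
  exact: block_atom.
move=> x; rewrite -rmorphM/= mulrA divff ?mul1r// gt_eqF//.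
by rewrite mulr_gt0// rectangle_fine_gt0.
Qed.

End atoms.

(** * Bounded functionals are small on corrected indicators of small sets *)

Section dual_bound.
Context {R : realType} (lam : R).
Hypothesis lam_gt0 : (0 < lam)%R.
Local Notation mu := (mulam lam).
Local Notation Q := (@quadrant R).
Implicit Types (f a b : R * R -> R[i]) (S D : set (R * R)).

Let mQ : measurable Q. Proof. exact: measurable_quadrant. Qed.

Lemma h1_norm_ge0 f : 0 <= h1_norm lam f.
Proof.
apply: le_ereal_inf_tmp => _ [alpha [atoms [_ ->]]].
by apply: nneseries_ge0 => n _ _; rewrite lee_fin normc_ge0.
Qed.

Lemma h1_dual_bound L : h1_dual lam L -> exists2 M : R, (0 < M)%R &
  forall f, h1 lam f -> (normc (L f))%:E <= M%:E * h1_norm lam f.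
Proof.
move=> [_ [M hM]]; exists (`|M| + 1)%R; first by rewrite ltr_wpDl.
move=> f hf; apply: (le_trans (hM f hf)); rewrite lee_wpmul2r ?h1_norm_ge0//.
by rewrite lee_fin (le_trans (ler_norm _))// lerDl.
Qed.

Lemma block_h1 c S w : rectangle lam S -> (0 < c)%R -> block mu c S w ->
  h1 lam (fun x => (w x)%:C%C) /\
  h1_norm lam (fun x => (w x)%:C%C) <= (c * fine (mu S))%:E.
Proof.
move=> rS c0 bw; have [a aa wE] := block_span lam_gt0 rS c0 bw.
have [|h1w nw] := @span_h1 _ _ lam_gt0 1%N (fun=> (c * fine (mu S))%:C%C)
  (fun=> a) (fun x => (w x)%:C%C) (fun=> aa).
  by move=> x; rewrite big_ord1 wE.
split => //; apply: (le_trans nw); rewrite big_ord1 normc_real.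
by rewrite ger0_norm// mulr_ge0// ?ltW// rectangle_fine_gt0.
Qed.

(** The large block has height t on [S] and the small ones height 1 on the [P k], which gives the
    coefficients t mu(S) and mu(P_k). The series converges in L^1 because its error is at most the
    indicator of the union of the remaining [P k], whose measure tends to 0. *)
Lemma cover_decomposition S (P : (set (R * R))^nat) E (t : R) :
  rectangle lam S -> trivIset setT P ->
  (forall k, P k = set0 \/ rectangle lam (P k)) -> (forall k, P k `<=` S) ->
  measurable E -> E `<=` \bigcup_k P k -> (0 < t)%R ->
  (forall k, mu (P k `&` E) <= t%:E * mu (P k)) -> mu E <= t%:E * mu S ->
  \sum_(k <oo) mu (P k) < +oo ->
  let f := fun x => (\1_E x - fine (mu E) / fine (mu S) * \1_S x)%:C%C in
  h1 lam f /\ h1_norm lam f <= (t * fine (mu S))%:E + \sum_(k <oo) mu (P k).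
Proof.
move=> rS tP rP PS mE EP t0 dP dS sumP f.
have mS := rectangle_measurable rS.
have Sfin := rectangle_fin lam_gt0 rS.
have S0 := rectangle_fine_gt0 lam_gt0 rS.
have mP k : measurable (P k).
  by case: (rP k) => [->|/rectangle_measurable].
have Pfin k : mu (P k) \is a fin_num.
  by case: (rP k) => [->|/(rectangle_fin lam_gt0)]; first by rewrite measure0.
have [large [small [bl bs residual mtail tail0]]] :=
  cover_split mS Sfin S0 mP tP PS mE EP t0 dP dS.
pose tail n := \bigcup_(k >= n) P k.
have [a0 aa0 a0E] := block_span lam_gt0 rS t0 bl.
have /choice[a aP] k : exists a, atom lam a /\
    forall x, (small k x)%:C%C = ((fine (mu (P k)))%:C%C * a x)%R.
  (* An empty [P k] is not a rectangle; it contributes the zero atom, with coefficient 0. *)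
  case: (rP k) => [P0|rPk].
    exists (fun=> 0%R); split; first exact: zero_atom.
    have [_ _ s0 _] := bs k.
    by move=> x; rewrite mulr0 s0// P0.
  have [b ab bE] := block_span lam_gt0 rPk ltr01 (bs k).
  by exists b; split => // x; rewrite bE mul1r.
pose alpha i : R[i] := if i is k.+1 then (fine (mu (P k)))%:C%C
  else (t * fine (mu S))%:C%C.
pose atoms i := if i is k.+1 then a k else a0.
have sum_alpha : \sum_(0 <= i <oo) (normc (alpha i))%:E =
    (t * fine (mu S))%:E + \sum_(k <oo) mu (P k).
  rewrite nneseries_recl//; last by move=> k _; rewrite lee_fin normc_ge0.
  rewrite normc_real ger0_norm ?mulr_ge0 ?(ltW t0) ?(ltW S0)//; congr (_ + _).
  rewrite -nneseries_addn//; last by move=> k; rewrite lee_fin normc_ge0.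
  apply: eq_eseriesr => k _; rewrite addn1 normc_real ger0_norm ?fine_ge0//.
  exact: fineK (Pfin k).
have sumE n x : (\sum_(0 <= i < n.+1) alpha i * atoms i x =
    (large x + \sum_(0 <= k < n) small k x)%:C%C)%R.
  rewrite big_nat_recl//= -a0E rmorphD/= rmorph_sum/=; congr (_ + _)%R.
  by apply: eq_bigr => k _; have [_ ->] := aP k.
have resE n x : (f x - \sum_(0 <= i < n.+1) alpha i * atoms i x =
    ((\1_E x - fine (mu E) / fine (mu S) * \1_S x) -
       (large x + \sum_(0 <= k < n) small k x))%:C%C)%R.
  by rewrite sumE /f -rmorphB.
have dec : atomic_decomposition lam f alpha atoms.
  split.
  - by move=> [|k]//=; have [] := aP k.
  - by rewrite sum_alpha lte_add_pinfty// ltry.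
  (* Index 0 carries the large atom, so n small blocks correspond to n + 1 terms of the series. *)
  rewrite -(cvg_shiftn 1).
  apply: (squeeze_cvge _ (cvg_cst 0) tail0).
  - apply: nearW => n; rewrite integral_ge0//=; last first.
      by move=> x _; rewrite lee_fin normc_ge0.
    rewrite addn1.
    apply: (@le_trans _ _ (\int[mu]_(x in Q) (\1_(tail n) x)%:E)); last first.
      rewrite integral_indic; [|exact: mQ|exact: mtail].
      apply: le_measure; rewrite ?inE; [|exact: mtail|exact: subIsetl].
      by apply: measurableI; [exact: mtail|exact: mQ].
    apply: ge0_le_integral => //.
    + by move=> x _; rewrite lee_fin normc_ge0.
    + apply/measurable_EFinP.
      under eq_fun do rewrite resE normc_real.
      apply: measurable_funTS; apply: measurableT_comp => //.
      apply: measurable_funB.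
        apply: measurable_funB; first exact: measurable_indic.
        by apply: measurable_funM => //; exact: measurable_indic.
      apply: measurable_funD; first by case: bl.
      by apply: measurable_sum => k; have [] := bs k.
    + apply/measurable_EFinP; apply: measurable_funTS.
      exact: measurable_indic (mtail n).
    + by move=> x _; rewrite lee_fin resE normc_real; exact: residual.
split; last by rewrite -sum_alpha; exact: h1_norm_le dec.
split; last by exists alpha, atoms.
have ES : E `<=` S by move=> x /EP[k _ /PS].
have int1 A : measurable A -> A `<=` S -> mu.-integrable Q (EFin \o (\1_A : R * R -> R)).
  move=> mA AS; apply: (@integrable_bounded_supp _ _ _ mu S Q _ 1%R) => //.
  - exact: (rectangle_lty lam_gt0 rS).
  - move=> x; rewrite indicE; case: (x \in A); rewrite ?normr1//.
    by rewrite normr0.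
  - by move=> x nSx; rewrite indicE memNset// => /AS.
split; rewrite /f/=; last exact: integrable0.
under eq_fun do rewrite EFinB.
apply: integrableB => //; first exact: int1.
by apply: integrableZE => //; exact: int1.
Qed.

Lemma indicator_small L S (e : R) : h1_dual lam L -> rectangle lam S -> (0 < e)%R ->
  exists2 d : R, (0 < d)%R & forall E, measurable E -> E `<=` S -> mu E < d%:E ->
  (normc (L (fun x => (\1_E x - fine (mu E) / fine (mu S) * \1_S x)%:C%C)) <= e)%R.
Proof.
move=> dL rS e0; have [M M0 LM] := h1_dual_bound dL.
have [p [mp refp p0 cellp regp]] := rectangle_partition lam_gt0 rS.
have mS := rectangle_measurable rS.
have Sfin := rectangle_fin lam_gt0 rS.
have S0 := rectangle_fine_gt0 lam_gt0 rS.
pose mS' := fine (mu S).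
(* The large atom has coefficient 4 s mu(S), the 4 being the doubling constant; this choice keeps
   its contribution below e/2. *)
pose s : R := Num.min (1 / 2)%R (e / (8 * M * mS'))%R.
have s0 : (0 < s)%R by rewrite lt_min divr_gt0//= divr_gt0// !mulr_gt0.
have s1 : (s < 1)%R by rewrite gt_min; apply/orP; left; lra.
have sM : (M * (s * 4 * mS') <= e / 2)%R.
  have : (s <= e / (8 * M * mS'))%R by rewrite ge_min lexx orbT.
  rewrite ler_pdivlMr ?mulr_gt0// => h; lra.
(* The first bound keeps the contribution 2 d M / s of the small atoms below e/2; the second ensures
   that [S] itself is not a dense cell. *)
pose d : R := Num.min (s * e / (4 * M))%R (s * mS' / 2)%R.
have d0 : (0 < d)%R by rewrite lt_min !divr_gt0 ?mulr_gt0.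
have dM : (M * (2 * d / s) <= e / 2)%R.
  have : (d <= s * e / (4 * M))%R by rewrite ge_min lexx.
  rewrite ler_pdivlMr ?mulr_gt0// => h.
  rewrite mulrA ler_pdivrMr//; lra.
have dS : (2 * d <= s * mS')%R.
  have : (d <= s * mS' / 2)%R by rewrite ge_min lexx orbT.
  lra.
exists d => // E mE ES Ed.
have [U [oU EU muU]] := cell_regular_outer mS mp refp mE (regp E mE) d0.
have SE : S `&` E = E by rewrite setIidr.
rewrite SE in EU muU.
have muU2 : mu (S `&` U) <= (2 * d)%:E.
  apply: (le_trans muU); rewrite mulr_natl mulr2n EFinD leeD2r// ltW//.
have mSU : measurable (S `&` U) by apply: cellopen_measurable oU.
have [|||P [tP cP UP dP sP]] := @stopping_cover _ _ _ mu S p mS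
    (rectangle_lty lam_gt0 rS) mp refp 4 s _ _ (fun x y _ _ => p0 x y) U oU s0 s1.
- by move=> n x Sx; have [[_ +] _] := cellp n x Sx.
- by move=> n x Sx; have [] := cellp n x Sx.
- apply: (le_trans muU2); rewrite -(fineK Sfin) -EFinM lee_fin; exact: dS.
have PS k : P k `<=` S.
  by case: (cP k) => [->//|[n [x [_ ->]]]] y [].
have rP k : P k = set0 \/ rectangle lam (P k).
  case: (cP k) => [->|[n [x [Sx ->]]]]; [by left|right].
  by have [] := cellp n x Sx.
have mP k : measurable (P k).
  by case: (rP k) => [->//|]; exact: rectangle_measurable.
have mPU k : measurable (P k `&` U).
  by rewrite -(setIidl (PS k)) -setIA; exact: measurableI.
(* The weak type estimate: the disjoint cells have density at least s, so s times their total
   measure is at most that of S [&] U, hence at most 2 d. *)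
have sumP : \sum_(k <oo) mu (P k) <= (2 * d / s)%:E.
  rewrite -(@lee_pmul2l _ s%:E)// ?lte_fin// -EFinM mulrC divfK ?gt_eqF//.
  rewrite -nneseriesZl//; apply: (le_trans _ muU2).
  apply: (@le_trans _ _ (\sum_(k <oo) mu (P k `&` U))).
    by apply: lee_nneseries => // k _; rewrite mule_ge0// lee_fin ltW.
  rewrite -measure_semi_bigcup.
  - rewrite le_measure ?inE//; first exact: bigcupT_measurable.
    by move=> x [k _ [Pkx Ux]]; split => //; exact: PS Pkx.
  - exact: mPU.
  - exact: trivIset_setIr.
  - exact: bigcupT_measurable.
have [|||||hf nf] := @cover_decomposition S P E (s * 4)%R rS tP rP PS mE.
- by move=> x Ex; apply: UP; split; [exact: ES|exact: EU].
- by rewrite mulr_gt0.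
- move=> k; apply: (le_trans _ (dP k)); rewrite le_measure ?inE//.
    exact: measurableI.
  by apply: setIS => x Ex; exact: EU.
- apply: (le_trans (ltW Ed)); rewrite -(fineK Sfin) -EFinM lee_fin -/mS'.
  have : (0 <= s * mS')%R by rewrite mulr_ge0// ltW.
  by move: dS d0; lra.
- exact: (le_lt_trans sumP (ltry _)).
rewrite -lee_fin; apply: (le_trans (LM _ hf)).
apply: (@le_trans _ _ (M%:E * ((s * 4 * mS')%:E + (2 * d / s)%:E))).
  rewrite lee_pmul2l ?lte_fin//; apply: (le_trans nf).
  by rewrite leeD2l.
rewrite -EFinD -EFinM lee_fin mulrDr; lra.
Qed.

End dual_bound.

(** * Radon-Nikodym density of an absolutely continuous additive set function *)

Section charge_density.
Context d (T : measurableType d) (R : realType).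
Variable mu : {measure set T -> \bar R}.
Variables (S : set T) (F : set T -> R).
Hypothesis mS : measurable S.
Hypothesis Sfin : mu S < +oo.
Hypothesis addF : forall A B, measurable A -> measurable B -> A `<=` S -> B `<=` S ->
  A `&` B = set0 -> F (A `|` B) = (F A + F B)%R.
Hypothesis acF : forall e : R, (0 < e)%R -> exists2 r : R, (0 < r)%R &
  forall A, measurable A -> A `<=` S -> mu A < r%:E -> (`|F A| <= e)%R.

Let F0 : F set0 = 0%R.
Proof.
have := @addF set0 set0 measurable0 measurable0 (@sub0set _ _) (@sub0set _ _) (setI0 _).
by rewrite setU0 => /eqP; rewrite -subr_eq0 opprD addrA subrr sub0r oppr_eq0 => /eqP.
Qed.

Definition charge_on (A : set T) : \bar R := (F (S `&` A))%:E.

Let charge_on0 : charge_on set0 = 0.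
Proof. by rewrite /charge_on setI0 F0. Qed.

Let charge_on_finite A : measurable A -> charge_on A \is a fin_num.
Proof. by []. Qed.

Let charge_on_sigma_additive : semi_sigma_additive charge_on.
Proof.
move=> A mA tA mUA.
have mSA n : measurable (S `&` A n) by exact: measurableI.
pose tail n := \bigcup_(k >= n) (S `&` A k).
have mtail n : measurable (tail n) by apply: bigcup_measurable.
have tailS n : tail n `<=` S by move=> x [k _ []].
(* Finite additivity leaves the value on the tail as the error; tails of a disjoint sequence in a
   set of finite measure have measure tending to 0, so absolute continuity removes it. *)
have sumE n : \sum_(0 <= i < n) charge_on (A i) =
    charge_on (\bigcup_n A n) - (F (tail n))%:E.
  rewrite /charge_on; elim: n => [|n ih].
    rewrite big_geq// /tail (_ : \bigcup_(k >= 0) _ = S `&` \bigcup_n A n) ?subee//.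
    rewrite setI_bigcupr; apply/seteqP; split => x [k _ h]; by exists k.
  rewrite big_nat_recr//= ih.
  rewrite (_ : tail n = (S `&` A n) `|` tail n.+1); last first.
    apply/seteqP; split => [x [k /= nk h]|x [h|[k /= nk h]]].
    - by move: nk h; rewrite leq_eqVlt => /predU1P[<-|nk] h; [left|right; exists k].
    - by exists n => //=.
    - by exists k => //=; exact: ltnW.
  have dis : (S `&` A n) `&` tail n.+1 = set0.
    rewrite -subset0 => x [[_ Anx] [k /= nk [_ Akx]]].
    have nkE : n = k by apply: (tA n k I I); exists x.
    by rewrite nkE ltnn in nk.
  rewrite (addF (mSA n) (mtail n.+1) (@subIsetl _ _ _) (tailS _) dis).
  by rewrite -EFinB -!EFinD; congr EFin; ring.
have tail0 : mu (tail n) @[n --> \oo] --> 0.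
  have := @nonincreasing_cvg_mu _ _ _ mu tail.
  have -> : \bigcap_n tail n = set0.
    rewrite -subset0 => x tx; have [k _ [_ Akx]] := tx 0%N I.
    have [j /= kj [_ Ajx]] := tx k.+1 I.
    have jk : j = k by apply: (tA j k I I); exists x.
    by rewrite jk ltnn in kj.
  rewrite measure0; apply => //.
  - by rewrite (le_lt_trans _ Sfin)// le_measure ?inE.
  - move=> n k nk; apply/subsetPset => x [j /= kj h]; exists j => //=.
    exact: leq_trans kj.
rewrite (_ : (fun n => _) = (fun n => charge_on (\bigcup_n A n) - (F (tail n))%:E)); last first.
  by apply/funext => n; exact: sumE.
rewrite /charge_on -[X in _ --> X]sube0.
under eq_fun do rewrite -EFinB.
rewrite -EFinB; apply: cvg_EFin; first exact: nearW.
apply: cvgB; first exact: cvg_cst.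
apply/cvgrPdist_le => e e0; have [r r0 hr] := acF e0.
have r0' : 0 < r%:E by rewrite lte_fin.
have : \forall n \near \oo, mu (tail n) < r%:E.
  by apply: (tail0 [set y | y < r%:E]); exact: open_ereal_lt'.
by apply: filterS => n h; rewrite sub0r normrN hr.
Qed.

HB.instance Definition _ := isCharge.Build _ _ _ charge_on
  charge_on0 charge_on_finite charge_on_sigma_additive.

Lemma charge_density : exists g : T -> R, mu.-integrable S (EFin \o g) /\
  forall A, measurable A -> A `<=` S -> F A = (\int[mu]_(x in A) g x)%R.
Proof.
(* Here mu is arbitrary; its restriction to [S] is finite, as the Radon-Nikodym theorem is applied
   to a finite measure. *)
pose nu : {finite_measure set T -> \bar R} := mfrestr mS Sfin.
have nuE A : measurable A -> A `<=` S -> nu A = mu A.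
  by move=> mA AS; rewrite /nu/= /mfrestr /mrestr setIidl.
have integral_nu A (h : T -> \bar R) : A `<=` S ->
    \int[nu]_(x in A) h x = \int[mu]_(x in A) h x.
  by move=> AS; apply: eq_measure_integral => B mB BA; apply: nuE => // x /BA /AS.
have dom : charge_on `<< nu.
  apply/null_content_dominatesP => A mA nuA0; rewrite /charge_on.
  congr EFin; apply/eqP; rewrite -normr_le0; apply/ler_addgt0Pl => e e0.
  rewrite addr0; have [r r0 hr] := acF e0; apply: hr.
  - exact: measurableI.
  - exact: subIsetl.
  by move: nuA0; rewrite /nu/= /mfrestr /mrestr setIC => ->; rewrite lte_fin.
pose g := Radon_Nikodym (charge_on : {charge set T -> \bar R}) nu.
have gfin x : g x \is a fin_num by exact: Radon_Nikodym_fin_num.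
have ig : nu.-integrable setT g by exact: Radon_Nikodym_integrable.
have gE A : measurable A -> charge_on A = \int[nu]_(x in A) g x.
  by move=> mA; exact: Radon_Nikodym_integral.
exists (fine \o g); split.
  rewrite (_ : EFin \o _ = g); last by apply/funext => x /=; rewrite fineK.
  have /integrableP[mg] := integrableS measurableT mS (@subsetT _ _) ig.
  by rewrite integral_nu// => igS; apply/integrableP.
move=> A mA AS; have := gE A mA; rewrite /charge_on setIidr// integral_nu// => h.
rewrite /Rintegral -[LHS]/(fine (F A)%:E) h; congr fine.
by apply: eq_integral => x _; rewrite /= fineK.
Qed.

End charge_density.

(** * From indicators to bounded functions *)

Section functional_density.
Context d (T : measurableType d) (R : realType).
Variable mu : {measure set T -> \bar R}.
Variable (S : set T).

Definition bounded_on (c : R) (g : T -> R) :=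
  [/\ measurable_fun setT g, (forall x, (`|g x| <= c)%R) &
    (forall x, ~ S x -> g x = 0%R)].

Variable (lambda : (T -> R) -> R) (K : R).
Hypothesis mS : measurable S.
Hypothesis Sfin : mu S < +oo.
Hypothesis lambda_linear : forall (k c c' : R) g h, bounded_on c g -> bounded_on c' h ->
  lambda (fun x => k * g x + h x)%R = (k * lambda g + lambda h)%R.
Hypothesis lambda_bounded : forall (c : R) g, bounded_on c g -> (`|lambda g| <= K * c)%R.
Hypothesis lambda_ac : forall e : R, (0 < e)%R -> exists2 r : R, (0 < r)%R &
  forall A, measurable A -> A `<=` S -> mu A < r%:E -> (`|lambda \1_A| <= e)%R.

Lemma bounded_on_indic A : measurable A -> A `<=` S -> bounded_on 1 (\1_A).
Proof.
move=> mA AS; split; first exact: measurable_indic.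
  by move=> x; rewrite indicE; case: (x \in A); rewrite ?normr1// normr0.
by move=> x nSx; rewrite indicE memNset// => /AS.
Qed.

Lemma bounded_onD k c c' g h : bounded_on c g -> bounded_on c' h ->
  bounded_on (`|k| * c + c') (fun x => k * g x + h x)%R.
Proof.
move=> [mg gc g0] [mh hc h0]; split.
- by apply: measurable_funD => //; exact: measurable_funM.
- move=> x; rewrite (le_trans (ler_normD _ _))// lerD// normrM.
  by rewrite ler_wpM2l.
- by move=> x nSx; rewrite g0// h0// mulr0 addr0.
Qed.

Lemma integrableM_bounded c g (u : T -> R) : mu.-integrable S (EFin \o u) ->
  bounded_on c g -> mu.-integrable S (EFin \o (fun x => u x * g x)%R) /\
  (`|\int[mu]_(x in S) (u x * g x)| <= c * \int[mu]_(x in S) `|u x|)%R.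
Proof.
move=> iu [mg gc g0].
have mu_ : measurable_fun S u by apply/measurable_EFinP; exact: measurable_int iu.
have iau : mu.-integrable S (fun x => `|u x|%:E) by exact: integrable_norm iu.
have [] := @le_Rintegral_abs _ _ _ mu S (fun x => u x * g x)%R
   (fun x => c * `|u x|)%R mS.
- by apply: measurable_funM => //; exact: measurable_funTS.
- exact: integrableZE.
- by apply: aeW => x _; rewrite normrM mulrC ler_wpM2r.
by move=> ? ?; split => //; rewrite -RintegralZl.
Qed.

(** The density found on indicators works for simple functions by linearity; both sides are
    continuous for the sup norm, in which bounded functions are limits of simple ones. *)
Lemma functional_density : exists u : T -> R, mu.-integrable S (EFin \o u) /\
  forall c g, bounded_on c g -> lambda g = (\int[mu]_(x in S) (u x * g x))%R.
Proof.
have b0 : bounded_on 0 (fun=> 0%R) by split => // x; rewrite normr0.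
have lambda0 : lambda (fun=> 0%R) = 0%R.
  apply/eqP; rewrite -normr_le0; apply: (le_trans (lambda_bounded b0)).
  by rewrite mulr0.
have [A B mA mB AS BS AB|u [iu uE]] := @charge_density _ _ _ mu S
    (fun A => lambda \1_A) mS Sfin _ lambda_ac.
  rewrite -[RHS]mul1r mulrDr mul1r mul1r -[X in (X + _)%R]mul1r.
  rewrite -(lambda_linear _ (bounded_on_indic mA AS) (bounded_on_indic mB BS)).
  congr lambda; apply/funext => x; rewrite mul1r !indicE in_setU.
  case: (boolP (x \in A)) => [|_]; last by rewrite add0r.
  rewrite inE => Ax; rewrite memNset ?addr0// => Bx.
  by have : (A `&` B) x by []; rewrite AB.
have good_sum n (k : nat -> R) (A : nat -> set T) :
    (forall i, measurable (A i)) -> (forall i, A i `<=` S) ->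
    exists2 c, bounded_on c (fun x => \sum_(0 <= i < n) k i * \1_(A i) x)%R &
    lambda (fun x => \sum_(0 <= i < n) k i * \1_(A i) x)%R =
      (\int[mu]_(x in S) (u x * \sum_(0 <= i < n) k i * \1_(A i) x))%R.
  move=> mA AS; elim: n => [|n [c bc ih]].
    exists 0%R.
      by under [X in bounded_on _ X]eq_fun do rewrite big_geq//.
    under [X in lambda X]eq_fun do rewrite big_geq//.
    under eq_Rintegral do rewrite big_geq// mulr0.
    by rewrite lambda0 Rintegral_cst// mul0r.
  have bA := bounded_on_indic (mA n) (AS n).
  have rw : (fun x => \sum_(0 <= i < n.+1) k i * \1_(A i) x)%R =
      (fun x => k n * \1_(A n) x + \sum_(0 <= i < n) k i * \1_(A i) x)%R.
    by apply/funext => x; rewrite big_nat_recr//= addrC.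
  exists (`|k n| * 1 + c)%R; first by rewrite rw; exact: bounded_onD.
  rewrite rw (lambda_linear _ bA bc) ih uE//.
  have i1 : mu.-integrable S (fun x => (k n * (u x * \1_(A n) x))%:E).
    by apply: integrableZE => //; have [] := integrableM_bounded iu bA.
  have i2 := (integrableM_bounded iu bc).1.
  transitivity (\int[mu]_(x in S) (k n * (u x * \1_(A n) x) +
      u x * \sum_(0 <= i < n) k i * \1_(A i) x))%R; last first.
    apply: eq_Rintegral => x _; rewrite (congr1 (fun f => f x) rw).
    by rewrite mulrDr mulrCA.
  rewrite RintegralD// RintegralZl//; last by have [] := integrableM_bounded iu bA.
  congr (_ * _ + _)%R.
  by rewrite Rintegral_mul_indic.
exists u; split => // c g bg; have [mg gc g0] := bg.
pose C := (K + \int[mu]_(x in S) `|u x|)%R.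
suff small (N : nat) : (`|lambda g - \int[mu]_(x in S) (u x * g x)| <=
    C * (2 * c / N.+1%:R))%R.
  apply/eqP; rewrite -subr_eq0 -normr_le0.
  apply/ler_addgt0Pl => e e0; rewrite addr0.
  apply: (le_trans (small (Num.truncn (`|C * (2 * c)| / e)%R))).
  rewrite mulrA ler_pdivrMr//; apply: (le_trans (ler_norm _)).
  have := truncnS_gt (`|C * (2 * c)| / e)%R.
  by rewrite ltr_pdivrMr// [(e * _)%R]mulrC => /ltW.
(* A bound c <= 0 forces g = 0, and c = 0 since [T] has a point; beyond this case one may divide by
   the mesh. *)
have [c0|c0] := leP c 0%R.
  have gz : g = (fun=> 0%R).
    apply/funext => x; apply/eqP; rewrite -normr_le0; exact: le_trans (gc x) c0.
  have c00 : (0 <= c)%R.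
    have [x|e] := pselect (exists x : T, True).
      by case: x => x _; exact: le_trans (gc x).
    exfalso; apply: e; exists point; exact: I.
  rewrite gz lambda0 (_ : c = 0)%R ?mulr0 ?mul0r ?mulr0; last by apply/le_anti; rewrite c0 c00.
  under eq_Rintegral do rewrite mulr0.
  by rewrite Rintegral_cst// mul0r subrr normr0.
pose dl := (2 * c / N.+1%:R)%R.
have dl0 : (0 < dl)%R by rewrite divr_gt0// mulr_gt0.
(* Layer-cake approximation: starting from -c, each superlevel set adds one mesh [dl], so h rounds g
   down to the grid -c + [dl] * nat on [S]. *)
pose A i := if i is j.+1 then S `&` [set x | (j.+1%:R * dl <= g x + c)%R] else S.
pose k i := if i is _.+1 then dl else (- c)%R.
pose h x := (\sum_(0 <= i < N.+2) k i * \1_(A i) x)%R.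
have mA i : measurable (A i).
  case: i => [|i]//=; apply: measurableI => //.
  rewrite -[X in measurable X]setTI; apply: measurable_fun_le => //.
  exact: measurable_funD.
have AS i : A i `<=` S by case: i => [|i]//=; exact: subIsetl.
have [ch bh lh] := good_sum N.+2 k A mA AS.
rewrite -/h in bh lh.
have close : bounded_on dl (fun x => -1 * h x + g x)%R.
  have [mh _ h0] := bh; split.
  - by apply: measurable_funD => //; exact: measurable_funM.
  - move=> x; have [Sx|nSx] := pselect (S x); last by rewrite h0// g0// mulr0 addr0 normr0 ltW.
    pose r := Num.truncn ((g x + c) / dl)%R.
    have gc0 : (0 <= g x + c)%R by have := gc x; rewrite ler_norml; lra.
    have /andP[r1 r2] : (r%:R <= (g x + c) / dl < r.+1%:R)%R.
      by apply: Num.Theory.truncn_itv; rewrite divr_ge0// ltW.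
    have rN : (r <= N.+1)%N.
      rewrite -(@ler_nat R) (le_trans r1)// ler_pdivrMr// /dl mulrC divfK//.
      by have := gc x; rewrite ler_norml; lra.
    have hx : h x = (- c + dl * r%:R)%R.
      rewrite /h big_nat_recl//= indicE mem_set// mulr1; congr (_ + _)%R.
      rewrite -mulr_sumr; congr (_ * _)%R.
      transitivity (\sum_(0 <= i < N.+1) ((i < r)%N)%:R : R)%R.
        apply: eq_bigr => i _; rewrite indicE; congr (_%:R)%R; congr nat_of_bool.
        apply/idP/idP; rewrite inE.
          move=> [_ /=]; rewrite -ler_pdivlMr// => h1.
          by rewrite -ltnS -(@ltr_nat R) (le_lt_trans h1).
        move=> ir; split => //=; rewrite -ler_pdivlMr// (le_trans _ r1)//.
        by rewrite ler_nat.
      rewrite -natr_sum; congr (_%:R)%R.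
      have minE m : (\sum_(0 <= i < m) (i < r) = minn r m)%N.
        elim: m => [|m ihm]; first by rewrite big_geq// minn0.
        by rewrite big_nat_recr//= ihm; case: (ltnP m r) => /= mr; lia.
      by rewrite minE; exact/minn_idPl.
    rewrite hx ler_norml; move: r1 r2.
    rewrite ler_pdivlMr// ltr_pdivrMr// -natr1 mulrDl mul1r => r1 r2.
    by apply/andP; split; lra.
  - by move=> x nSx; rewrite h0// g0// mulr0 addr0.
have l1 := lambda_linear (-1) bh bg.
have i2 := (integrableM_bounded iu close).2.
(* The representation is exact on the simple function h, so the defect of g is that of g - h, whose
   sup norm is at most [dl]. *)
have -> : (lambda g - \int[mu]_(x in S) (u x * g x) =
   lambda (fun x => -1 * h x + g x) - \int[mu]_(x in S) (u x * (-1 * h x + g x)))%R.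
  rewrite l1 lh -/h.
  have ih := (integrableM_bounded iu bh).1; have ig := (integrableM_bounded iu bg).1.
  have -> : (\int[mu]_(x in S) (u x * (-1 * h x + g x)) =
      -1 * \int[mu]_(x in S) (u x * h x) + \int[mu]_(x in S) (u x * g x))%R.
    rewrite -RintegralZl// -RintegralD//; last exact: integrableZE.
    by apply: eq_Rintegral => x _; ring.
  by rewrite /h; ring.
rewrite -/dl (le_trans (ler_normB _ _))// /C mulrDl lerD//.
  exact: lambda_bounded.
by rewrite mulrC.
Qed.

End functional_density.

(** * Gluing densities along an increasing sequence of sets *)

Section glue.
Context d (T : measurableType d) (R : realType).

Lemma ae_eq_Rintegral (mu : {measure set T -> \bar R}) (D : set T) (f g : T -> R) :
  measurable D -> measurable_fun D f -> mu.-integrable D (EFin \o g) ->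
  {ae mu, forall x, D x -> f x = g x} ->
  mu.-integrable D (EFin \o f) /\
  (\int[mu]_(x in D) f x = \int[mu]_(x in D) g x)%R.
Proof.
move=> mD mf ig fg.
have mg : measurable_fun D g by apply/measurable_EFinP; exact: measurable_int ig.
have [|intf _] := @le_Rintegral_abs _ _ _ mu D f (fun x => `|g x|)%R mD mf (integrable_norm ig).
  by apply: filterS fg => x h Dx; rewrite h.
split => //; congr fine; apply: ae_eq_integral => //.
- exact/measurable_EFinP.
- exact/measurable_EFinP.
by apply: filterS fg => x h Dx; rewrite h.
Qed.

Lemma Rintegral_indic (mu : {measure set T -> \bar R}) (A : set T) :
  measurable A -> (\int[mu]_x \1_A x = fine (mu A))%R.
Proof. by move=> mA; rewrite /Rintegral integral_indic// setIT. Qed.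

Lemma measure_lt_fineK (mu : {measure set T -> \bar R}) (A : set T) (r : R) :
  mu A < r%:E -> mu A = (fine (mu A))%:E.
Proof. by move=> Ar; rewrite fineK// ge0_fin_numE// (lt_trans Ar)// ltry. Qed.

Variable mu : {measure set T -> \bar R}.
Variables (S : (set T)^nat) (u : nat -> T -> R).
Hypothesis mS : forall n, measurable (S n).
Hypothesis ndS : forall n k, (n <= k)%N -> S n `<=` S k.
Hypothesis iu : forall n, mu.-integrable (S n) (EFin \o u n).
Hypothesis compat : forall n k E, (n <= k)%N -> measurable E -> E `<=` S n ->
  (\int[mu]_(x in E) u n x = \int[mu]_(x in E) u k x)%R.

(** At each point [v] uses the first set of the sequence that contains it, hence is measurable on
    each of countably many disjoint pieces. Equal integrals over all measurable subsets make the
    [u n] agree almost everywhere. *)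
Lemma glue_ae : exists v : T -> R, measurable_fun (\bigcup_n S n) v /\
  forall n, {ae mu, forall x, S n x -> v x = u n x}.
Proof.
pose ind x n := `[< S n x >].
pose first x : nat := if pselect (exists n, ind x n) is left ex then ex_minn ex else 0%N.
have first_in n x : S n x -> S (first x) x /\ (first x <= n)%N.
  move=> Snx; rewrite /first; case: pselect => [ex|]; last first.
    by move=> []; exists n; exact/asboolP.
  by case: ex_minnP => k /asboolP Skx mink; split => //; apply: mink; exact/asboolP.
exists (fun x => u (first x) x); split.
  rewrite seqDU_bigcup_eq; apply/measurable_fun_bigcup => k.
    exact: seqDU_measurable.
  apply: (@eq_measurable_fun _ _ _ _ _ (u k)).
    move=> x; rewrite inE => -[Skx nx]; congr u; apply/eqP.
    have [Sf fk] := first_in _ _ Skx; rewrite eqn_leq fk andbT leqNgt.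
    apply/negP => fk'; apply: nx.
    by rewrite -bigcup_mkord; exists (first x).
  have mk : measurable_fun (S k) (u k) by apply/measurable_EFinP; exact: measurable_int (iu k).
  by apply: measurable_funS mk => // x [].
have aek n k : (k <= n)%N -> {ae mu, forall x, S k x -> u k x = u n x}.
  move=> kn.
  have iun : mu.-integrable (S k) (EFin \o u n).
    by apply: (integrableS _ _ (ndS kn) (iu n)).
  have := @integral_ae_eq _ _ _ mu (S k) (mS k) (EFin \o u n) (EFin \o u k)
    (iu k) (measurable_int _ iun).
  have step E : E `<=` S k -> measurable E ->
      \int[mu]_(x in E) (EFin \o u k) x = \int[mu]_(x in E) (EFin \o u n) x.
    move=> ES mE; have := compat kn mE ES; rewrite /Rintegral => h.
    rewrite -[LHS]fineK; last first.
      by apply: integrable_fin_num => //; exact: integrableS (iu k).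
    rewrite -[RHS]fineK ?h//.
    by apply: integrable_fin_num => //; exact: integrableS iun.
  by move=> /(_ step); apply: filterS => x h /h [].
move=> n.
have h2 : {ae mu, forall x, forall k, (k <= n)%N -> S k x -> u k x = u n x}.
  apply: ae_foralln => k; have [kn|nk] := leqP k n.
    by apply: filterS (aek _ _ kn) => x h _.
  by apply: aeW.
apply: filterS h2 => x h Snx; have [Sf fn] := first_in _ _ Snx.
exact: h.
Qed.

End glue.

(** * Correcting the mean on a fixed set *)

Section mean_correction.
Context d (T : measurableType d) (R : realType).
Variable mu : {measure set T -> \bar R}.
Variable B : set T.
Hypothesis mB : measurable B.
Hypothesis B0 : (0 < fine (mu B))%R.

(** Functionals on h^1 see only functions of mean zero. Correcting on one fixed [B] rather than on
    each square makes the densities on different squares compatible; as the indicator of [B] is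
    corrected to 0, the density obtained has integral 0 over [B]. *)
Definition mean_correction (g : T -> R) (x : T) : R :=
  (g x - (\int[mu]_y g y) / fine (mu B) * \1_B x)%R.

Lemma bounded_on_integrable S D c (g : T -> R) : measurable S -> measurable D ->
  mu S < +oo -> bounded_on S c g -> mu.-integrable D (EFin \o g).
Proof.
by move=> mS mD Sfin [mg gc g0]; exact: integrable_bounded_supp gc g0.
Qed.

Lemma mean_correction_linear S S' c c' (k : R) g h : measurable S -> measurable S' ->
  mu S < +oo -> mu S' < +oo -> bounded_on S c g -> bounded_on S' c' h ->
  forall x, mean_correction (fun y => k * g y + h y)%R x =
    (k * mean_correction g x + mean_correction h x)%R.
Proof.
move=> mS mS' Sfin Sfin' bg bh x; rewrite /mean_correction.
have ig := bounded_on_integrable mS measurableT Sfin bg.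
have ih := bounded_on_integrable mS' measurableT Sfin' bh.
rewrite RintegralD//; last exact: integrableZE.
by rewrite RintegralZl//; ring.
Qed.

Lemma bounded_on_ge0 (t : T) S c (g : T -> R) : bounded_on S c g -> (0 <= c)%R.
Proof. by move=> [_ gc _]; exact: le_trans (gc t). Qed.

Lemma Rintegral_bounded_on S c (g : T -> R) : measurable S -> mu S < +oo ->
  bounded_on S c g -> (`|\int[mu]_y g y| <= c * fine (mu S))%R.
Proof.
move=> mS Sfin bg; have [mg gc g0] := bg.
rewrite (@Rintegral_supp _ _ _ mu S)//.
rewrite -Rintegral_cst//.
have ic : mu.-integrable S (EFin \o (fun=> c)).
  apply: measurable_bounded_integrable => //; exact: bounded_cst.
have mSg : measurable_fun S g by exact: measurable_funTS.
have ae : {ae mu, forall x, S x -> (`|g x| <= c)%R} by apply: aeW => x _.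
by have [] := le_Rintegral_abs mS mSg ic ae.
Qed.

Lemma mean_correction_block S c (g : T -> R) : measurable S -> mu S < +oo ->
  B `<=` S -> bounded_on S c g ->
  block mu (c * (1 + fine (mu S) / fine (mu B))) S (mean_correction g).
Proof.
move=> mS Sfin BS bg; have [mg gc g0] := bg.
have c0 : (0 <= c)%R := bounded_on_ge0 point bg.
have Ig := Rintegral_bounded_on mS Sfin bg.
have mI : measurable_fun setT (\1_B : T -> R) by exact: measurable_indic.
split.
- by apply: measurable_funB => //; exact: measurable_funM.
- move=> x; rewrite mulrDr mulr1 (le_trans (ler_normB _ _))// lerD// normrM.
  rewrite normrM -[leRHS]mulr1 ler_pM//; last first.
    by rewrite indicE; case: (x \in B); rewrite ?normr1// normr0.
  rewrite (gtr0_norm (_ : 0 < (fine (mu B))^-1)%R) ?invr_gt0// mulrA.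
  by rewrite ler_wpM2r// invr_ge0 ltW.
- move=> x nSx; rewrite /mean_correction g0// indicE memNset ?mulr0 ?subr0//.
  by move/BS.
- have iB : mu.-integrable S (EFin \o (\1_B : T -> R)).
    apply: (@bounded_on_integrable S S 1%R) => //.
    exact: bounded_on_indic.
  have ig : mu.-integrable S (EFin \o g) by exact: bounded_on_integrable bg.
  rewrite /mean_correction RintegralB//; last exact: integrableZE.
  rewrite RintegralZl// (_ : (\int[mu]_(x in S) \1_B x = fine (mu B))%R); last first.
    by rewrite /Rintegral integral_indic// setIidl.
  rewrite divfK ?gt_eqF//; apply/eqP; rewrite subr_eq0; apply/eqP.
  by rewrite [RHS](@Rintegral_supp _ _ _ mu S).
Qed.

Lemma mean_correction_bound S : measurable S -> mu S < +oo -> (0 < fine (mu S))%R ->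
  B `<=` S -> exists k s : R, [/\ (0 < k)%R, (0 < s)%R, mu S = s%:E &
    forall c g, bounded_on S c g -> block mu (c * k) S (mean_correction g)].
Proof.
move=> mS Sfin S0 BS; exists (1 + fine (mu S) / fine (mu B))%R, (fine (mu S)); split.
- by rewrite addrC ltr_wpDl// divr_ge0// ltW.
- by [].
- by rewrite fineK// ge0_fin_numE.
- by move=> c g; exact: mean_correction_block.
Qed.

End mean_correction.

(** * Linear functionals on h^1: null functions and finite sums *)

Section functionals.
Context {R : realType} (lam : R).
Hypothesis lam_gt0 : (0 < lam)%R.
Local Notation mu := (mulam lam).
Local Notation Q := (@quadrant R).
Implicit Types (f a b : R * R -> R[i]) (S D : set (R * R)) (g h u v w : R * R -> R).

Let mQ : measurable Q. Proof. exact: measurable_quadrant. Qed.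

Lemma zero_decomposition f : cmeasurable Q f -> {ae mu, forall x, Q x -> f x = 0%R} ->
  h1 lam f /\ h1_norm lam f <= 0.
Proof.
move=> [mR mI] f0.
have sum0 n : (\sum_(0 <= i < n) 0 * 0 = 0 :> R[i])%R by rewrite big1// => i _; rewrite mul0r.
have dec : atomic_decomposition lam f (fun=> 0%R) (fun=> fun=> 0%R).
  split.
  - by move=> _; exact: zero_atom.
  - by rewrite eseries0 ?ltry// => i _ _; rewrite [normc _](normc0 R).
  apply: cvg_near_cst; apply: nearW => n.
  under eq_integral do rewrite sum0// subr0.
  transitivity (\int[mu]_(x in Q) (cst 0 x : \bar R)); last exact: integral0.
  apply: ae_eq_integral => //.
  - by apply/measurable_EFinP; exact: measurable_normc.
  - by apply: filterS f0 => x h Qx; rewrite h// [normc _](normc0 R).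
have i0 : mu.-integrable Q (EFin \o (fun=> 0%R : R)) by exact: integrable0.
split; last first.
  apply: (le_trans (h1_norm_le dec)).
  by rewrite eseries0// => i _ _; rewrite [normc _](normc0 R).
split; last by exists (fun=> 0%R), (fun=> fun=> 0%R).
split.
- have [//|+ _] := ae_eq_Rintegral mQ mR i0 _; last exact.
  by apply: filterS f0 => x h Qx; rewrite h.
- have [//|+ _] := ae_eq_Rintegral mQ mI i0 _; last exact.
  by apply: filterS f0 => x h Qx; rewrite h.
Qed.

Lemma cintegrable_cmeasurable D f : cintegrable lam D f -> cmeasurable D f.
Proof.
move=> [iR iI]; split; apply/measurable_EFinP.
  exact: measurable_int iR.
exact: measurable_int iI.
Qed.

Lemma cmeasurableD D f (g : R * R -> R[i]) : cmeasurable D f -> cmeasurable D g ->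
  cmeasurable D (fun x => f x + g x)%R.
Proof.
move=> [fR fI] [gR gI]; split.
  by under eq_fun do rewrite ReD; exact: measurable_funD.
by under eq_fun do rewrite ImD; exact: measurable_funD.
Qed.

Lemma h1_ae f (g : R * R -> R[i]) : cmeasurable Q g -> h1 lam f ->
  {ae mu, forall x, Q x -> f x = g x} -> h1 lam g.
Proof.
move=> mg [[iR iI] [alpha [atoms [aa sa lima]]]] fg; split.
  have [gR gI] := mg; split.
  - have [//|+ _] := ae_eq_Rintegral mQ gR iR _; last exact.
    by apply: filterS fg => x h Qx; rewrite h.
  - have [//|+ _] := ae_eq_Rintegral mQ gI iI _; last exact.
    by apply: filterS fg => x h Qx; rewrite h.
exists alpha, atoms; split => //.
have ms n : cmeasurable Q (fun x => - \sum_(0 <= i < n) alpha i * atoms i x)%R.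
  under [X in cmeasurable _ X]eq_fun do rewrite -mulN1r.
  apply: cmeasurableZ => //; apply: (@cintegrable_cmeasurable Q).
  by apply: (cintegrable_sum n mQ) => i; apply: cintegrableZ => //; exact: atom_integrable.
rewrite (_ : (fun n => _) = (fun n => \int[mu]_(x in Q)
   (normc (f x - \sum_(0 <= i < n) alpha i * atoms i x)%R)%:E))//.
apply/funext => n; apply: ae_eq_integral => //.
- by apply/measurable_EFinP; apply: measurable_normc; apply: cmeasurableD.
- apply/measurable_EFinP; apply: measurable_normc; apply: cmeasurableD => //.
  exact: cintegrable_cmeasurable.
by apply: filterS fg => x h Qx; rewrite h.
Qed.

(** The difference vanishes almost everywhere, so the decomposition into zero atoms shows that its
    norm is 0. *)
Lemma h1_dual_ae L f (g : R * R -> R[i]) : h1_dual lam L -> cmeasurable Q g -> h1 lam f ->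
  {ae mu, forall x, Q x -> f x = g x} -> L g = L f.
Proof.
move=> dL mg hf fg; have hg := h1_ae mg hf fg.
have [M M0 LM] := h1_dual_bound dL.
have [linL _] := dL.
have mf : cmeasurable Q f by apply: cintegrable_cmeasurable; case: hf.
have md : cmeasurable Q (fun x => -1 * f x + g x)%R.
  by apply: cmeasurableD => //; exact: cmeasurableZ.
have d0 : {ae mu, forall x, Q x -> (-1 * f x + g x)%R = 0%R}.
  by apply: filterS fg => x h Qx; rewrite h// mulN1r addNr.
have [hd nd] := zero_decomposition md d0.
have := LM _ hd; rewrite linL// mulN1r => /le_trans; move=> /(_ 0) le0.
have : (normc (- L f + L g))%:E <= 0.
  by apply: le0; rewrite -(mule0 M%:E) lee_pmul2l// lte_fin.
rewrite lee_fin => z; apply/eqP; rewrite -subr_eq0 addrC; apply/eqP.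
by apply: (@eq0_normc R); apply/le_anti; rewrite z normc_ge0.
Qed.

Lemma h1_zero : h1 lam (fun=> 0%R).
Proof.
have [//|+ _] := @zero_decomposition (fun=> 0%R) _ (aeW _ (fun _ _ => erefl)); last exact.
Qed.

Definition h1_linear (L : (R * R -> R[i]) -> R[i]) :=
  forall (k : R[i]) f (g : R * R -> R[i]), h1 lam f -> h1 lam g ->
    L (fun x => k * f x + g x)%R = (k * L f + L g)%R.

Lemma h1_linear0 L : h1_linear L -> L (fun=> 0%R) = 0%R.
Proof.
move=> linL; have := linL (-1)%R _ _ h1_zero h1_zero.
under [X in L X]eq_fun do rewrite mulr0 addr0.
by rewrite mulN1r addNr.
Qed.

Lemma h1_linear_sum L n (alpha : 'I_n -> R[i]) (atoms : 'I_n -> R * R -> R[i]) :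
  h1_linear L -> (forall i, atom lam (atoms i)) ->
  L (fun x => \sum_(i < n) alpha i * atoms i x)%R = (\sum_(i < n) alpha i * L (atoms i))%R.
Proof.
move=> linL; elim: n alpha atoms => [|n ih] alpha atoms aa.
  rewrite big_ord0; under [X in L X]eq_fun do rewrite big_ord0.
  exact: h1_linear0.
rewrite big_ord_recr/=; under [X in L X]eq_fun do rewrite big_ord_recr/= addrC.
rewrite linL; last 2 first.
- by have [] := atom_h1 lam_gt0 (aa ord_max).
- by have [] := @span_h1 _ _ lam_gt0 n (fun i => alpha (widen_ord (leqnSn n) i))
    (fun i => atoms (widen_ord (leqnSn n) i)) _ (fun i => aa _) (fun x => erefl).
by rewrite ih 1?addrC.
Qed.

Lemma represents_atoms b L : h1_linear L ->
  (forall a, atom lam a -> cintegrable lam Q (fun x => b x * a x)%R /\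
     L a = cintegral lam Q (fun x => b x * a x)%R) ->
  represents lam b L.
Proof.
move=> linL Lb f [n [alpha [atoms [aa fE]]]].
have -> : f = (fun x => \sum_(i < n) alpha i * atoms i x)%R by exact/funext.
rewrite (h1_linear_sum _ linL aa) {f fE}.
have bsum x : (b x * \sum_(i < n) alpha i * atoms i x =
    \sum_(i < n) alpha i * (b x * atoms i x))%R.
  by rewrite mulr_sumr; apply: eq_bigr => i _; rewrite mulrCA.
under [X in cintegrable _ _ X]eq_fun do rewrite bsum.
under [X in cintegral _ _ X]eq_fun do rewrite bsum.
elim: n alpha atoms aa {bsum} => [|n ih] alpha atoms aa.
  under [X in cintegrable _ _ X]eq_fun do rewrite big_ord0.
  under [X in cintegral _ _ X]eq_fun do rewrite big_ord0.
  rewrite big_ord0; split; first exact: cintegrable0.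
  by apply: eq_complexP => /=; rewrite Rintegral_cst// mul0r.
have [ih1 ih2] := ih (fun i => alpha (widen_ord (leqnSn n) i))
  (fun i => atoms (widen_ord (leqnSn n) i)) (fun i => aa _).
have [ia La] := Lb _ (aa ord_max).
under [X in cintegrable _ _ X]eq_fun do rewrite big_ord_recr/=.
under [X in cintegral _ _ X]eq_fun do rewrite big_ord_recr/=.
split; first by apply: cintegrableD => //; exact: cintegrableZ.
rewrite cintegralD//; last exact: cintegrableZ.
by rewrite cintegralZ// big_ord_recr/= ih2 La.
Qed.

End functionals.

(** * The density of a functional on the whole quadrant *)

Section dual_density.
Context {R : realType} (lam : R).
Hypothesis lam_gt0 : (0 < lam)%R.
Local Notation mu := (mulam lam).
Local Notation Q := (@quadrant R).
Implicit Types (f a b : R * R -> R[i]) (S D : set (R * R)) (g h u v w : R * R -> R).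

Let mQ : measurable Q. Proof. exact: measurable_quadrant. Qed.
Local Notation base := (square 0 : set (R * R)).
Local Notation corr := (mean_correction mu base).

Lemma block_weaken (c c' : R) S w : (c <= c')%R -> block mu c S w -> block mu c' S w.
Proof. by move=> cc' [mw wc w0 iw]; split => // x; exact: le_trans cc'. Qed.

Lemma corr_block n : exists k s : R,
  [/\ (0 < k)%R, (0 < s)%R, mu (square n) = s%:E &
    forall c g, bounded_on (square n) c g -> block mu (c * k)%R (square n) (corr g)].
Proof.
have rS := square_rectangle lam_gt0 n.
exact: (mean_correction_bound (measurable_square lam_gt0 0)
  (rectangle_fine_gt0 lam_gt0 (square_rectangle lam_gt0 0))
  (measurable_square lam_gt0 n) (rectangle_lty lam_gt0 rS)
  (rectangle_fine_gt0 lam_gt0 rS) (square_mono (leq0n n))).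
Qed.

Lemma corr_h1 n (c : R) g : bounded_on (square n) c g -> h1 lam (fun x => (corr g x)%:C%C).
Proof.
move=> bg; have rS := square_rectangle lam_gt0 n.
have [k [s [k0 _ _ bk]]] := corr_block n.
have bl' : block mu (`|c * k| + 1)%R (square n) (corr g).
  by apply: block_weaken (bk _ _ bg); rewrite (le_trans (ler_norm _))// lerDl.
have ck0 : (0 < `|c * k| + 1)%R by rewrite ltr_wpDl.
by have [] := block_h1 lam_gt0 rS ck0 bl'.
Qed.

Section part.
Variables (L : (R * R -> R[i]) -> R[i]) (rho : R[i] -> R).
Hypothesis dL : h1_dual lam L.
Hypothesis rho_linear : forall (k : R) (z z' : R[i]),
  rho (k%:C%C * z + z')%R = (k * rho z + rho z')%R.
Hypothesis rho_le : forall z, (`|rho z| <= normc z)%R.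

Let Lambda g : R[i] := L (fun x => (corr g x)%:C%C).

Let Lambda_linear n (k c c' : R) g h : bounded_on (square n) c g ->
  bounded_on (square n) c' h ->
  Lambda (fun x => k * g x + h x)%R = (k%:C%C * Lambda g + Lambda h)%R.
Proof.
move=> bg bh; rewrite /Lambda; have [linL _] := dL.
rewrite -linL; [|exact: corr_h1 bg|exact: corr_h1 bh].
congr L; apply/funext => x; rewrite -rmorphM -rmorphD; congr (_%:C)%C.
have mS := measurable_square lam_gt0 n.
have Sfin := rectangle_lty lam_gt0 (square_rectangle lam_gt0 n).
exact: (mean_correction_linear base k mS mS Sfin Sfin bg bh).
Qed.

Let Lambda_bounded n : exists K : R, forall c g, bounded_on (square n) c g ->
  (normc (Lambda g) <= K * c)%R.
Proof.
have [M M0 LM] := h1_dual_bound dL.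
have rS := square_rectangle lam_gt0 n.
have [k [s [k0 s0 sE bk]]] := corr_block n.
exists (M * (k * s))%R => c g bg.
have c0 : (0 <= c)%R := bounded_on_ge0 point bg.
(* The bound c may be 0, whereas normalising a block to an atom needs a positive height; the slack e
   tends to 0 afterwards. *)
have pos e : (0 < e)%R -> (normc (Lambda g) <= M * (((c + e) * k) * s))%R.
  move=> e0; have ce0 : (0 < c + e)%R by rewrite ltr_wpDl.
  have bge : bounded_on (square n) (c + e)%R g.
    by have [mg gc g0] := bg; split => // x; rewrite (le_trans (gc x))// lerDl ltW.
  have [hb] := block_h1 lam_gt0 rS (mulr_gt0 ce0 k0) (bk _ _ bge).
  rewrite sE/= => nb.
  rewrite -lee_fin; apply: (le_trans (LM _ hb)).
  by rewrite EFinM lee_pmul2l// lte_fin.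
have C0 : (0 < M * (k * s))%R by rewrite !mulr_gt0.
apply/ler_addgt0Pl => e e0.
apply: (le_trans (pos (e / (M * (k * s)))%R (divr_gt0 e0 C0))).
rewrite le_eqVlt; apply/orP; left; apply/eqP; field.
by rewrite !gt_eqF.
Qed.

(** [indicator_small] corrects the mean on square [n], [Lambda] on square 0. The two differ by
    mu(A)/mu(square n) times the fixed number Lambda(1_(square n)), which is small with mu(A). *)
Let Lambda_small n (e : R) : (0 < e)%R -> exists2 r : R, (0 < r)%R &
  forall A, measurable A -> A `<=` square n -> mu A < r%:E ->
  (normc (Lambda \1_A) <= e)%R.
Proof.
move=> e0; have rS := square_rectangle lam_gt0 n.
have mS := measurable_square lam_gt0 n.
have Sfin := rectangle_lty lam_gt0 rS.
have [_ [s [_ s0 sE _]]] := corr_block n.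
have e20 : (0 < e / 2)%R by rewrite divr_gt0.
have [d d0 hd] := indicator_small lam_gt0 dL rS e20.
have [l l0 lE] : exists2 l : R, (0 < l)%R & (normc (Lambda \1_(square n)) <= l)%R.
  exists (normc (Lambda \1_(square n)) + 1)%R; last by rewrite lerDl.
  by rewrite ltr_wpDl// normc_ge0.
(* The second bound keeps (mu(A) / s) l below e/2, where [l] is a strictly positive bound for the
   fixed number. *)
pose r := Num.min d (e / 2 * s / l)%R.
exists r; first by rewrite lt_min d0 divr_gt0// mulr_gt0.
move=> A mA AS muA.
have bA := bounded_on_indic R mA AS.
have bS := bounded_on_indic R mS (@subset_refl _ (square n)).
have hA := hd A mA AS.
have iA := bounded_on_integrable mS measurableT Sfin bA.
have iS := bounded_on_integrable mS measurableT Sfin bS.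
have IA := Rintegral_indic mu mA.
have IS := Rintegral_indic mu mS.
have Afin := measure_lt_fineK muA.
have a0 : (0 <= fine (mu A))%R by exact: fine_ge0.
rewrite sE/= in hA IS.
move: Afin hA IA a0 muA {hd Sfin}; move: (fine (mu A)) => a ->.
rewrite !lte_fin lt_min => hA IA a0 /andP[ad als].
pose k := (a / s)%R.
(* With k = a/s this function already has mean zero, so the correction on square 0 leaves it
   unchanged. *)
have kE : Lambda (fun x => - k * \1_(square n) x + \1_A x)%R =
    L (fun x => (\1_A x - a / s * \1_(square n) x)%:C%C).
  rewrite /Lambda; congr L; apply/funext => x; congr (_%:C)%C.
  rewrite /mean_correction.
  have -> : (\int[mu]_y (- k * \1_(square n) y + \1_A y) = 0)%R.
    rewrite RintegralD; [|exact: measurableT|exact: integrableZE|exact: iA].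
    rewrite RintegralZl; [|exact: measurableT|exact: iS].
    by rewrite IA IS mulNr /k divfK ?addNr// gt_eqF.
  by rewrite mul0r mul0r subr0 mulNr addrC.
have := Lambda_linear (- k) bS bA; rewrite kE => h.
have -> : Lambda \1_A = (L (fun x => (\1_A x - a / s * \1_(square n) x)%:C%C)
   + k%:C%C * Lambda \1_(square n))%R.
  by rewrite h rmorphN/= mulNr addrAC addNr add0r.
have k0 : (0 <= k)%R by rewrite divr_ge0// ltW.
rewrite (le_trans (normc_leD _ _))// [leRHS](splitr e) lerD//.
  exact: hA.
rewrite normcM normc_real (ger0_norm k0).
apply: (@le_trans _ _ (k * l)%R); first by rewrite ler_wpM2l.
by rewrite -ler_pdivlMr// /k ler_pdivrMr// mulrAC ltW.
Qed.

(** [rho] stands for the real or the imaginary part. The densities on two squares have equal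
    integrals over every measurable subset of the smaller one, because [Lambda] does not depend on
    the square. *)
Lemma part_density : exists u,
  [/\ measurable_fun Q u, (forall n, mu.-integrable (square n) (EFin \o u)) &
    forall n c g, bounded_on (square n) c g ->
      rho (L (fun x => (corr g x)%:C%C)) = (\int[mu]_(x in square n) (u x * g x))%R].
Proof.
have mS n := measurable_square lam_gt0 n.
have Sfin n := rectangle_lty lam_gt0 (square_rectangle lam_gt0 n).
have /choice[u hu] n : exists u, mu.-integrable (square n) (EFin \o u) /\
    forall c g, bounded_on (square n) c g ->
      rho (Lambda g) = (\int[mu]_(x in square n) (u x * g x))%R.
  have [K hK] := Lambda_bounded n.
  apply: (@functional_density _ _ _ mu (square n)
    (fun g => rho (Lambda g)) K (mS n) (Sfin n)).
  - move=> k c c' g h bg bh; rewrite -rho_linear; congr rho.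
    exact: Lambda_linear bg bh.
  - by move=> c g bg; exact: le_trans (rho_le _) (hK _ _ bg).
  - move=> e e0; have [r r0 hr] := Lambda_small n e0.
    by exists r => // A mA AS muA; exact: le_trans (rho_le _) (hr A mA AS muA).
have indE n A : measurable A -> A `<=` square n ->
    (rho (Lambda \1_A) = \int[mu]_(x in A) u n x)%R.
  move=> mA AS; have [_ h] := hu n; rewrite (h _ _ (bounded_on_indic R mA AS)).
  exact: Rintegral_mul_indic.
have compat n k E : (n <= k)%N -> measurable E -> E `<=` square n ->
    (\int[mu]_(x in E) u n x = \int[mu]_(x in E) u k x)%R.
  move=> nk mE ES; rewrite -indE// -indE//.
  exact: subset_trans (square_mono nk).
have [v [mv vu]] := glue_ae mS (@square_mono R) (fun n => (hu n).1) compat.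
have mv' n : measurable_fun (square n) v.
  apply: (measurable_funS _ _ mv); first exact: bigcupT_measurable.
  by move=> x Sx; exists n.
have iv n : mu.-integrable (square n) (EFin \o v).
  by have [] := ae_eq_Rintegral (mS n) (mv' n) (hu n).1 (vu n).
exists v; split => //; first by rewrite (quadrant_square lam_gt0).
move=> n c g bg; have [_ /(_ _ _ bg) ->] := hu n.
have mvg : measurable_fun (square n) (fun x => v x * g x)%R.
  by apply: measurable_funM => //; case: bg => mg _ _; exact: measurable_funTS.
have [iug _] := integrableM_bounded (mS n) (hu n).1 bg.
have [|_ ->//] := ae_eq_Rintegral (mS n) mvg iug _.
by apply: filterS (vu n) => x h Sx; rewrite h.
Qed.

End part.

End dual_density.

(** * Truncation of real numbers *)

Section clip.
Context {R : realType}.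
Implicit Types (c x y : R).

Definition clip c x : R := Num.max (- c)%R (Num.min c x).

Lemma clip_le c x : (0 <= c)%R -> (`|clip c x| <= c)%R.
Proof.
move=> c0; rewrite /clip ler_norml; case: (leP c x) => xc.
  by case: (leP (- c) c)%R => ?; lra.
by case: (leP (- c) x)%R => ?; lra.
Qed.

Lemma clip_id c x : (`|x| <= c)%R -> clip c x = x.
Proof.
rewrite ler_norml => /andP[cx xc].
by rewrite /clip (min_idPr xc) (max_idPr cx).
Qed.

Lemma clip_lipschitz c x y : (0 <= c)%R -> (`|clip c x - clip c y| <= `|x - y|)%R.
Proof.
wlog xy : x y / (x <= y)%R.
  by move=> H c0; have [/H|/ltW/H] := leP x y; last rewrite distrC (distrC x); apply.
move=> c0; rewrite (ler0_norm (_ : x - y <= 0)%R) ?subr_le0//.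
rewrite /clip ler_norml; case: (leP c x) => xc; case: (leP c y) => yc;
  case: (leP (- c) c)%R => cc; case: (leP (- c) x)%R => cx;
  case: (leP (- c) y)%R => cy; lra.
Qed.

Lemma clip_abs c x : (0 <= c)%R -> (`|clip c x| <= `|x|)%R.
Proof.
move=> c0; have := clip_lipschitz x 0 c0.
by rewrite (clip_id (_ : (`|0| <= c)%R)) ?normr0// !subr0.
Qed.

Lemma measurable_clip d (T : measurableType d) (D : set T) c (u : T -> R) :
  measurable_fun D u -> measurable_fun D (fun t => clip c (u t)).
Proof.
move=> mu_; rewrite (_ : (fun t => _) = (cst (- c) \max (cst c \min u))%R)//.
by apply: measurable_maxr => //; exact: measurable_minr.
Qed.

Lemma clip_cvg x : clip k%:R x @[k --> \oo] --> x.
Proof.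
apply: cvg_near_cst; near=> k; rewrite clip_id//.
by near: k; exact: nbhs_infty_ger.
Unshelve. all: by end_near. Qed.

End clip.

(** * Mean oscillation as a pairing with a block *)

Section oscillation.
Context d (T : measurableType d) (R : realType).
Variable mu : {measure set T -> \bar R}.
Variables (S : set T) (u : T -> R).
Hypothesis mS : measurable S.
Hypothesis Sfin : mu S < +oo.
Hypothesis S0 : (0 < fine (mu S))%R.
Hypothesis iu : mu.-integrable S (EFin \o u).

(** With P the part of [S] where u >= m, |u - m| is the product of u - m and the sign 2 1_P - 1.
    Since u - m has integral 0, the sign may be replaced by its deviation from its mean, 2 1_P - 2p
    with p = mu(P)/mu(S), which is bounded by 2. That has integral 0 as well, so m drops out of the
    pairing. *)
Lemma oscillation_block : exists w, block mu 2 S w /\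
  (\int[mu]_(x in S) `|u x - (\int[mu]_(y in S) u y) / fine (mu S)| =
   \int[mu]_(x in S) (u x * w x))%R.
Proof.
set I := (\int[mu]_(y in S) u y)%R; pose m := (I / fine (mu S))%R.
pose P := S `&` u @^-1` `[m, +oo[.
have mP : measurable P.
  have mu_ : measurable_fun S u by apply/measurable_EFinP; exact: measurable_int iu.
  by apply: mu_ => //; exact: measurable_itv.
have PS : P `<=` S by exact: subIsetl.
pose p := (fine (mu P) / fine (mu S))%R.
have Pfin : mu P \is a fin_num.
  by rewrite ge0_fin_numE// (le_lt_trans _ Sfin)// le_measure ?inE.
have p01 : (0 <= p <= 1)%R.
  rewrite divr_ge0 ?fine_ge0//= ler_pdivrMr// mul1r fine_le ?le_measure ?inE//.
  by rewrite ge0_fin_numE.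
have bP := bounded_on_indic R mP PS.
have bS := bounded_on_indic R mS (@subset_refl _ S).
have iP := bounded_on_integrable mS mS Sfin bP.
have iS := bounded_on_integrable mS mS Sfin bS.
have iuP := (integrableM_bounded mS iu bP).1.
have iuS := (integrableM_bounded mS iu bS).1.
have IP : (\int[mu]_(x in S) \1_P x = fine (mu P))%R.
  by rewrite /Rintegral integral_indic// setIidl.
have IS : (\int[mu]_(x in S) \1_S x = fine (mu S))%R.
  by rewrite /Rintegral integral_indic// setIid.
have IuS : (\int[mu]_(x in S) (u x * \1_S x) = I)%R by exact: Rintegral_mul_indic.
pose w x := (2 * \1_P x + (- (2 * p)) * \1_S x)%R.
exists w; split.
  have /andP[p0 p1] := p01.
  split.
  - by apply: measurable_funD; apply: measurable_funM => //; exact: measurable_indic.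
  - move=> x; rewrite /w !indicE ler_norml; case: (boolP (x \in P)) => [|_].
      by rewrite inE => /PS xS; rewrite mem_set//=; lra.
    by case: (x \in S) => /=; lra.
  - by move=> x nSx; rewrite /w !indicE !memNset ?mulr0 ?addr0// => /PS.
  - rewrite RintegralD//; [|exact: integrableZE..].
    rewrite !RintegralZl// IP IS /p.
    by field; rewrite gt_eqF.
transitivity (\int[mu]_(x in S) (2 * (u x * \1_P x) + (- (u x) + ((- (2 * m)) * \1_P x + m * \1_S x))))%R.
  apply: eq_Rintegral => x xS; rewrite -/m !indicE xS.
  rewrite (_ : (x \in P) = (m <= u x)%R); last first.
    apply/idP/idP; first by rewrite inE => -[_ /=]; rewrite in_itv/= andbT.
    move=> mu_; rewrite inE; split; first exact/set_mem.
    by rewrite /= in_itv/= andbT.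
  by case: leP => mu_ /=; [rewrite ger0_norm|rewrite ltr0_norm]; lra.
have iN : mu.-integrable S (fun x => (- u x)%:E).
  by under eq_fun do rewrite -mulN1r; exact: integrableZE.
have IN : (\int[mu]_(x in S) (- u x) = - I)%R.
  under eq_Rintegral do rewrite -mulN1r.
  by rewrite RintegralZl// mulN1r.
have i1 : mu.-integrable S (fun x => (- (2 * m) * \1_P x)%:E) by exact: integrableZE.
have i2 : mu.-integrable S (fun x => (m * \1_S x)%:E) by exact: integrableZE.
have i3 : mu.-integrable S (fun x => (- (2 * m) * \1_P x + m * \1_S x)%:E).
  by under eq_fun do rewrite EFinD; exact: integrableD.
have i4 : mu.-integrable S (fun x => (- u x + (- (2 * m) * \1_P x + m * \1_S x))%:E).
  by under eq_fun do rewrite EFinD; exact: integrableD.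
rewrite RintegralD//; last exact: integrableZE.
rewrite RintegralD// RintegralD// !RintegralZl// IN IP IS.
transitivity (\int[mu]_(x in S) (2 * (u x * \1_P x) + (- (2 * p)) * (u x * \1_S x)))%R; last first.
  by apply: eq_Rintegral => x _; rewrite /w; ring.
rewrite RintegralD//; [|exact: integrableZE..].
rewrite !RintegralZl// IuS /p /m; field.
by rewrite gt_eqF.
Qed.

End oscillation.

(** * Pairing a locally integrable function with a block *)

Section pairing.
Context {R : realType} (lam : R).
Hypothesis lam_gt0 : (0 < lam)%R.
Local Notation mu := (mulam lam).
Local Notation Q := (@quadrant R).
Implicit Types (S D : set (R * R)) (g h u v w : R * R -> R).

Let mQ : measurable Q. Proof. exact: measurable_quadrant. Qed.

(** Clipping [w] at its essential bound and cutting it off outside [S] changes it on a null set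
    only, and makes the bound and the support hold everywhere. *)
Lemma rough_block_regular r w : (0 <= r)%R -> rough_block lam r w -> exists S w',
  [/\ rectangle lam S, block mu (r * (fine (mu S))^-1) S w' &
    {ae mu, forall x, Q x -> w x = w' x}].
Proof.
move=> r0 [S [rS mw iw wb]].
have mS := rectangle_measurable rS.
have SQ := rectangle_quadrant rS.
have [c [c0 cE]] : exists c, (0 <= c)%R /\ c = (r * (fine (mu S))^-1)%R.
  exists (r * (fine (mu S))^-1)%R; split => //.
  by rewrite mulr_ge0// invr_ge0 fine_ge0.
rewrite -cE in wb; exists S; rewrite -cE.
pose w' := (fun x => clip c (w x)) \_ S.
have mw' : measurable_fun setT w'.
  apply/(measurable_restrictT _ mS); apply: measurable_clip.
  exact: measurable_funS mw.
have ww' : {ae mu, forall x, Q x -> w x = w' x}.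
  apply: filterS wb => x + _; rewrite /w' patchE indicE.
  case: ifPn => [_|_]; first by rewrite mulr1 => wc; rewrite clip_id.
  by rewrite mulr0 normr_le0 => /eqP.
have w'0 x : ~ S x -> w' x = 0%R by move=> nSx; rewrite /w' patchE memNset.
have w'c x : (`|w' x| <= c)%R.
  by rewrite /w' patchE; case: ifPn => _; [exact: clip_le|rewrite normr0].
have iw' : mu.-integrable Q (EFin \o w').
  exact: integrable_bounded_supp mS mQ (rectangle_lty lam_gt0 rS) mw' w'c w'0.
exists w'; split => //; split => //.
rewrite -(@Rintegral_supp _ _ _ mu S Q)//.
by have [_ <-] := ae_eq_Rintegral mQ mw iw' ww'.
Qed.

(** [u] is integrable only on a square; this is enough since the block vanishes outside [S], and [w]
    differs from it on a null set. *)
Lemma pairing n u w c S w' : measurable_fun Q u ->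
  mu.-integrable (square n) (EFin \o u) -> measurable_fun Q w ->
  rectangle lam S -> S `<=` square n -> block mu c S w' ->
  {ae mu, forall x, Q x -> w x = w' x} ->
  mu.-integrable Q (fun x => (u x * w x)%:E) /\
  (\int[mu]_(x in Q) (u x * w x) = \int[mu]_(x in square n) (u x * w' x))%R.
Proof.
move=> mu_ iu mw rS Sn [mw' wc w0 _] ww'.
have mn := measurable_square lam_gt0 n.
have nQ := rectangle_quadrant (square_rectangle lam_gt0 n).
have bw : bounded_on (square n) c w' by split => // x nx; apply: w0 => /Sn.
have [iuw _] := integrableM_bounded mn iu bw.
have supp x : ~ square n x -> (u x * w' x = 0)%R.
  by move=> nx; rewrite w0 ?mulr0// => /Sn.
have iQ : mu.-integrable Q (EFin \o (fun x => u x * w' x)%R).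
  apply/(integrable_mkcond _ mQ).
  move/(integrable_mkcond _ mn) : iuw; congr (mu.-integrable _ _).
  apply/funext => x; rewrite !patchE.
  case: ifPn => [|xn].
    by rewrite inE => xn; rewrite mem_set//; exact: nQ.
  case: ifPn => // _; rewrite /= supp// => xn'.
  by move/negP : xn; apply; exact: mem_set.
have muw : measurable_fun Q (fun x => u x * w x)%R by exact: measurable_funM.
have [|h1 h2] := ae_eq_Rintegral mQ muw iQ _.
  by apply: filterS ww' => x h Qx; rewrite h.
by split => //; rewrite h2 (@Rintegral_supp _ _ _ mu (square n)).
Qed.

Lemma rough_block_pairing u w r : (0 <= r)%R -> measurable_fun Q u ->
  (forall n, mu.-integrable (square n) (EFin \o u)) -> rough_block lam r w ->
  mu.-integrable Q (fun x => (u x * w x)%:E).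
Proof.
move=> r0 mu_ iu rw; have [S [w' [rS bw ww']]] := rough_block_regular r0 rw.
have mw : measurable_fun Q w by case: rw => ? [].
have [n Sn] := rectangle_square rS.
by have [] := pairing mu_ (iu n) mw rS Sn bw ww'.
Qed.

End pairing.

(** * From a functional to a bmo function *)

Section representation.
Context {R : realType} (lam : R).
Hypothesis lam_gt0 : (0 < lam)%R.
Local Notation mu := (mulam lam).
Local Notation Q := (@quadrant R).
Implicit Types (f a b : R * R -> R[i]) (S D : set (R * R)) (u v w : R * R -> R).

Let mQ : measurable Q. Proof. exact: measurable_quadrant. Qed.

Lemma atom_rough_Re a : atom lam a -> rough_block lam 1 (fun x => complex.Re (a x)).
Proof.
move=> /(atom_blockRe lam_gt0 1%R); rewrite [normc _](normc1 R).
by under [X in rough_block _ _ X]eq_fun do rewrite mul1r.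
Qed.

Lemma atom_rough_Im a : atom lam a -> rough_block lam 1 (fun x => complex.Im (a x)).
Proof.
move=> /(atom_blockIm lam_gt0 1%R); rewrite [normc _](normc1 R).
by under [X in rough_block _ _ X]eq_fun do rewrite mul1r.
Qed.

Lemma cintegrableM_atom b a : cmeasurable Q b ->
  (forall n, cintegrable lam (square n) b) -> atom lam a ->
  cintegrable lam Q (fun x => b x * a x)%R.
Proof.
move=> [mR mI] ib aa; have rR := atom_rough_Re aa; have rI := atom_rough_Im aa.
have iR n : mu.-integrable (square n) (fun x => (complex.Re (b x))%:E) by case: (ib n).
have iI n : mu.-integrable (square n) (fun x => (complex.Im (b x))%:E) by case: (ib n).
split.
  under eq_fun do rewrite ReM EFinB.
  by apply: integrableB => //; [exact: (rough_block_pairing lam_gt0 ler01 mR iR rR)|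
    exact: (rough_block_pairing lam_gt0 ler01 mI iI rI)].
under eq_fun do rewrite ImM EFinD.
by apply: integrableD => //; [exact: (rough_block_pairing lam_gt0 ler01 mR iR rI)|
  exact: (rough_block_pairing lam_gt0 ler01 mI iI rR)].
Qed.

Lemma dual_representation L : h1_dual lam L -> exists b,
  [/\ cmeasurable Q b, (forall n, cintegrable lam (square n) b) & represents lam b L].
Proof.
move=> dL; have [linL _] := dL.
have linRe (k : R) (z z' : R[i]) :
    complex.Re (k%:C%C * z + z')%R = (k * complex.Re z + complex.Re z')%R.
  by rewrite ReD ReM /= mul0r subr0.
have linIm (k : R) (z z' : R[i]) :
    complex.Im (k%:C%C * z + z')%R = (k * complex.Im z + complex.Im z')%R.
  by rewrite ImD ImM /= mul0r addr0.
have [u [mu_ iu uE]] := part_density lam_gt0 dL linRe (@normc_geRe R).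
have [v [mv iv vE]] := part_density lam_gt0 dL linIm (@normc_geIm R).
pose b x := (u x +i* v x)%C.
have mb : cmeasurable Q b by [].
have ib n : cintegrable lam (square n) b by split; [exact: iu|exact: iv].
exists b; split => //; apply: (represents_atoms lam_gt0 linL) => a aa.
have iba := cintegrableM_atom mb ib aa; split => //.
have rR := atom_rough_Re aa; have rI := atom_rough_Im aa.
have [S1 [w1 [rS1 bl1 ww1]]] := rough_block_regular lam_gt0 ler01 rR.
have [S2 [w2 [rS2 bl2 ww2]]] := rough_block_regular lam_gt0 ler01 rI.
have [n1 S1n] := rectangle_square rS1; have [n2 S2n] := rectangle_square rS2.
pose n := maxn n1 n2.
have {}S1n : S1 `<=` square n by apply: (subset_trans S1n); exact: square_mono (leq_maxl _ _).
have {}S2n : S2 `<=` square n by apply: (subset_trans S2n); exact: square_mono (leq_maxr _ _).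
(* A block has mean zero, so the correction fixes it and the density formulas apply to [L]
   itself. *)
have corrE c S w : rectangle lam S -> S `<=` square n -> block mu c S w ->
    bounded_on (square n) c w /\ mean_correction mu (square 0) w = w.
  move=> rS Sn [mw wc w0 iw]; split; first by split => // x nx; apply: w0 => /Sn.
  apply/funext => x; rewrite /mean_correction (@Rintegral_supp _ _ _ mu S) ?iw//.
  by rewrite mul0r mul0r subr0.
have [bd1 c1] := corrE _ _ _ rS1 S1n bl1; have [bd2 c2] := corrE _ _ _ rS2 S2n bl2.
have h1w1 := corr_h1 lam_gt0 bd1; have h1w2 := corr_h1 lam_gt0 bd2.
rewrite c1 in h1w1; rewrite c2 in h1w2.
pose ii : R[i] := Complex (0 : R)%R (1 : R)%R.
have ReE (s t : R) : complex.Re (ii * s%:C%C + t%:C%C)%R = t.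
  by rewrite ReD ReM /= mul0r mul1r subr0 add0r.
have ImE (s t : R) : complex.Im (ii * s%:C%C + t%:C%C)%R = s.
  by rewrite ImD ImM /= mul0r mul1r add0r addr0.
(* The atom agrees only almost everywhere with w1 + i w2; [L] does not see the difference. The
   densities [u] and [v] of its real and imaginary parts were tested on real functions only, hence
   the splitting. *)
have La : L a = (ii * L (fun x => (w2 x)%:C%C) + L (fun x => (w1 x)%:C%C))%R.
  rewrite -linL//; apply/esym; apply: (h1_dual_ae lam_gt0 dL).
  - have [m1 _ _ _] := bl1; have [m2 _ _ _] := bl2; split.
      by under [X in measurable_fun _ X]eq_fun do rewrite ReE; exact: measurable_funTS.
    by under [X in measurable_fun _ X]eq_fun do rewrite ImE; exact: measurable_funTS.
  - by have [] := atom_h1 lam_gt0 aa.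
  apply: filterS2 ww1 ww2 => x h1 h2 Qx; apply: eq_complexP.
    by rewrite h1// ReE.
  by rewrite h2// ImE.
have mwR : measurable_fun Q (fun x => complex.Re (a x)) by case: rR => ? [].
have mwI : measurable_fun Q (fun x => complex.Im (a x)) by case: rI => ? [].
have [iu1 Iu1] := pairing lam_gt0 mu_ (iu n) mwR rS1 S1n bl1 ww1.
have [iu2 Iu2] := pairing lam_gt0 mu_ (iu n) mwI rS2 S2n bl2 ww2.
have [iv1 Iv1] := pairing lam_gt0 mv (iv n) mwR rS1 S1n bl1 ww1.
have [iv2 Iv2] := pairing lam_gt0 mv (iv n) mwI rS2 S2n bl2 ww2.
have := uE _ _ _ bd1; have := uE _ _ _ bd2; have := vE _ _ _ bd1; have := vE _ _ _ bd2.
rewrite c1 c2 => v2 v1 u2 u1.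
have RE : complex.Re (cintegral lam Q (fun x => b x * a x)%R) =
    (\int[mu]_(x in Q) (u x * complex.Re (a x)) - \int[mu]_(x in Q) (v x * complex.Im (a x)))%R.
  by rewrite -RintegralB//; apply: eq_Rintegral => x _; rewrite ReM.
have IE : complex.Im (cintegral lam Q (fun x => b x * a x)%R) =
    (\int[mu]_(x in Q) (u x * complex.Im (a x)) + \int[mu]_(x in Q) (v x * complex.Re (a x)))%R.
  by rewrite -RintegralD//; apply: eq_Rintegral => x _; rewrite ImM.
rewrite La; apply: eq_complexP.
  by rewrite RE ReD ReM [complex.Re ii]/= [complex.Im ii]/= mul0r mul1r add0r u1 v2 Iu1 Iv2 addrC.
by rewrite IE ImD ImM [complex.Re ii]/= [complex.Im ii]/= mul0r mul1r add0r u2 v1 Iu2 Iv1.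
Qed.

(** The factor 2 is the height of the oscillation block, divided out to make it an atom. *)
Lemma oscillation_Re S b : rectangle lam S -> cintegrable lam S b ->
  exists2 a, atom lam a &
  ((fine (mu S))^-1 * \int[mu]_(x in S) `|complex.Re (b x) - complex.Re (mean lam S b)| =
   2 * complex.Re (cintegral lam Q (fun x => b x * a x)))%R.
Proof.
move=> rS [iR iI]; have mS := rectangle_measurable rS.
have S0 := rectangle_fine_gt0 lam_gt0 rS.
have [w [bw wE]] := oscillation_block mS (rectangle_lty lam_gt0 rS) S0 iR.
exists (fun x => ((2 * fine (mu S))^-1 * w x)%:C%C); first exact: block_atom bw.
have -> : complex.Re (mean lam S b) = ((\int[mu]_(x in S) complex.Re (b x)) / fine (mu S))%R.
  by rewrite /mean ReM /= mul0r subr0 mulrC.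
rewrite wE.
have [mw wc w0 _] := bw.
have [iw _] := integrableM_bounded mS iR (And3 mw wc w0).
have -> : complex.Re (cintegral lam Q (fun x => b x * ((2 * fine (mu S))^-1 * w x)%:C%C)%R) =
    (\int[mu]_(x in Q) ((2 * fine (mu S))^-1 * (complex.Re (b x) * w x)))%R.
  by apply: eq_Rintegral => x _; rewrite ReM /= mulr0 subr0 mulrCA.
rewrite (@Rintegral_supp _ _ _ mu S Q); last 2 first.
- exact: (rectangle_quadrant rS).
- by move=> x nSx; rewrite w0// !mulr0.
rewrite RintegralZl//; move: (fine (mu S)) S0 => s s0.
by field; rewrite gt_eqF.
Qed.

Lemma oscillation_Im S b : rectangle lam S -> cintegrable lam S b ->
  exists2 a, atom lam a &
  ((fine (mu S))^-1 * \int[mu]_(x in S) `|complex.Im (b x) - complex.Im (mean lam S b)| =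
   2 * complex.Im (cintegral lam Q (fun x => b x * a x)))%R.
Proof.
move=> rS [iR iI]; have mS := rectangle_measurable rS.
have S0 := rectangle_fine_gt0 lam_gt0 rS.
have [w [bw wE]] := oscillation_block mS (rectangle_lty lam_gt0 rS) S0 iI.
exists (fun x => ((2 * fine (mu S))^-1 * w x)%:C%C); first exact: block_atom bw.
have -> : complex.Im (mean lam S b) = ((\int[mu]_(x in S) complex.Im (b x)) / fine (mu S))%R.
  by rewrite /mean ImM /= mul0r addr0 mulrC.
rewrite wE.
have [mw wc w0 _] := bw.
have [iw _] := integrableM_bounded mS iI (And3 mw wc w0).
have -> : complex.Im (cintegral lam Q (fun x => b x * ((2 * fine (mu S))^-1 * w x)%:C%C)%R) =
    (\int[mu]_(x in Q) ((2 * fine (mu S))^-1 * (complex.Im (b x) * w x)))%R.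
  by apply: eq_Rintegral => x _; rewrite ImM /= mulr0 add0r mulrCA.
rewrite (@Rintegral_supp _ _ _ mu S Q); last 2 first.
- exact: (rectangle_quadrant rS).
- by move=> x nSx; rewrite w0// !mulr0.
rewrite RintegralZl//; move: (fine (mu S)) S0 => s s0.
by field; rewrite gt_eqF.
Qed.

Lemma integrable_oscillation S (u : R * R -> R) (c : R) : rectangle lam S ->
  mu.-integrable S (EFin \o u) -> mu.-integrable S (fun x => (`|u x - c|)%:E).
Proof.
move=> rS iu; have mS := rectangle_measurable rS.
have ic : mu.-integrable S (EFin \o (fun=> c)).
  apply: measurable_bounded_integrable => //; first exact: (rectangle_lty lam_gt0 rS).
  exact: bounded_cst.
have id : mu.-integrable S (EFin \o (fun x => u x - c)%R).
  rewrite (_ : EFin \o _ = (EFin \o u) \- (EFin \o (fun=> c))); last exact/funext.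
  exact: integrableB.
exact: integrable_norm id.
Qed.

(** The constant 4 is 2 for the height of the oscillation block times 2 for adding the real and the
    imaginary part. *)
Lemma bmo_le_dual b L : (forall S, rectangle lam S -> cintegrable lam S b) ->
  represents lam b L -> bmo_norm lam b <= 4%:E * dual_norm lam L.
Proof.
move=> ib bL; apply: ge_ereal_sup => _ [S rS <-].
have [iR iI] := ib _ rS; have mS := rectangle_measurable rS.
have S0 := rectangle_fine_gt0 lam_gt0 rS.
have LaD a : atom lam a -> (normc (cintegral lam Q (fun x => b x * a x)%R))%:E <= dual_norm lam L.
  move=> aa; have [ha na] := atom_h1 lam_gt0 aa.
  have [_ <-] := bL a (atom_span aa).
  by apply: ereal_sup_ubound; exists a.
have [a1 aa1 E1] := oscillation_Re rS (ib _ rS).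
have [a2 aa2 E2] := oscillation_Im rS (ib _ rS).
have i1 := integrable_oscillation (complex.Re (mean lam S b)) rS iR.
have i2 := integrable_oscillation (complex.Im (mean lam S b)) rS iI.
set r1 := complex.Re (mean lam S b) in E1 i1; set r2 := complex.Im (mean lam S b) in E2 i2.
have i3 : mu.-integrable S (fun x => (`|complex.Re (b x) - r1| + `|complex.Im (b x) - r2|)%:E).
  by under eq_fun do rewrite EFinD; exact: integrableD.
have le1 : \int[mu]_(x in S) (normc (b x - mean lam S b)%R)%:E <=
    (\int[mu]_(x in S) (`|complex.Re (b x) - r1| + `|complex.Im (b x) - r2|))%:E.
  rewrite /Rintegral fineK; last exact: (integrable_fin_num mS i3).
  apply: ge0_le_integral => //.
  - by move=> x _; rewrite lee_fin normc_ge0.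
  - apply/measurable_EFinP; apply: measurable_normc.
    apply: (@cmeasurableD _ S b (fun=> - mean lam S b)%R); last by split.
    exact: cintegrable_cmeasurable (ib _ rS).
  - exact: measurable_int i3.
  - by move=> x _; rewrite lee_fin (le_trans (normc_leReIm _))// ReB ImB.
rewrite (inv_mu lam_gt0 rS).
apply: (@le_trans _ _ (((fine (mu S))^-1)%:E *
   (\int[mu]_(x in S) (`|complex.Re (b x) - r1| + `|complex.Im (b x) - r2|))%:E)).
  by rewrite lee_pmul2l// lte_fin invr_gt0.
rewrite -EFinM RintegralD// mulrDr E1 E2.
apply: (@le_trans _ _ (2%:E * (normc (cintegral lam Q (fun x => b x * a1 x)%R))%:E +
   2%:E * (normc (cintegral lam Q (fun x => b x * a2 x)%R))%:E)).
  rewrite -!EFinM -EFinD lee_fin lerD// ler_wpM2l//.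
    exact: le_trans (ler_norm _) (normc_geRe _).
  exact: le_trans (ler_norm _) (normc_geIm _).
have -> : (4 : R)%:E = 2%:E + 2%:E by rewrite -EFinD; congr EFin; lra.
rewrite ge0_muleDl ?lee_fin//.
by apply: leeD; rewrite lee_pmul2l//; exact: LaD.
Qed.

Lemma dual_norm_lty L : h1_dual lam L -> dual_norm lam L < +oo.
Proof.
move=> dL; have [M M0 LM] := h1_dual_bound dL.
apply: (@le_lt_trans _ _ M%:E); last exact: ltry.
apply: ge_ereal_sup => _ [f [hf nf] <-]; apply: (le_trans (LM _ hf)).
by rewrite -[leRHS]mule1 lee_pmul2l// lte_fin.
Qed.

Lemma cintegrable_rectangle b S : (forall n, cintegrable lam (square n) b) ->
  rectangle lam S -> cintegrable lam S b.
Proof.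
move=> ib rS; have [n Sn] := rectangle_square rS.
have mS := rectangle_measurable rS; have mn := measurable_square lam_gt0 n.
by have [iR iI] := ib n; split; [exact: (integrableS mn mS Sn iR)|exact: (integrableS mn mS Sn iI)].
Qed.

(* The integral of a nonnegative function is a supremum over simple functions, hence
   monotone in its domain, measurable or not. *)
Lemma integrable_subset (K : set (R * R)) S u : measurable S -> K `<=` S ->
  measurable_fun K (EFin \o u) -> mu.-integrable S (EFin \o u) ->
  mu.-integrable K (EFin \o u).
Proof.
move=> mS KS mK /integrableP[mu_ ufin]; apply/integrableP; split => //.
apply: le_lt_trans ufin.
rewrite integral_mkcond [leRHS]integral_mkcond !ge0_integralTE; last 2 first.
- by apply: erestrict_ge0 => x _.
- by apply: erestrict_ge0 => x _.
apply: ge_ereal_sup => _ [h hK <-]; apply: ereal_sup_ubound; exists h => // x.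
apply: (le_trans (hK x)); rewrite !patchE; case: ifPn => [|_].
  by rewrite inE => /KS xS; rewrite mem_set.
by case: ifPn => _; [exact: abse_ge0|exact: lexx].
Qed.

(** A compact subset of the quadrant is bounded, hence contained in some square; integrability up to
    the axes is the stronger condition. *)
Lemma L1loc_squares b : cmeasurable Q b -> (forall n, cintegrable lam (square n) b) ->
  L1loc lam b.
Proof.
move=> mb ib; split => // K KQ cK.
have [n Kn] : exists n, K `<=` square n.
  apply: subset_square => //.
  have [M [_ hM]] := @compact_bounded R (R * R)%type K cK.
  exists (`|M| + 1)%R => x Kx.
  have := hM (`|M| + 1)%R _ x Kx; rewrite (le_lt_trans (ler_norm M)) ?ltrDl// => /(_ isT).
  rewrite /= prod_normE ge_max => /andP[h1 h2].
  by split; [exact: (le_trans (ler_norm _) h1)|exact: (le_trans (ler_norm _) h2)].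
have mn := measurable_square lam_gt0 n.
have [iR iI] := ib n; have [mR mI] := mb.
have sub (u : R * R -> R) : measurable_fun Q u -> measurable_fun K (EFin \o u).
  move=> mu_; have : measurable_fun Q (EFin \o u) by exact/measurable_EFinP.
  by apply: measurable_funS.
by split; apply: (integrable_subset mn Kn) => //; exact: sub.
Qed.

Lemma dual_bmo L : h1_dual lam L -> exists2 b, bmo lam b & represents lam b L.
Proof.
move=> dL; have [b [mb ib bL]] := dual_representation dL; exists b => //.
split; first exact: L1loc_squares.
apply: (le_lt_trans (bmo_le_dual (fun S rS => cintegrable_rectangle ib rS) bL)).
by rewrite lte_mul_pinfty// dual_norm_lty.
Qed.

End representation.

(** * Tannery's theorem with a bound on the limit *)

Section tannery.
Context {R : realType}.
Variables (x : nat -> nat -> R) (y c r : nat -> R) (N A : R).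
Hypothesis N0 : (0 <= N)%R.
Hypothesis xr : forall i k, (`|x i k| <= N * r i)%R.
Hypothesis xy : forall i, x i k @[k --> \oo] --> y i.
Hypothesis xc : forall k, (\sum_(0 <= i < n) x i k)%R @[n --> \oo] --> c k.
Hypothesis rA : forall n, (\sum_(0 <= i < n) r i <= A)%R.
Hypothesis rcvg : (\sum_(0 <= i < n) r i)%R @[n --> \oo] --> A.

Let partial_le n p k : (n <= p)%N ->
  (`|\sum_(0 <= i < p) x i k - \sum_(0 <= i < n) x i k| <=
    N * (A - \sum_(0 <= i < n) r i))%R.
Proof.
move=> np; rewrite (big_cat_nat (leq0n n) np)/= addrAC subrr add0r.
apply: (le_trans (ler_norm_sum _ _ _)).
apply: (@le_trans _ _ (\sum_(n <= i < p) N * r i)%R); first exact: ler_sum.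
rewrite -mulr_sumr ler_wpM2l// lerBrDl -big_cat_nat//.
Qed.

Let tail_le n k : (`|c k - \sum_(0 <= i < n) x i k| <=
  N * (A - \sum_(0 <= i < n) r i))%R.
Proof.
have h : (`|\sum_(0 <= i < p) x i k - \sum_(0 <= i < n) x i k|)%R @[p --> \oo] -->
    `|c k - \sum_(0 <= i < n) x i k|%R.
  by apply: cvg_norm; apply: cvgB => //; exact: cvg_cst.
apply: (cvgr_to_le h); near=> p; apply: partial_le.
by near: p; exact: nbhs_infty_ge.
Unshelve. all: by end_near. Qed.

(** The tails of the series are small uniformly in k, so c k is eventually close to a finite sum of
    the limits [y i]. This Cauchy argument does not identify the limit, of which only existence and
    size are wanted. *)
Lemma tannery_cvg : cvgn c.
Proof.
apply/cauchy_cvgP/cauchy_exP => e e0.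
have e20 : (0 < e / 2)%R by rewrite divr_gt0.
have tail0 : (N * (A - \sum_(0 <= i < n) r i))%R @[n --> \oo] --> (0 : R)%R.
  have h : (A - \sum_(0 <= i < n) r i)%R @[n --> \oo] --> (A - A)%R.
    by apply: cvgB; [exact: cvg_cst|exact: rcvg].
  have := @cvgMl_tmp R nat \oo _ _ N _ h; rewrite subrr mulr0; exact.
have /cvgrPdist_lt /(_ _ e20) [n _ /(_ n (leqnn n))] := tail0.
rewrite /= sub0r normrN => /(le_lt_trans (ler_norm _)) hn.
exists (\sum_(0 <= i < n) y i)%R.
have sxy p : (\sum_(0 <= i < p) x i k)%R @[k --> \oo] --> (\sum_(0 <= i < p) y i)%R.
  elim: p => [|p ih].
    by under eq_fun do rewrite big_geq//; rewrite big_geq//; exact: cvg_cst.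
  under eq_fun do rewrite big_nat_recr//=.
  by rewrite big_nat_recr//=; exact: cvgD.
have /cvgrPdist_lt /(_ _ e20) := sxy n.
rewrite /nbhs/=; apply: filterS => k /= hk.
rewrite /ball/=.
have -> : (\sum_(0 <= i < n) y i - c k = (\sum_(0 <= i < n) y i - \sum_(0 <= i < n) x i k) -
   (c k - \sum_(0 <= i < n) x i k))%R by ring.
rewrite (le_lt_trans (ler_normB _ _))// [ltRHS](splitr e).
by rewrite ltrD// (le_lt_trans (tail_le n k)).
Qed.

Lemma tannery_le : (`|limn c| <= N * A)%R.
Proof.
have h : (`|c k|)%R @[k --> \oo] --> `|limn c|%R by apply: cvg_norm; exact: tannery_cvg.
apply: (cvgr_to_le h); near=> k.
by have := tail_le 0 k; rewrite !big_geq// !subr0.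
Unshelve. all: by end_near. Qed.

End tannery.

(** * Pairings with truncations *)

Section truncated_pairing.
Context {R : realType} (lam : R).
Hypothesis lam_gt0 : (0 < lam)%R.
Local Notation mu := (mulam lam).
Local Notation Q := (@quadrant R).
Implicit Types (S D : set (R * R)) (u v w : R * R -> R).

Let mQ : measurable Q. Proof. exact: measurable_quadrant. Qed.

Variables (u : R * R -> R) (N : R).
Hypothesis mu_ : measurable_fun Q u.
Hypothesis N0 : (0 <= N)%R.
Hypothesis iu : forall S, rectangle lam S -> mu.-integrable S (EFin \o u).
Hypothesis ou : forall S, rectangle lam S -> exists k : R,
  (\int[mu]_(x in S) `|u x - k| <= N * fine (mu S))%R.

Let iun n : mu.-integrable (square n) (EFin \o u).
Proof. exact: iu (square_rectangle lam_gt0 n). Qed.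

Let mclip c D : measurable_fun D u -> measurable_fun D (fun x => clip c (u x)).
Proof. exact: measurable_clip. Qed.

Lemma lipschitz_pairing (phi : R -> R) r w : (0 <= r)%R ->
  (forall x y, `|phi x - phi y| <= `|x - y|)%R -> (forall x, `|phi x| <= `|x|)%R ->
  measurable_fun Q (fun x => phi (u x)) -> rough_block lam r w ->
  (`|\int[mu]_(x in Q) (phi (u x) * w x)| <= N * r)%R.
Proof.
move=> r0 philip phile mphi rw.
have [S [w' [rS bw ww']]] := rough_block_regular lam_gt0 r0 rw.
have mw : measurable_fun Q w by case: rw => ? [].
have [n Sn] := rectangle_square rS.
have mS := rectangle_measurable rS.
have mn := measurable_square lam_gt0 n.
have Sfin := rectangle_lty lam_gt0 rS.
have S0 := rectangle_fine_gt0 lam_gt0 rS.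
have SQ := rectangle_quadrant rS.
have iphi D : measurable D -> D `<=` Q -> mu.-integrable D (EFin \o u) ->
    mu.-integrable D (EFin \o (fun x => phi (u x))).
  move=> mD DQ iD; apply: (le_integrable mD _ _ iD).
    by apply/measurable_EFinP; exact: measurable_funS mphi.
  by move=> x _; rewrite lee_fin.
have iphin := iphi _ mn (rectangle_quadrant (square_rectangle lam_gt0 n)) (iun n).
have [_ ->] := pairing lam_gt0 mphi iphin mw rS Sn bw ww'.
have [k ok] := ou rS.
have [c [c0 cE bwc]] : exists c, [/\ (0 <= c)%R, c = (r * (fine (mu S))^-1)%R & block mu c S w'].
  exists (r * (fine (mu S))^-1)%R; split => //.
  by rewrite mulr_ge0// invr_ge0 ltW.
have [mw' wc w0 iw] := bwc.
rewrite (@Rintegral_supp _ _ _ mu S) => [||x nSx]; [|exact: Sn|by rewrite w0// mulr0].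
have bS := And3 mw' wc w0.
have [i1 _] := integrableM_bounded mS (iphi _ mS SQ (iu rS)) bS.
have iw' : mu.-integrable S (EFin \o w') by exact: (block_integrable mS Sfin mS bwc).
(* The block has integral 0, so the constant phi(k) may be subtracted; then |phi(u) - phi(k)| <= |u
   - k| brings in the oscillation of [u]. *)
have -> : (\int[mu]_(x in S) (phi (u x) * w' x) =
    \int[mu]_(x in S) ((phi (u x) - phi k) * w' x))%R.
  transitivity (\int[mu]_(x in S) (phi (u x) * w' x) - phi k * \int[mu]_(x in S) w' x)%R.
    by rewrite iw mulr0 subr0.
  rewrite -RintegralZl// -RintegralB//; last exact: integrableZE.
  by apply: eq_Rintegral => x _; rewrite mulrBl.
have io := integrable_oscillation lam_gt0 k rS (iu rS).
have ico : mu.-integrable S (fun x => (c * `|u x - k|)%:E) by exact: integrableZE.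
have mp : measurable_fun S (fun x => (phi (u x) - phi k) * w' x)%R.
  apply: measurable_funM; last exact: measurable_funTS.
  by apply: measurable_funB => //; exact: measurable_funS mphi.
have ae : {ae mu, forall x, S x -> (`|(phi (u x) - phi k) * w' x| <= c * `|u x - k|)%R}.
  by apply: aeW => x _; rewrite normrM mulrC ler_pM.
have [_ le] := le_Rintegral_abs mS mp ico ae.
apply: (le_trans le); rewrite RintegralZl//.
apply: (@le_trans _ _ (c * (N * fine (mu S)))%R); first by rewrite ler_wpM2l.
rewrite cE; move: (fine (mu S)) S0 => s s0.
by rewrite le_eqVlt; apply/orP; left; apply/eqP; field; rewrite gt_eqF.
Qed.

Definition truncated_pairing v (k : nat) : R :=
  (\int[mu]_(x in Q) (clip k%:R (u x) * v x))%R.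

Lemma integrable_clipM (k : nat) v : mu.-integrable Q (EFin \o v) ->
  mu.-integrable Q (fun x => (clip k%:R (u x) * v x)%:E).
Proof.
move=> iv; have mv : measurable_fun Q v by apply/measurable_EFinP; exact: measurable_int iv.
have ikv : mu.-integrable Q (fun x => (k%:R * v x)%:E) by exact: integrableZE.
apply: (le_integrable mQ _ _ ikv).
  by apply/measurable_EFinP; apply: measurable_funM => //; exact: mclip.
move=> x _; rewrite lee_fin !normrM ler_wpM2r// (le_trans (clip_le _ _))//.
exact: ler_norm.
Qed.

(** Dominated convergence with majorant |u w|, which is integrable because [w] is bounded and lives
    on one rectangle. *)
Lemma truncated_pairing_cvg w r : (0 <= r)%R -> rough_block lam r w ->
  truncated_pairing w k @[k --> \oo] --> (\int[mu]_(x in Q) (u x * w x))%R.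
Proof.
move=> r0 rw; have iw := rough_block_integrable lam_gt0 rw.
have mw : measurable_fun Q w by case: rw => ? [].
have iuw := rough_block_pairing lam_gt0 r0 mu_ iun rw.
have muw : measurable_fun Q (fun x => (u x * w x)%:E) by exact: measurable_int iuw.
have mk (k : nat) : measurable_fun Q (fun x => (clip k%:R (u x) * w x)%:E).
  by apply/measurable_EFinP; apply: measurable_funM => //; exact: mclip.
have iauw : mu.-integrable Q (fun x => `|u x * w x|%:E) by exact: integrable_norm iuw.
have ptw : {ae mu, forall x, Q x ->
    (clip k%:R (u x) * w x)%:E @[k --> \oo] --> (u x * w x)%:E}.
  apply: aeW => x _; apply: cvg_EFin; first exact: nearW.
  by apply: cvgMr_tmp; exact: clip_cvg.
have dom : {ae mu, forall x, forall k : nat, Q x ->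
    `|(clip k%:R (u x) * w x)%:E| <= `|u x * w x|%:E}.
  by apply: aeW => x k _; rewrite lee_fin !normrM ler_wpM2r// clip_abs.
have [_ _ h] := dominated_convergence mQ mk muw ptw iauw dom.
by apply: fine_cvg; rewrite fineK//; exact: (integrable_fin_num mQ iuw).
Qed.

Lemma truncated_pairing_linear (k : nat) (s : R) v w :
  mu.-integrable Q (EFin \o v) -> mu.-integrable Q (EFin \o w) ->
  truncated_pairing (fun x => s * v x + w x)%R k =
  (s * truncated_pairing v k + truncated_pairing w k)%R.
Proof.
move=> iv iw; rewrite /truncated_pairing.
have i1 := integrable_clipM k iv; have i2 := integrable_clipM k iw.
rewrite -RintegralZl// -RintegralD//; last exact: integrableZE.
by apply: eq_Rintegral => x _; ring.
Qed.

Lemma truncated_pairing_sum (k n : nat) (w : nat -> R * R -> R) :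
  (forall i, mu.-integrable Q (EFin \o w i)) ->
  mu.-integrable Q (EFin \o (fun x => \sum_(0 <= i < n) w i x)%R) /\
  truncated_pairing (fun x => \sum_(0 <= i < n) w i x)%R k =
  (\sum_(0 <= i < n) truncated_pairing (w i) k)%R.
Proof.
move=> iw; elim: n => [|n [ih1 ih2]].
  split.
    rewrite (_ : (fun x => _) = (fun=> 0%R)); first exact: integrable0.
    by apply/funext => x; rewrite big_geq.
  rewrite big_geq// /truncated_pairing.
  under eq_Rintegral do rewrite big_geq// mulr0.
  by rewrite Rintegral_cst// mul0r.
rewrite big_nat_recr//= -ih2 (_ : (fun x => _) =
  (fun x => 1 * (w n x) + \sum_(0 <= i < n) w i x)%R); last first.
  by apply/funext => x; rewrite big_nat_recr//= mul1r addrC.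
split; last by rewrite truncated_pairing_linear// mul1r addrC.
rewrite (_ : EFin \o _ = (EFin \o (fun x => 1 * w n x)%R) \+
  (EFin \o (fun x => \sum_(0 <= i < n) w i x)%R)); last exact/funext.
apply: integrableD => //; exact: (integrableZE 1 mQ (iw n)).
Qed.

Lemma truncated_pairing_series v (w : nat -> R * R -> R) (r : nat -> R) (A : R) :
  mu.-integrable Q (EFin \o v) -> (forall i, rough_block lam (r i) (w i)) ->
  (forall i, 0 <= r i)%R -> (forall n, \sum_(0 <= i < n) r i <= A)%R ->
  (\sum_(0 <= i < n) r i)%R @[n --> \oo] --> A ->
  \int[mu]_(x in Q) `|v x - \sum_(0 <= i < n) w i x|%:E @[n --> \oo] --> 0 ->
  cvgn (truncated_pairing v) /\ (`|limn (truncated_pairing v)| <= N * A)%R.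
Proof.
move=> iv rw r0 rA rcvg vw.
have iw i : mu.-integrable Q (EFin \o w i) by exact: rough_block_integrable (rw i).
have xr i k : (`|truncated_pairing (w i) k| <= N * r i)%R.
  apply: (@lipschitz_pairing (clip k%:R)) => //.
  - by move=> x y; exact: clip_lipschitz.
  - by move=> x; exact: clip_abs.
  - exact: mclip.
have xy i := truncated_pairing_cvg (r0 i) (rw i).
have xc k : (\sum_(0 <= i < n) truncated_pairing (w i) k)%R @[n --> \oo] -->
    truncated_pairing v k.
  apply/cvgrPdist_le => e e0.
  (* The truncation is bounded by k, so pairing with it is continuous for the L^1 norm; k + 1
     instead of k avoids a division by 0. *)
  have d0 : (0 < e / k.+1%:R)%R by rewrite divr_gt0.
  have : \forall n \near \oo, \int[mu]_(x in Q) `|v x - \sum_(0 <= i < n) w i x|%:E <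
      (e / k.+1%:R)%:E.
    by apply: (vw [set y | y < (e / k.+1%:R)%:E]); apply: open_ereal_lt'; rewrite lte_fin.
  apply: filterS => n hn.
  have [isw <-] := truncated_pairing_sum k n iw.
  have ivs : mu.-integrable Q (EFin \o (fun x => v x - \sum_(0 <= i < n) w i x)%R).
    rewrite (_ : EFin \o _ = (EFin \o v) \- (EFin \o (fun x => \sum_(0 <= i < n) w i x)%R)).
      exact: integrableB.
    exact/funext.
  have -> : (truncated_pairing v k - truncated_pairing (fun x => \sum_(0 <= i < n) w i x)%R k =
      truncated_pairing (fun x => v x - \sum_(0 <= i < n) w i x)%R k)%R.
    rewrite /truncated_pairing -RintegralB//; last 2 first.
    - exact: integrable_clipM.
    - exact: integrable_clipM.
    by apply: eq_Rintegral => x _; rewrite mulrBr.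
  have ia := integrable_norm ivs.
  have ika : mu.-integrable Q (fun x => (k.+1%:R * `|v x - \sum_(0 <= i < n) w i x|)%:E).
    by apply: integrableZE.
  have mk : measurable_fun Q (fun x => clip k%:R (u x) * (v x - \sum_(0 <= i < n) w i x))%R.
    by apply/measurable_EFinP; exact: measurable_int (integrable_clipM k ivs).
  have ae : {ae mu, forall x, Q x ->
      (`|clip k%:R (u x) * (v x - \sum_(0 <= i < n) w i x)| <=
       k.+1%:R * `|v x - \sum_(0 <= i < n) w i x|)%R}.
    apply: aeW => x _; rewrite normrM ler_wpM2r//.
    by rewrite (le_trans (clip_le _ _))// ler_nat.
  have [_ le] := le_Rintegral_abs mQ mk ika ae.
  rewrite (le_trans le)// RintegralZl// mulrC -ler_pdivlMr//.
  rewrite -lee_fin /Rintegral fineK; first exact: ltW.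
  exact: (integrable_fin_num mQ ia).
split; first exact: (tannery_cvg N0 xr xy xc rA rcvg).
exact: (tannery_le N0 xr xy xc rA rcvg).
Qed.

End truncated_pairing.

(** * From a bmo function to a functional *)

Section duality.
Context {R : realType} (lam : R).
Hypothesis lam_gt0 : (0 < lam)%R.
Local Notation mu := (mulam lam).
Local Notation Q := (@quadrant R).
Implicit Types (f a b : R * R -> R[i]) (S D : set (R * R)).

Let mQ : measurable Q. Proof. exact: measurable_quadrant. Qed.

Lemma bmo_norm_ge0 b : 0 <= bmo_norm lam b.
Proof.
have rS := square_rectangle lam_gt0 0; apply: le_ereal_sup_tmp.
exists ((mu (square 0))^-1 * \int[mu]_(x in square 0) (normc (b x - mean lam (square 0) b)%R)%:E).
  by exists (square 0).
apply: mule_ge0; first by rewrite inve_ge0.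
by apply: integral_ge0 => x _; rewrite lee_fin normc_ge0.
Qed.

(** Local integrability says nothing about rectangles touching the axes. There the mean is at first
    just some number k, the integral having a default value; finiteness of the oscillation makes b -
    k integrable, and with it b. *)
Lemma bmo_integrable b (N : R) : cmeasurable Q b -> bmo_norm lam b = N%:E ->
  forall S, rectangle lam S -> cintegrable lam S b /\
    (\int[mu]_(x in S) normc (b x - mean lam S b) <= N * fine (mu S))%R.
Proof.
move=> [mR mI] bN S rS; set k := mean lam S b.
have mS := rectangle_measurable rS.
have SQ := rectangle_quadrant rS.
have Sfin := rectangle_lty lam_gt0 rS.
have S0 := rectangle_fine_gt0 lam_gt0 rS.
have mb : cmeasurable S b by split; [exact: measurable_funS mR|exact: measurable_funS mI].
have mbk : measurable_fun S (fun x => normc (b x - k)%R).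
  by apply: measurable_normc; apply: (@cmeasurableD _ S b (fun=> - k)%R); last by split.
have le : \int[mu]_(x in S) (normc (b x - k)%R)%:E <= (N * fine (mu S))%:E.
  have : (mu S)^-1 * \int[mu]_(x in S) (normc (b x - k)%R)%:E <= N%:E.
    by rewrite -bN; apply: ereal_sup_ubound; exists S.
  rewrite (inv_mu lam_gt0 rS).
  move: (integral _ _ _) (fine (mu S)) S0 => I s s0.
  by rewrite lee_pdivrMl// muleC EFinM.
have ibk : mu.-integrable S (fun x => (normc (b x - k)%R)%:E).
  apply/integrableP; split; first exact/measurable_EFinP.
  under eq_integral do rewrite gee0_abs ?lee_fin ?normc_ge0//.
  exact: le_lt_trans le (ltry _).
have cst_int (c : R) : mu.-integrable S (EFin \o (fun=> c)).
  by apply: measurable_bounded_integrable => //; exact: bounded_cst.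
have part (u : R * R -> R) (c : R) : measurable_fun S u ->
    (forall x, `|u x - c| <= normc (b x - k)%R)%R -> mu.-integrable S (EFin \o u).
  move=> mu_ uc.
  have [||i1 _] := @le_Rintegral_abs _ _ _ mu S (fun x => u x - c)%R _ mS _ ibk.
  - exact: measurable_funB.
  - by apply: aeW => x _.
  rewrite (_ : EFin \o u = (EFin \o (fun x => u x - c)%R) \+ (EFin \o (fun=> c))).
    exact: integrableD.
  by apply/funext => x /=; rewrite -EFinD subrK.
split.
  case: mb => mbR mbI; split.
    by apply: (part _ (complex.Re k) mbR) => x; rewrite -ReB normc_geRe.
  by apply: (part _ (complex.Im k) mbI) => x; rewrite -ImB normc_geIm.
rewrite -lee_fin /Rintegral fineK//; exact: (integrable_fin_num mS ibk).
Qed.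

Lemma bmo_oscillation b (N : R) : cmeasurable Q b -> bmo_norm lam b = N%:E ->
  forall S, rectangle lam S -> exists k : R[i],
    (\int[mu]_(x in S) `|complex.Re (b x) - complex.Re k| <= N * fine (mu S))%R /\
    (\int[mu]_(x in S) `|complex.Im (b x) - complex.Im k| <= N * fine (mu S))%R.
Proof.
move=> mb bN S rS; exists (mean lam S b); set k := mean lam S b.
have [[iR iI] le] := bmo_integrable mb bN rS.
have mS := rectangle_measurable rS.
have Sfin := rectangle_lty lam_gt0 rS.
have icst : cintegrable lam S (fun=> - k)%R.
  split; apply: measurable_bounded_integrable => //; exact: bounded_cst.
have ibk := cintegrable_normc mS (cintegrableD mS (conj iR iI) icst).
split; apply: (le_trans _ le); apply: le_Rintegral => //.
- exact: (integrable_oscillation lam_gt0 _ rS iR).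
- by move=> x _; rewrite -ReB normc_geRe.
- exact: (integrable_oscillation lam_gt0 _ rS iI).
- by move=> x _; rewrite -ImB normc_geIm.
Qed.

Lemma le_h1_norm (K x : R) f : (0 <= K)%R -> h1 lam f ->
  (forall alpha atoms, atomic_decomposition lam f alpha atoms ->
    x%:E <= K%:E * \sum_(0 <= i <oo) (normc (alpha i))%:E) ->
  x%:E <= K%:E * h1_norm lam f.
Proof.
move=> K0 [_ [alpha [atoms dec]]] h.
(* For K = 0 one cannot divide, and some decomposition of [f] must be at hand to get x <= 0. *)
move: K0; rewrite le_eqVlt => /predU1P[K0|K0].
  by have := h _ _ dec; rewrite -K0 !mul0e.
rewrite -lee_pdivrMl//; apply: le_ereal_inf_tmp => _ [alpha' [atoms' [dec' ->]]].
by rewrite lee_pdivrMl//; exact: h dec'.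
Qed.

Lemma decomposition_partial_sums (alpha : nat -> R[i]) :
  \sum_(0 <= i <oo) (normc (alpha i))%:E < +oo -> exists A : R,
  [/\ \sum_(0 <= i <oo) (normc (alpha i))%:E = A%:E,
      (forall n, \sum_(0 <= i < n) normc (alpha i) <= A)%R &
      (\sum_(0 <= i < n) normc (alpha i))%R @[n --> \oo] --> A].
Proof.
move=> fin; have pos i : true -> 0 <= (normc (alpha i))%:E by rewrite lee_fin normc_ge0.
exists (fine (\sum_(0 <= i <oo) (normc (alpha i))%:E)).
have E : \sum_(0 <= i <oo) (normc (alpha i))%:E =
    (fine (\sum_(0 <= i <oo) (normc (alpha i))%:E))%:E.
  by rewrite fineK// ge0_fin_numE// nneseries_ge0// => i _ _; exact: pos.
split => //.
  move=> n; rewrite -lee_fin -E -sumEFin.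
  by apply: nneseries_lim_ge => i _ _; exact: pos.
have : (\sum_(0 <= i < n) (normc (alpha i))%:E) @[n --> \oo] -->
    \sum_(0 <= i <oo) (normc (alpha i))%:E.
  by apply: is_cvg_nneseries => n _; exact: pos.
move: E; set A := fine _ => E.
rewrite E; under [in X in X -> _]eq_fun do rewrite sumEFin.
move/fine_cvg => h; exact: h.
Qed.

Section functional.
Variables (b : R * R -> R[i]) (N : R).
Hypothesis mb : cmeasurable Q b.
Hypothesis bN : bmo_norm lam b = N%:E.

Let N0 : (0 <= N)%R. Proof. by rewrite -lee_fin -bN bmo_norm_ge0. Qed.

Let uR x : R := complex.Re (b x).
Let uI x : R := complex.Im (b x).
Let muR : measurable_fun Q uR. Proof. by case: mb. Qed.
Let muI : measurable_fun Q uI. Proof. by case: mb. Qed.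

Let iR S : rectangle lam S -> mu.-integrable S (EFin \o uR).
Proof. by move=> rS; have [[]] := bmo_integrable mb bN rS. Qed.
Let iI S : rectangle lam S -> mu.-integrable S (EFin \o uI).
Proof. by move=> rS; have [[]] := bmo_integrable mb bN rS. Qed.

Let oR S : rectangle lam S -> exists k : R,
  (\int[mu]_(x in S) `|uR x - k| <= N * fine (mu S))%R.
Proof. by move=> rS; have [k [? _]] := bmo_oscillation mb bN rS; exists (complex.Re k). Qed.
Let oI S : rectangle lam S -> exists k : R,
  (\int[mu]_(x in S) `|uI x - k| <= N * fine (mu S))%R.
Proof. by move=> rS; have [k [_ ?]] := bmo_oscillation mb bN rS; exists (complex.Im k). Qed.

Let pairing_cvg (u : R * R -> R) v := cvgn (truncated_pairing lam u v).

Let h1_pairing f alpha atoms (u : R * R -> R) : cintegrable lam Q f ->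
  atomic_decomposition lam f alpha atoms ->
  measurable_fun Q u -> (forall S, rectangle lam S -> mu.-integrable S (EFin \o u)) ->
  (forall S, rectangle lam S -> exists k : R,
    (\int[mu]_(x in S) `|u x - k| <= N * fine (mu S))%R) ->
  exists A : R, [/\ \sum_(0 <= i <oo) (normc (alpha i))%:E = A%:E,
    pairing_cvg u (fun x => complex.Re (f x)),
    pairing_cvg u (fun x => complex.Im (f x)),
    (`|limn (truncated_pairing lam u (fun x => complex.Re (f x)))| <= N * A)%R &
    (`|limn (truncated_pairing lam u (fun x => complex.Im (f x)))| <= N * A)%R].
Proof.
move=> [fR fI] [aa sa lima] mu_ iu ou.
have [A [AE Ale Acvg]] := decomposition_partial_sums sa; exists A.
have r0 i : (0 <= normc (alpha i))%R by exact: normc_ge0.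
have mres n : cmeasurable Q (fun x => f x - \sum_(0 <= i < n) alpha i * atoms i x)%R.
  apply: cmeasurableD; first exact: (@cintegrable_cmeasurable _ lam Q f (conj fR fI)).
  under [X in cmeasurable _ X]eq_fun do rewrite -mulN1r.
  apply: cmeasurableZ => //; apply: (@cintegrable_cmeasurable _ lam Q).
  apply: cintegrable_sum => // i; apply: cintegrableZ => //; exact: atom_integrable.
have limpart (rho : R[i] -> R) : (forall z z' : R[i], rho (z - z') = rho z - rho z')%R ->
    (forall n (F : nat -> R[i]), rho (\sum_(0 <= i < n) F i) = \sum_(0 <= i < n) rho (F i))%R ->
    (forall z, `|rho z| <= normc z)%R ->
    (forall g, cmeasurable Q g -> measurable_fun Q (fun x => rho (g x))) ->
    \int[mu]_(x in Q) `|rho (f x) - \sum_(0 <= i < n) rho (alpha i * atoms i x)|%:E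
      @[n --> \oo] --> 0.
  move=> rhoB rhoS rhole mrho.
  apply: (squeeze_cvge _ (cvg_cst 0) lima).
  apply: nearW => n; apply/andP; split.
    by apply: integral_ge0 => x _; rewrite lee_fin.
  under eq_integral do rewrite -rhoS -rhoB.
  apply: ge0_le_integral => //.
  - by apply/measurable_EFinP; apply: measurableT_comp => //; exact: mrho.
  - by apply/measurable_EFinP; exact: measurable_normc.
  - by move=> x _; rewrite lee_fin.
have cR := limpart (fun z => complex.Re z) (@ReB R) (fun n F => Re_sum _ _ _)
  (@normc_geRe R) (fun g mg => mg.1).
have cI := limpart (fun z => complex.Im z) (@ImB R) (fun n F => Im_sum _ _ _)
  (@normc_geIm R) (fun g mg => mg.2).
have bR i := atom_blockRe lam_gt0 (alpha i) (aa i).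
have bI i := atom_blockIm lam_gt0 (alpha i) (aa i).
have [c1 l1] := truncated_pairing_series lam_gt0 mu_ N0 iu ou fR bR r0 Ale Acvg cR.
have [c2 l2] := truncated_pairing_series lam_gt0 mu_ N0 iu ou fI bI r0 Ale Acvg cI.
exact: (And5 AE c1 c2 l1 l2).
Qed.

Let h1_pairing_cvg f : h1 lam f -> [/\ pairing_cvg uR (fun x => complex.Re (f x)),
  pairing_cvg uR (fun x => complex.Im (f x)), pairing_cvg uI (fun x => complex.Re (f x)) &
  pairing_cvg uI (fun x => complex.Im (f x))].
Proof.
move=> [cf [alpha [atoms dec]]].
have [A1 [_ ? ? _ _]] := h1_pairing cf dec muR iR oR.
by have [A2 [_ ? ? _ _]] := h1_pairing cf dec muI iI oI.
Qed.

Let lim_pairing u v : R := limn (truncated_pairing lam u v).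

Let lim_pairing_linear u s v w : measurable_fun Q u ->
  mu.-integrable Q (EFin \o v) -> mu.-integrable Q (EFin \o w) ->
  pairing_cvg u v -> pairing_cvg u w ->
  pairing_cvg u (fun x => s * v x + w x)%R /\
  lim_pairing u (fun x => s * v x + w x)%R = (s * lim_pairing u v + lim_pairing u w)%R.
Proof.
move=> mu_ iv iw cv cw.
have h : truncated_pairing lam u (fun x => s * v x + w x)%R k @[k --> \oo] -->
    (s * lim_pairing u v + lim_pairing u w)%R.
  under eq_fun do rewrite truncated_pairing_linear//.
  by apply: cvgD; [apply: cvgMl_tmp; exact: cv|exact: cw].
by split; [apply/cvg_ex; exists (s * lim_pairing u v + lim_pairing u w)%R|exact: cvg_lim h].
Qed.

(** The limit version of the integral of b f, with the real and the imaginary part of [b] truncated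
    separately. No decomposition of [f] enters, so linearity and independence of the decomposition
    cost nothing extra. *)
Definition bmo_functional f : R[i] := Complex
  (lim_pairing uR (fun x => complex.Re (f x)) - lim_pairing uI (fun x => complex.Im (f x)))%R
  (lim_pairing uR (fun x => complex.Im (f x)) + lim_pairing uI (fun x => complex.Re (f x)))%R.

Let lim_pairing_complex u (k : R[i]) f (g : R * R -> R[i]) : measurable_fun Q u ->
  cintegrable lam Q f -> cintegrable lam Q g ->
  pairing_cvg u (fun x => complex.Re (f x)) -> pairing_cvg u (fun x => complex.Im (f x)) ->
  pairing_cvg u (fun x => complex.Re (g x)) -> pairing_cvg u (fun x => complex.Im (g x)) ->
  lim_pairing u (fun x => complex.Re (k * f x + g x)%R) =
    (complex.Re k * lim_pairing u (fun x => complex.Re (f x)) -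
     complex.Im k * lim_pairing u (fun x => complex.Im (f x)) +
     lim_pairing u (fun x => complex.Re (g x)))%R /\
  lim_pairing u (fun x => complex.Im (k * f x + g x)%R) =
    (complex.Re k * lim_pairing u (fun x => complex.Im (f x)) +
     complex.Im k * lim_pairing u (fun x => complex.Re (f x)) +
     lim_pairing u (fun x => complex.Im (g x)))%R.
Proof.
move=> mu_ [fR fI] [gR gI] cfR cfI cgR cgI.
have intl (s : R) (v w : R * R -> R) : mu.-integrable Q (EFin \o v) ->
    mu.-integrable Q (EFin \o w) -> mu.-integrable Q (EFin \o (fun x => s * v x + w x)%R).
  move=> iv iw; rewrite (_ : EFin \o _ = (EFin \o (fun x => s * v x)%R) \+ (EFin \o w)).
    by apply: integrableD => //; exact: (integrableZE s mQ iv).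
  exact/funext.
have [c1 e1] := lim_pairing_linear (- complex.Im k) mu_ fI gR cfI cgR.
have [_ e2] := lim_pairing_linear (complex.Re k) mu_ fR (intl _ _ _ fI gR) cfR c1.
have [c3 e3] := lim_pairing_linear (complex.Im k) mu_ fR gI cfR cgI.
have [_ e4] := lim_pairing_linear (complex.Re k) mu_ fI (intl _ _ _ fR gI) cfI c3.
split.
  rewrite (_ : (fun x => complex.Re _) = (fun x => complex.Re k * complex.Re (f x) +
     (- complex.Im k * complex.Im (f x) + complex.Re (g x)))%R).
    by rewrite e2 e1; do ![move: (lim_pairing _ _) => ?]; ring.
  by apply/funext => x; rewrite ReD ReM; ring.
rewrite (_ : (fun x => complex.Im _) = (fun x => complex.Re k * complex.Im (f x) +
   (complex.Im k * complex.Re (f x) + complex.Im (g x)))%R).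
  by rewrite e4 e3; do ![move: (lim_pairing _ _) => ?]; ring.
by apply/funext => x; rewrite ImD ImM; ring.
Qed.

Lemma bmo_functional_linear : h1_linear lam bmo_functional.
Proof.
move=> k f g hf hg.
have [f1 f2 f3 f4] := h1_pairing_cvg hf; have [g1 g2 g3 g4] := h1_pairing_cvg hg.
have [e1 e2] := lim_pairing_complex k muR hf.1 hg.1 f1 f2 g1 g2.
have [e3 e4] := lim_pairing_complex k muI hf.1 hg.1 f3 f4 g3 g4.
rewrite /bmo_functional e1 e2 e3 e4; apply: eq_complexP.
  by rewrite ReD ReM /=; do ![move: (lim_pairing _ _) => ?]; ring.
by rewrite ImD ImM /=; do ![move: (lim_pairing _ _) => ?]; ring.
Qed.

Lemma bmo_functional_bounded f : h1 lam f ->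
  (normc (bmo_functional f))%:E <= (4 * N)%:E * h1_norm lam f.
Proof.
move=> hf; apply: le_h1_norm => //; first by rewrite mulr_ge0.
move=> alpha atoms dec.
have [A [AE _ _ l1 l2]] := h1_pairing hf.1 dec muR iR oR.
have [A' [A'E _ _ l3 l4]] := h1_pairing hf.1 dec muI iI oI.
have AA' : A' = A by move: A'E; rewrite AE => -[].
rewrite AA' in l3 l4; rewrite AE -EFinM lee_fin.
apply: (le_trans (normc_leReIm _)) => /=.
apply: le_trans (lerD (ler_normB _ _) (ler_normD _ _)) _.
(* One N A for each of the four real pairings. *)
rewrite (_ : 4 * N * A = (N * A + N * A) + (N * A + N * A))%R; last by ring.
exact: lerD (lerD l1 l4) (lerD l2 l3).
Qed.

Lemma bmo_functional_represents : represents lam b bmo_functional.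
Proof.
apply: (represents_atoms lam_gt0 bmo_functional_linear) => a aa.
have ib n : cintegrable lam (square n) b.
  by have [] := bmo_integrable mb bN (square_rectangle lam_gt0 n).
have iba := cintegrableM_atom lam_gt0 mb ib aa; split => //.
have rR := atom_rough_Re lam_gt0 aa; have rI := atom_rough_Im lam_gt0 aa.
have lim u w : measurable_fun Q u ->
    (forall S, rectangle lam S -> mu.-integrable S (EFin \o u)) ->
    rough_block lam 1 w -> lim_pairing u w = (\int[mu]_(x in Q) (u x * w x))%R /\
    mu.-integrable Q (fun x => (u x * w x)%:E).
  move=> mu_ iu rw; split.
    by apply: cvg_lim => //; exact: (truncated_pairing_cvg lam_gt0 mu_ iu ler01 rw).
  apply: (rough_block_pairing lam_gt0 ler01 mu_ _ rw) => n.
  exact: iu (square_rectangle lam_gt0 n).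
have [e1 i1] := lim _ _ muR iR rR; have [e2 i2] := lim _ _ muI iI rI.
have [e3 i3] := lim _ _ muR iR rI; have [e4 i4] := lim _ _ muI iI rR.
rewrite /bmo_functional e1 e2 e3 e4; apply: eq_complexP.
  by rewrite [LHS]/= -RintegralB//; apply: eq_Rintegral => x _; rewrite ReM.
by rewrite [LHS]/= -RintegralD//; apply: eq_Rintegral => x _; rewrite ImM.
Qed.

Lemma bmo_functional_dual : h1_dual lam bmo_functional.
Proof.
split; first exact: bmo_functional_linear.
by exists (4 * N)%R; exact: bmo_functional_bounded.
Qed.

End functional.

End duality.

(** * Uniqueness of the functional and of the function *)

Lemma null_oscillation {d} {T : measurableType d} {R : realType} (mu : {measure set T -> \bar R})
    (D : set T) (u : T -> R) (c : R) : measurable D -> measurable_fun D u ->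
  mu.-integrable D (fun x => (`|u x - c|)%:E) -> (\int[mu]_(x in D) `|u x - c| = 0)%R ->
  {ae mu, forall x, D x -> u x = c}.
Proof.
move=> mD mu_ iu u0.
have m1 : measurable_fun D (fun x => (u x - c)%:E).
  by apply/measurable_EFinP; exact: measurable_funB.
have e0 : \int[mu]_(x in D) `|(u x - c)%:E| = 0.
  by rewrite -[LHS](fineK (integrable_fin_num mD iu)) [X in X%:E]u0.
have := (ae_eq_integral_abs mu mD m1).1 e0.
by apply: filterS => x h Dx; have [/eqP] := h Dx; rewrite subr_eq0 => /eqP.
Qed.

Lemma big_nat_shift (V : nmodType) (F : nat -> V) n m :
  (\sum_(0 <= i < n + m) F i = \sum_(0 <= i < n) F i + \sum_(0 <= i < m) F (i + n)%N)%R.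
Proof.
rewrite (big_cat_nat (n := n) _ (leq_addr m n))//=; congr (_ + _)%R.
by rewrite -{1}[n]add0n big_addn addKn.
Qed.

Section uniqueness.
Context {R : realType} (lam : R).
Hypothesis lam_gt0 : (0 < lam)%R.
Local Notation mu := (mulam lam).
Local Notation Q := (@quadrant R).
Implicit Types (f a b : R * R -> R[i]) (S D : set (R * R)).

Let mQ : measurable Q. Proof. exact: measurable_quadrant. Qed.

Lemma decomposition_remainder f alpha atoms n : atomic_decomposition lam f alpha atoms ->
  atomic_decomposition lam (fun x => -1 * (\sum_(0 <= i < n) alpha i * atoms i x) + f x)%R
    (fun i => alpha (i + n)%N) (fun i => atoms (i + n)%N).
Proof.
move=> [aa sa lima]; have [A [_ Ale _]] := decomposition_partial_sums sa.
split => //.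
- apply: (@le_lt_trans _ _ A%:E); last exact: ltry.
  apply: lime_le; first by apply: is_cvg_nneseries => i _ _; rewrite lee_fin normc_ge0.
  apply: nearW => m; rewrite sumEFin lee_fin (le_trans _ (Ale (n + m)%N))//.
  by rewrite big_nat_shift lerDr sumr_ge0// => i _; exact: normc_ge0.
rewrite -(cvg_shiftn n) in lima; apply: cvg_trans lima; apply: near_eq_cvg; apply: nearW => m.
apply: eq_integral => x _; congr (normc _)%:E.
by rewrite mulN1r (addrC (- _)%R) -addrA -opprD /= (addnC m n) big_nat_shift.
Qed.

(** The shifted sequences decompose the remainder, so an atomic series converges in the h^1 norm and
    not only in L^1: the finite combinations of atoms are dense. *)
Lemma remainder_norm f alpha atoms : h1 lam f -> atomic_decomposition lam f alpha atoms ->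
  exists2 r : nat -> R, r n @[n --> \oo] --> (0 : R)%R & forall n,
    h1 lam (fun x => -1 * (\sum_(0 <= i < n) alpha i * atoms i x) + f x)%R /\
    h1_norm lam (fun x => -1 * (\sum_(0 <= i < n) alpha i * atoms i x) + f x)%R <= (r n)%:E.
Proof.
move=> [cf _] dec; have [aa sa _] := dec.
have [A [_ Ale Acvg]] := decomposition_partial_sums sa.
exists (fun n => A - \sum_(0 <= i < n) normc (alpha i))%R.
  rewrite -[X in _ --> X](subrr A).
  have h : (fun=> A) n @[n --> \oo] --> A by exact: cvg_cst.
  exact: (cvgB h Acvg).
move=> n; have decn := decomposition_remainder n dec; split.
  split; last by do 2 eexists; exact: decn.
  apply: cintegrableD => //; apply: cintegrableZ => //; apply: cintegrable_sum => // i.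
  by apply: cintegrableZ => //; exact: atom_integrable.
apply: (le_trans (h1_norm_le decn)).
apply: lime_le; first by apply: is_cvg_nneseries => i _ _; rewrite lee_fin normc_ge0.
apply: nearW => m; rewrite sumEFin lee_fin lerBrDl (le_trans _ (Ale (n + m)%N))//.
by rewrite big_nat_shift.
Qed.

(** Both functionals agree on partial sums, so their difference at [f] is that at the remainder,
    which tends to 0 by boundedness. *)
Lemma h1_dual_unique b L L' : h1_dual lam L -> h1_dual lam L' ->
  represents lam b L -> represents lam b L' -> forall f, h1 lam f -> L' f = L f.
Proof.
move=> dL dL' bL bL' f hf; have [_ [alpha [atoms dec]]] := hf.
have [M M0 LM] := h1_dual_bound dL; have [M' M'0 LM'] := h1_dual_bound dL'.
have [r r0 hr] := remainder_norm hf dec; have [aa _ _] := dec.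
pose s n x := (\sum_(0 <= i < n) alpha i * atoms i x)%R.
have sE n : forall x, s n x = (\sum_(i < n) alpha i * atoms i x)%R.
  by move=> x; rewrite /s big_mkord.
have hs n : h1 lam (s n) by have [] := span_h1 lam_gt0 (fun i : 'I_n => aa i) (sE n).
have ss n : atomic_span lam (s n) by exists n, (fun i => alpha i), (fun i => atoms i).
have [linL _] := dL; have [linL' _] := dL'.
have le n : (normc (L' f - L f) <= (M' + M) * r n)%R.
  have [hg ng] := hr n.
  have [_ Ls] := bL _ (ss n); have [_ Ls'] := bL' _ (ss n).
  have gE : (L' f - L f = L' (fun x => -1 * s n x + f x) - L (fun x => -1 * s n x + f x))%R.
    by rewrite linL// linL'// Ls Ls' opprD addrACA subrr add0r.
  rewrite gE (le_trans (normc_leD _ _))// normcN mulrDl; apply: lerD.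
    rewrite -lee_fin EFinM (le_trans (LM' _ hg))// lee_pmul2l// lte_fin//.
  rewrite -lee_fin EFinM (le_trans (LM _ hg))// lee_pmul2l// lte_fin//.
apply/eqP; rewrite -subr_eq0; apply/eqP/(@eq0_normc R)/le_anti; rewrite normc_ge0 andbT.
have c0 : ((M' + M) * r n)%R @[n --> \oo] --> (0 : R)%R.
  by rewrite -[X in _ --> X](mulr0 (M' + M)%R); apply: cvgMl_tmp.
rewrite -(cvg_lim (@Rhausdorff R) c0); apply: limr_ge; first by apply/cvg_ex; exists 0%R.
exact: nearW.
Qed.

Lemma cintegral_ae f (g : R * R -> R[i]) : cmeasurable Q f -> cintegrable lam Q g ->
  {ae mu, forall x, Q x -> f x = g x} ->
  cintegrable lam Q f /\ cintegral lam Q f = cintegral lam Q g.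
Proof.
move=> [mR mI] [gR gI] fg.
have [|iR eR] := ae_eq_Rintegral mQ mR gR; first by apply: filterS fg => x h /h ->.
have [|iI eI] := ae_eq_Rintegral mQ mI gI; first by apply: filterS fg => x h /h ->.
by split; [split|apply: eq_complexP].
Qed.

Lemma represents_shift b (b' : R * R -> R[i]) (k : R[i]) L : h1_linear lam L ->
  cmeasurable Q b' -> represents lam b L ->
  {ae mu, forall x, Q x -> b' x = (b x + k)%R} -> represents lam b' L.
Proof.
move=> linL mb' bL bb'; apply: (represents_atoms lam_gt0 linL) => a aa.
have [iba La] := bL _ (atom_span aa); have ia := atom_integrable lam_gt0 aa.
have [S [_ ma a0 _]] := atom_bound lam_gt0 aa.
have ika := cintegrableZ k mQ ia; have ig := cintegrableD mQ iba ika.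
have [||i1 e1] := @cintegral_ae (fun x => b' x * a x)%R _ _ ig.
- split.
    under eq_fun do rewrite ReM; case: mb' ma => ? ? [? ?].
    by apply: measurable_funB; exact: measurable_funM.
  under eq_fun do rewrite ImM; case: mb' ma => ? ? [? ?].
  by apply: measurable_funD; exact: measurable_funM.
- by apply: filterS bb' => x h Qx; rewrite h// mulrDl.
by split => //; rewrite La e1 cintegralD// cintegralZ// a0 mulr0 addr0.
Qed.

(** The atoms that compute the oscillation over a square give 0, so [d] equals its mean almost
    everywhere on each square. *)
Lemma annihilator_constant d : cmeasurable Q d -> (forall n, cintegrable lam (square n) d) ->
  (forall a, atom lam a -> cintegral lam Q (fun x => d x * a x)%R = 0%R) ->
  exists k : R[i], {ae mu, forall x, Q x -> d x = k}.
Proof.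
move=> [mR mI] id da; pose k n := mean lam (square n) d.
have sqQ n : square n `<=` Q := rectangle_quadrant (square_rectangle lam_gt0 n).
have dk n : {ae mu, forall x, square n x -> d x = k n}.
  have rS := square_rectangle lam_gt0 n; have mS := measurable_square lam_gt0 n.
  have S0 : (fine (mu (square n)))^-1%R != 0%R.
    by rewrite invr_eq0 gt_eqF// rectangle_fine_gt0.
  have [iR iI] := id n.
  have [a1 aa1] := oscillation_Re lam_gt0 rS (id n).
  rewrite da// mulr0 => /eqP; rewrite mulf_eq0 (negbTE S0)/= => /eqP oR.
  have [a2 aa2] := oscillation_Im lam_gt0 rS (id n).
  rewrite da// mulr0 => /eqP; rewrite mulf_eq0 (negbTE S0)/= => /eqP oI.
  have aeR := null_oscillation mS (measurable_funS mQ (sqQ n) mR)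
    (integrable_oscillation lam_gt0 _ rS iR) oR.
  have aeI := null_oscillation mS (measurable_funS mQ (sqQ n) mI)
    (integrable_oscillation lam_gt0 _ rS iI) oI.
  by apply: filterS2 aeR aeI => x hR hI Sx; apply: eq_complexP; [exact: hR|exact: hI].
have k0 n : k n = k 0%N.
  (* Two different constants would make square 0, on which both are attained almost everywhere, a
     null set. *)
  apply: contrapT => kn.
  have S0 : {ae mu, forall x, ~ square 0 x}.
    apply: filterS2 (dk n) (dk 0%N) => x hn h0 Sx; apply: kn.
    by rewrite -h0// hn//; exact: (square_mono (leq0n n)).
  have N0 : mu.-negligible (square 0) by apply: negligibleS S0 => x Sx /=; exact.
  have := (negligibleP mu (measurable_square lam_gt0 0)).1 N0.
  by have [_ + e] := square_rectangle lam_gt0 0; rewrite e ltxx.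
exists (k 0%N); have := ae_foralln dk; apply: filterS => x h.
by rewrite (quadrant_square lam_gt0) => -[n _ Sx]; rewrite -(k0 n); exact: h.
Qed.

End uniqueness.

(** * The duality *)

Lemma bmo_fin {R : realType} (lam : R) (b : R * R -> R[i]) : (0 < lam)%R -> bmo lam b ->
  exists N : R, [/\ (0 <= N)%R, cmeasurable quadrant b & bmo_norm lam b = N%:E].
Proof.
move=> lam0 [[mb _] bfin]; exists (fine (bmo_norm lam b)); split => //.
  exact/fine_ge0/bmo_norm_ge0.
by rewrite fineK// ge0_fin_numE// bmo_norm_ge0.
Qed.

Theorem theorem3p7 (R : realType) (lam : R) (lam_gt0 : (0 < lam)%R) :
  [/\ forall b : R * R -> R[i], bmo lam b ->
        exists L : (R * R -> R[i]) -> R[i],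
          [/\ h1_dual lam L,
              represents lam b L
            & forall L' : (R * R -> R[i]) -> R[i],
                h1_dual lam L' -> represents lam b L' ->
                forall f : R * R -> R[i], h1 lam f -> L' f = L f],
      forall L : (R * R -> R[i]) -> R[i], h1_dual lam L ->
        exists b : R * R -> R[i],
          [/\ bmo lam b,
              represents lam b L
            & forall b' : R * R -> R[i], bmo lam b' ->
                (represents lam b' L <->
                 exists k : R[i],
                   {ae mulam lam, forall x, quadrant x -> b' x = (b x + k)%R})]
    & exists c C : R,
        [/\ (0 < c)%R, (0 < C)%R
          & forall (b : R * R -> R[i]) (L : (R * R -> R[i]) -> R[i]),
              bmo lam b -> h1_dual lam L -> represents lam b L ->
              c%:E * bmo_norm lam b <= dual_norm lam L /\
              dual_norm lam L <= C%:E * bmo_norm lam b]].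
Proof.
have mQ : measurable (@quadrant R) := measurable_quadrant.
have ib (b : R * R -> R[i]) S : bmo lam b -> rectangle lam S -> cintegrable lam S b.
  move=> /(bmo_fin lam_gt0)[N [_ mb bN]] rS.
  by have [] := bmo_integrable lam_gt0 mb bN rS.
split.
- move=> b /(bmo_fin lam_gt0)[N [N0 mb bN]].
  exists (bmo_functional lam b).
  have dL := bmo_functional_dual lam_gt0 mb bN.
  have bL := bmo_functional_represents lam_gt0 mb bN.
  by split => // L' dL' bL'; exact: (h1_dual_unique lam_gt0 dL dL' bL bL').
- move=> L dL; have [b bb bL] := dual_bmo lam_gt0 dL; exists b; split => // b' bb'.
  have [N [_ mb bN]] := bmo_fin lam_gt0 bb; have [N' [_ mb' bN']] := bmo_fin lam_gt0 bb'.
  split => [b'L|[k bb'k]]; last exact: (represents_shift lam_gt0 dL.1 mb' bL bb'k).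
  have isq n : cintegrable lam (square n) b := ib _ _ bb (square_rectangle lam_gt0 n).
  have isq' n : cintegrable lam (square n) b' := ib _ _ bb' (square_rectangle lam_gt0 n).
  (* Two functions representing the same [L] differ by a function that annihilates every atom. *)
  have [||a aa|k dk] := @annihilator_constant _ _ lam_gt0 (fun x => -1 * b x + b' x)%R.
  + by apply: cmeasurableD => //; exact: cmeasurableZ.
  + move=> n; have mS := measurable_square lam_gt0 n.
    by apply: cintegrableD => //; exact: cintegrableZ.
  + have [i1 e1] := bL _ (atom_span aa); have [i2 e2] := b'L _ (atom_span aa).
    under [X in cintegral _ _ X]eq_fun do rewrite mulrDl -mulrA.
    rewrite cintegralD ?cintegralZ//; last exact: cintegrableZ.
    by rewrite -e1 -e2 mulN1r addNr.
  exists k; apply: filterS dk => x h Qx.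
  by rewrite -(h Qx) mulN1r addrA subrr add0r.
(* The first constant inverts the 4 of [bmo_le_dual]; the second is the bound of
   [bmo_functional]. *)
exists 4^-1%R, 4%R; split => // b L bb dL bL; split.
  by rewrite lee_pdivrMl//; exact: (bmo_le_dual lam_gt0 (fun S => ib b S bb) bL).
have [N [N0 mb bN]] := bmo_fin lam_gt0 bb.
have dL' := bmo_functional_dual lam_gt0 mb bN.
have bL' := bmo_functional_represents lam_gt0 mb bN.
rewrite bN -EFinM; apply: ge_ereal_sup => _ [f [hf nf] <-].
(* By uniqueness the given [L] coincides on h^1 with the functional built from [b], whose bound is
   known. *)
rewrite (h1_dual_unique lam_gt0 dL' dL bL' bL hf).
apply: (le_trans (bmo_functional_bounded lam_gt0 mb bN hf)).
by rewrite -[leRHS]mule1 lee_wpmul2l// lee_fin mulr_ge0.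
Qed.
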